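(* In the genus $1$ setting described in the context, with $k$ a fixed positive integer: (1) Set $\alpha^{(0)}_0=1$. Every sequence of complex numbers $(\alpha^{(r)}_r)_{r\ge1}$ extends uniquely to a family $(\alpha^{(l)}_r)_{0\le r\le l}$ of complex numbers solving the numeric recursion $E^{\pm}_{m,l}=0$ (both signs) for all integers $1\le m\le l$, where $$E^{\pm}_{m,l}=\sum_{r=0}^{m-1}\left(\frac{(\pm2ik)^{m-r}}{2\,(m-r)!}\,\alpha^{(l)}_r-(\pm ik)^{m-r}\,\alpha^{(l-m+r)}_r\right).$$ (2) Consequently, there exist infinitely many $\mathrm{Mod}_\Sigma$-invariant trivialisations of the formal Hitchin-Witten connection $\tilde{\mathcal D}$ of the form $\mathcal R(D)=\sum_{l\ge0}\mathcal R^{(l)}(D)s^{-l}$ with $$\mathcal R^{(l)}(D)=\sum_{r=0}^{l}\alpha^{(l)}_r A^{(l-r)}(D),$$ where $(\alpha^{(l)}_r)$ is a solution of the numeric recursion with $\alpha_0^{(0)}=1$. (3) Any two trivialisations of this form are related by multiplication by a power series in $s^{-1}$ with constant complex coefficients. (4) One particular solution of this form arises as the formal expansion of the explicit trivialisation $\exp(r\Delta)\,\tilde{\boldsymbol\nabla}\,\exp(-r\Delta)=\nabla^{\mathrm{Tr}}$ of the Hitchin-Witten connection: namely $$D\mapsto\exp(-r\Delta)\,D\,\exp(r\Delta)=\sum_{n\ge0}\frac{(-r\,\mathrm{ad}_\Delta)^n(D)}{n!},$$ where $r=\frac1{4k}\log\bigl(-\overline t/t\bigr)$ (the branch with $r\to0$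 as $s\to\infty$) is replaced by its expansion in $s^{-1}$ at $s=\infty$, $$r=\frac1{2k}\sum_{n=0}^\infty\frac{(ik)^{2n+1}}{2n+1}s^{-2n-1}.$$
   Context: Genus 1 setting. $\Sigma$ is a closed oriented smooth surface of genus $1$, $n\ge2$, and $\mathcal M$ is (the smooth part of) the moduli space of flat $SU(n)$-connections on $\Sigma$. In $2\pi$-periodic coordinates on $\Sigma$ every gauge class of flat connections has a representative with constant coefficients in the Cartan subalgebra $\mathfrak t\subset\mathfrak{su}(n)$ of diagonal matrices, and the tangent space of $\mathcal M$ at a smooth point is identified with the space of $1$-forms on $\Sigma$ with constant coefficients in $\mathfrak t$; this gives flat local coordinates on $\mathcal M$. $\omega$ is the Narasimhan-Atiyah-Bott-Goldman symplectic form (a positive multiple of $(a,b)\mapsto-\int_\Sigma\operatorname{Tr}(a\wedge b)$), and $\mathscr L\to\mathcal M$ is the Chern-Simons pre-quantum line bundle: Hermitian with compatible connection $\nabla$ of curvature $-i\omega$; $\mathscr L^k=\mathscr L^{\otimes k}$. $\mathcal T$ is the Teichmüller space of $\Sigma$; each $\sigma\in\mathcal T$ has a representative with constant coefficients, and defines the complex structure $J_\sigma$ on $\mathcal M$ given by the Hodge $*$-operator on $1$-forms, and the Kähler metric $g_\sigma=\omega(\cdot,J_\sigma\cdot)$. All these tensors have coefficients depending only on $\sigma$ in the flat coordinates. $d_{\mathcal T}$ is the exterior differential on $\mathcal T$. For $V$ tangent to $\mathcal T$, with $\tilde g$ the inverse of $g$, $\tilde G(V)=-V[\tilde g]=G(V)+\overline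 G(V)$, with $G(V)$ of type $(2,0)$ and $\overline G(V)$ of type $(0,2)$ on $\mathcal M$. On sections of $\mathscr L^k$: $\Delta=\tilde g^{\mu\nu}\nabla_\mu\nabla_\nu$ is the Laplace operator, and $$b(V)=G(V)^{\mu\nu}\nabla_\mu\nabla_\nu,\qquad \overline b(V)=\overline G(V)^{\mu\nu}\nabla_\mu\nabla_\nu ,$$ so $d_{\mathcal T}\Delta=-(b+\overline b)$. For $t=k+is$, $s\in\mathbb R$, the Hitchin-Witten connection on $C^\infty(\mathcal M,\mathscr L^k)\times\mathcal T\to\mathcal T$ is $\tilde{\boldsymbol\nabla}=\nabla^{\mathrm{Tr}}+\frac1{2t}b-\frac1{2\overline t}\overline b$, where $\nabla^{\mathrm{Tr}}$ is the trivial connection. $\mathrm D_k$ is the algebra of finite-order differential operators acting on $C^\infty(\mathcal M,\mathscr L^k)$ and $\mathscr A_k=\mathrm D_k[[s^{-1}]]$. The formal Hitchin-Witten connection on $\mathscr A_k\times\mathcal T\to\mathcal T$ is $$\tilde{\mathcal D}(D)=d_{\mathcal T}D-\frac1{2k}\sum_{l=1}^\infty(ik)^l\bigl[b-(-1)^l\overline b,D\bigr]s^{-l}.$$ A trivialisation of $\tilde{\mathcal D}$ is a map assigning to each $\sigma$-independent $D\in\mathrm D_k$ a map $\mathcal R(D)=\sum_{l\ge0}\mathcal R^{(l)}(D)s^{-l}\colon\mathcal T\to\mathscr A_k$ with $\mathcal R^{(0)}(D)=D$ and $\tilde{\mathcal D}\,\mathcal R(D)=0$. The mapping class group $\mathrm{Mod}_\Sigma$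 acts on $\mathcal M$, $\mathscr L$ and $\mathcal T$ compatibly with all the structures above, and on $\mathrm D_k$ by conjugation; $\mathcal R$ is $\mathrm{Mod}_\Sigma$-invariant if $\phi\cdot(\mathcal R(D)_\sigma)=\mathcal R(\phi\cdot D)_{\phi\sigma}$ for all $\phi\in\mathrm{Mod}_\Sigma$. For $\sigma$-independent $D\in\mathrm D_k$ and $l\ge0$, with $a:=-\frac i2\Delta$, set $A^{(l)}(D):=\frac{1}{l!}\mathrm{ad}_a^l(D)$ (a map $\mathcal T\to\mathrm D_k$). *)

(* Defs.v *)
From HB Require Import structures.
From mathcomp Require Import all_boot all_order all_algebra all_fingroup.
From mathcomp Require Import all_classical all_reals all_analysis.
From mathcomp.real_closed Require Import complex.

Set Implicit Arguments.
Unset Strict Implicit.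
Unset Printing Implicit Defensive.

Import Order.TTheory GRing.Theory Num.Theory.
Import numFieldNormedType.Exports.

Local Open Scope classical_set_scope.
Local Open Scope ring_scope.
Local Open Scope complex_scope.

(* Flat SU(n)-connections on the torus (R / 2 pi Z)^2, with coordinates x, y.
   A form with constant coefficients in the Cartan subalgebra is
     i diag(u_1, .., u_n) dx + i diag(v_1, .., v_n) dy,
     sum_j u_j = sum_j v_j = 0,
   and is stored as the 2 x (n - 1) real matrix with rows (u_1, .., u_(n-1))
   and (v_1, .., v_(n-1)).  The moduli space is the quotient of this space of
   forms by the gauge transformations exp(i diag(m) x + i diag(l) y), which
   translate by the integral forms (m, l), and by the constant ones
   permuting the diagonal entries (the Weyl group S_n).  Objects on the smooth
   part of the moduli space are represented by their lifts to the covering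
   set [regular] of forms. *)

Definition mx2 (K : Type) (a b c d : K) : 'M[K]_2 :=
  \matrix_(i, j) if i == ord0 then (if j == ord0 then a else b)
                 else (if j == ord0 then c else d).

Section ComplexAnalysis.
Variable R : realType.

(* the explicit imaginary unit, tied to the real and imaginary parts *)
Definition iC : R[i] := 0 +i* 1.

Definition expi (a : R) : R[i] := cos a +i* sin a.

Definition cexp (z : R[i]) : R[i] := (expR (complex.Re z))%:C * expi (complex.Im z).

Definition ccvg (T : Type) (F : set_system T) (u : T -> R[i]) (l : R[i]) : Prop :=
  ((fun x => complex.Re (u x)) @ F --> complex.Re l) /\
  ((fun x => complex.Im (u x)) @ F --> complex.Im l).

Definition cderive (V : normedModType R) (v : V) (f : V -> R[i]) (x : V) : R[i] :=
  ('D_v (fun y => complex.Re (f y)) x) +i* ('D_v (fun y => complex.Im (f y)) x).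

Definition cderivable (V : normedModType R) (f : V -> R[i]) (x v : V) : Prop :=
  derivable (fun y => complex.Re (f y)) x v /\
  derivable (fun y => complex.Im (f y)) x v.

Definition cdifferentiable (V : normedModType R) (f : V -> R[i]) (x : V) : Prop :=
  differentiable (fun y => complex.Re (f y)) x /\
  differentiable (fun y => complex.Im (f y)) x.

End ComplexAnalysis.

Section ModuliSpace.
Variables (R : realType) (n : nat).

Definition oneform : Type := 'M[R]_(2, n.-1).

(* all the n diagonal entries, the last one from the trace condition *)
Definition diag (x : oneform) : 'M[R]_(2, n.-1.+1) :=
  \matrix_(i, j) oapp (x i) (- \sum_l x i l) (unlift ord_max j).

(* omega (a, b) = - (1 / 2 pi) \int Tr (a /\ b), the normalisation for which
   the Chern-Simons line bundle has curvature - i omega *)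
Definition omega (x y : oneform) : R :=
  2 * pi * \sum_j (diag x 0 j * diag y 1 j - diag x 1 j * diag y 0 j).

(* The Weyl group acts freely on the class of x modulo integral forms: no two
   diagonal entries have the same pair of holonomies. *)
Definition regular : set oneform :=
  [set x | forall j l : 'I_(n.-1.+1), j != l ->
     exists i : 'I_2, diag x i j - diag x i l \isn't a Num.int].

Definition weyl (w : 'S_(n.-1.+1)) (x : oneform) : oneform :=
  \matrix_(i, j) diag x i (w (lift ord_max j)).

Definition integral_form (m : 'M[int]_(2, n.-1)) : oneform := map_mx intr m.

Definition e_ (p : 'I_(2 * n.-1)) : oneform := vec_mx (delta_mx 0 p).

Definition partial (p : 'I_(2 * n.-1)) (f : oneform -> R[i]) : oneform -> R[i] :=
  cderive (e_ p : 'M[R]_(2, n.-1)) f.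

Definition partials (w : seq 'I_(2 * n.-1)) (f : oneform -> R[i]) : oneform -> R[i] :=
  foldr partial f w.

(* C^oo on the open set [regular]: all iterated partial derivatives exist and
   are continuous there *)
Definition smooth (f : oneform -> R[i]) : Prop :=
  forall (w : seq 'I_(2 * n.-1)) (x : oneform), regular x ->
    ccvg (nbhs (x : 'M[R]_(2, n.-1))) (partials w f) (partials w f x) /\
    forall p, cderivable (partials w f : 'M[R]_(2, n.-1) -> R[i]) x (e_ p).

(* The Chern-Simons cocycle of the gauge transformation translating by the
   integral form m = (m', m''): the k-th power of
   (-1)^(m' . m'') exp (- (i / 2) omega (x, m)).
   The cocycle is trivial on constant gauge transformations. *)
Definition cocycle (k : nat) (m x : oneform) : R[i] :=
  expi (k%:R * (pi * (\sum_j diag m 0 j * diag m 1 j) - omega x m / 2)).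

(* Smooth sections of the k-th power of the Chern-Simons line bundle.  Only the
   values on [regular] matter: two sections are the same if they agree there. *)
Definition is_section (k : nat) (psi : oneform -> R[i]) : Prop :=
  [/\ smooth psi,
      forall (m : 'M[int]_(2, n.-1)) x, regular x ->
        psi (x + integral_form m) = cocycle k (integral_form m) x * psi x
    & forall w x, regular x -> psi (weyl w x) = psi x].

Definition oper : Type := (oneform -> R[i]) -> (oneform -> R[i]).

(* equality as operators on sections *)
Definition eq_oper (k : nat) (A B : oper) : Prop :=
  forall psi x, is_section k psi -> regular x -> A psi x = B psi x.

(* finite-order differential operators acting on sections *)
Definition is_diffop (k : nat) (D : oper) : Prop :=
  (forall psi, is_section k psi -> is_section k (D psi)) /\
  exists (N : nat) (c : 'I_N -> oneform -> R[i]) (w : 'I_N -> seq 'I_(2 * n.-1)),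
    (forall j, smooth (c j)) /\
    forall psi x, is_section k psi -> regular x ->
      D psi x = \sum_j c j x * partials (w j) psi x.

Definition zero_oper : oper := fun _ _ => 0.

Definition bracket (A B : oper) : oper :=
  fun psi x => A (B psi) x - B (A psi) x.

(* d - (i k / 2) omega (x, dx), of curvature - i k omega *)
Definition nabla (k : nat) (p : 'I_(2 * n.-1)) : oper :=
  fun psi x => partial p psi x - iC R * (k%:R / 2 * omega x (e_ p))%:C * psi x.

Definition second_order (k : nat) (S : 'M[R[i]]_(2 * n.-1)) : oper :=
  fun psi x => \sum_p \sum_q S p q * nabla k p (nabla k q psi) x.

(* Teichmueller space is the upper half-plane: tau = (tau1, tau2) stands for the
   conformal class of the metric |dx + (tau1 + i tau2) dy|^2. *)
Definition teich : set (R * R) := [set tau | 0 < tau.2].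

Definition metric (tau : R * R) : 'M[R]_2 :=
  mx2 1 tau.1 tau.1 (tau.1 ^+ 2 + tau.2 ^+ 2).

(* Hodge star on the coefficient rows of a 1-form a:
   ( *a)_j = sqrt (det h) \sum_i (h^-1 a)_i eps_(i, j),  eps_(0, 1) = 1 *)
Definition hodge (tau : R * R) : 'M[R]_2 :=
  Num.sqrt (\det (metric tau)) *: ((mx2 0 1 (- 1) 0)^T *m invmx (metric tau)).

Definition J (tau : R * R) (x : oneform) : oneform := hodge tau *m x.

Definition kahler (tau : R * R) : 'M[R]_(2 * n.-1) :=
  \matrix_(p, q) omega (e_ p) (J tau (e_ q)).

Definition inv_kahler (tau : R * R) : 'M[R]_(2 * n.-1) := invmx (kahler tau).

Definition V_inv_kahler (v tau : R * R) : 'M[R]_(2 * n.-1) :=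
  \matrix_(p, q) 'D_v (fun tau' => inv_kahler tau' p q) tau.

(* columns: coordinates of the images of the basis vectors *)
Definition Jmx (tau : R * R) : 'M[R[i]]_(2 * n.-1) :=
  \matrix_(p, q) (mxvec (J tau (e_ q)) 0 p)%:C.

Definition proj10 (tau : R * R) : 'M[R[i]]_(2 * n.-1) :=
  2^-1 *: (1%:M - iC R *: Jmx tau).
Definition proj01 (tau : R * R) : 'M[R[i]]_(2 * n.-1) :=
  2^-1 *: (1%:M + iC R *: Jmx tau).

(* the (2,0) and (0,2) parts of - V[inv_kahler] *)
Definition G (v tau : R * R) : 'M[R[i]]_(2 * n.-1) :=
  proj10 tau *m map_mx (real_complex R) (- V_inv_kahler v tau) *m (proj10 tau)^T.
Definition Gbar (v tau : R * R) : 'M[R[i]]_(2 * n.-1) :=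
  proj01 tau *m map_mx (real_complex R) (- V_inv_kahler v tau) *m (proj01 tau)^T.

Definition laplace (k : nat) (tau : R * R) : oper :=
  second_order k (map_mx (real_complex R) (inv_kahler tau)).
Definition b_op (k : nat) (v tau : R * R) : oper := second_order k (G v tau).
Definition bbar_op (k : nat) (v tau : R * R) : oper := second_order k (Gbar v tau).

(* Exterior differential on Teichmueller space of a family of operators,
   evaluated on the tangent vector v; it is taken pointwise on sections. *)
Definition dT (A : R * R -> oper) (v tau : R * R) : oper :=
  fun psi x => cderive v (fun tau' => A tau' psi x) tau.

Definition dT_exists (k : nat) (A : R * R -> oper) (tau : R * R) : Prop :=
  forall psi x, is_section k psi -> regular x ->
    cdifferentiable (fun tau' => A tau' psi x) tau.

Definition ik (k : nat) : R[i] := iC R * k%:R.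

(* A formal series in s^-1 is the sequence F of its coefficients: F l is the
   coefficient of s^-l. *)
Definition formalHW (k : nat) (v : R * R) (F : nat -> R * R -> oper)
    (l : nat) (tau : R * R) : oper :=
  fun psi x => dT (F l) v tau psi x -
    (2 * k%:R)^-1 * \sum_(1 <= j < l.+1) ik k ^+ j *
      bracket (fun phi y => b_op k v tau phi y - (- 1) ^+ j * bbar_op k v tau phi y)
              (F (l - j)%N tau) psi x.

(* R D l tau is the coefficient of s^-l of R(D) at tau; D ranges over operators
   that are differential operators, taken up to equality on sections. *)
Definition opmap : Type := oper -> nat -> R * R -> oper.

Definition trivialisation (k : nat) (T : opmap) : Prop :=
  (forall D D' l tau, is_diffop k D -> is_diffop k D' -> teich tau ->
     eq_oper k D D' -> eq_oper k (T D l tau) (T D' l tau)) /\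
  forall D, is_diffop k D ->
    [/\ forall l tau, teich tau -> is_diffop k (T D l tau),
        forall tau, teich tau -> eq_oper k (T D 0 tau) D,
        forall l tau, teich tau -> dT_exists k (T D l) tau
      & forall v l tau, teich tau ->
          eq_oper k (formalHW k v (T D) l tau) zero_oper].

(* The mapping class group is SL_2(Z), phi = ((a, b), (c, d)) being the class of
   (x, y) |-> (a x + b y, c x + d y).  It acts on forms, and on sections (with
   trivial action on the fibres), by push-forward; it acts on Teichmueller space
   by push-forward of conformal classes. *)
Definition mcg (phi : 'M[int]_2) : Prop := \det phi = 1.

Definition pull_form (phi : 'M[int]_2) (x : oneform) : oneform :=
  (map_mx intr phi)^T *m x.

Definition act_fun (phi : 'M[int]_2) (psi : oneform -> R[i]) : oneform -> R[i] :=
  fun x => psi (pull_form phi x).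

Definition act_oper (phi : 'M[int]_2) (D : oper) : oper :=
  fun psi => act_fun phi (D (act_fun (invmx phi) psi)).

Definition act_teich (phi : 'M[int]_2) (tau : R * R) : R * R :=
  let t := tau.1 +i* tau.2 in
  let t' := ((phi 0 0)%:~R * t - (phi 0 1)%:~R) /
            ((phi 1 1)%:~R - (phi 1 0)%:~R * t) in
  (complex.Re t', complex.Im t').

Definition mcg_invariant (k : nat) (T : opmap) : Prop :=
  forall phi D l tau, mcg phi -> is_diffop k D -> teich tau ->
    eq_oper k (act_oper phi (T D l tau)) (T (act_oper phi D) l (act_teich phi tau)).

Definition a_op (k : nat) (tau : R * R) : oper :=
  fun psi x => - iC R / 2 * laplace k tau psi x.

Definition A_op (k l : nat) (D : oper) (tau : R * R) : oper :=
  fun psi x => (l`!%:R)^-1 * iter l (bracket (a_op k tau)) D psi x.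

Definition of_form (k : nat) (alpha : nat -> nat -> R[i]) (T : opmap) : Prop :=
  forall D l tau, is_diffop k D -> teich tau ->
    eq_oper k (T D l tau)
      (fun psi x => \sum_(r < l.+1) alpha l r * A_op k (l - r) D tau psi x).

End ModuliSpace.

Section Numeric.
Variable R : realType.

(* the sign is + for eps = 1 and - for eps = -1; only alpha l r with r <= l
   is relevant *)
Definition E_ (k : nat) (eps : R[i]) (alpha : nat -> nat -> R[i]) (m l : nat) : R[i] :=
  \sum_(r < m)
    ((eps * 2 * ik R k) ^+ (m - r) / (2 * ((m - r)`!)%:R) * alpha l r
     - (eps * ik R k) ^+ (m - r) * alpha (l - m + r)%N r).

Definition numeric_recursion (k : nat) (alpha : nat -> nat -> R[i]) : Prop :=
  forall m l : nat, (1 <= m <= l)%N ->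
    E_ k 1 alpha m l = 0 /\ E_ k (- 1) alpha m l = 0.

Definition normalised_solution (k : nat) (alpha : nat -> nat -> R[i]) : Prop :=
  alpha 0 0 = 1 /\ numeric_recursion k alpha.

Definition cauchy_prod (f g : nat -> R[i]) (l : nat) : R[i] :=
  \sum_(j < l.+1) f j * g (l - j)%N.

Definition series_pow (f : nat -> R[i]) (m : nat) : nat -> R[i] :=
  iter m (cauchy_prod f) (fun l => (l == 0)%:R).

(* coefficients of the expansion of r in s^-1 *)
Definition r_coef (k j : nat) : R[i] :=
  if odd j then (2 * k%:R)^-1 * (ik R k ^+ j / j%:R) else 0.

Definition level (k : nat) (s : R) : R[i] := k%:R +i* s.

(* r = (1 / 4k) log (- conj t / t), with the branch tending to 0 at infinity *)
Definition is_r (k : nat) (r : R -> R[i]) : Prop :=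
  [/\ forall s, s != 0 -> cexp (4 * k%:R * r s) = - conjc (level k s) / level k s,
      forall s : R, s != 0 -> ccvg (nbhs s) r (r s),
      ccvg (pinfty_nbhs R) r 0
    & ccvg (ninfty_nbhs R) r 0].

End Numeric.

Section ExplicitTrivialisation.
Variables (R : realType) (n : nat).

(* the connection form (1 / 2t) b - (1 / 2 conj t) bbar, for t = k + i s *)
Definition HW_form (k : nat) (s : R) (v tau : R * R) : oper R n :=
  fun psi x => (2 * level k s)^-1 * b_op k v tau psi x
             - (2 * conjc (level k s))^-1 * bbar_op k v tau psi x.

(* the part of order zero in d_T of ad_Delta^m (nabla^Tr + HW_form): the bracket
   [Delta, nabla^Tr_v] is - V[Delta] *)
Definition ad_HW (k : nat) (s : R) (v tau : R * R) (m : nat) : oper R n :=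
  if m is m'.+1 then
    iter m' (bracket (laplace k tau))
      (fun psi x => bracket (laplace k tau) (HW_form k s v tau) psi x
                    - dT (laplace k) v tau psi x)
  else HW_form k s v tau.

(* coefficient of s^-j in the expansion of HW_form at s = oo *)
Definition HW_form_coef (k : nat) (v tau : R * R) (j : nat) : oper R n :=
  fun psi x => if j == 0%N then 0 else
    - (2 * k%:R)^-1 * ik R k ^+ j *
      (b_op k v tau psi x - (- 1) ^+ j * bbar_op k v tau psi x).

(* exp (c A) for a formal series c without constant term, so that only the
   powers c^m with m <= l contribute to the coefficient of s^-l *)
Definition formal_exp (c : nat -> R[i]) (A : oper R n) (l : nat) : oper R n :=
  fun psi x => \sum_(m < l.+1) series_pow c m l / (m`!)%:R * iter m A psi x.

Definition formal_comp (F H : nat -> oper R n) (l : nat) : oper R n :=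
  fun psi x => \sum_(j < l.+1) F j (H (l - j)%N psi) x.

(* nabla^Tr + HW_form, expanded in s^-1, applied to a family of series *)
Definition HW_expansion (k : nat) (v : R * R) (F : R * R -> nat -> oper R n)
    (tau : R * R) (l : nat) : oper R n :=
  fun psi x => dT (fun tau' => F tau' l) v tau psi x
             + formal_comp (HW_form_coef k v tau) (F tau) l psi x.

(* exp (- r ad_Delta) (D), with r replaced by its expansion; as in [formal_exp],
   only the powers m <= l contribute *)
Definition exp_triv (k : nat) : opmap R n :=
  fun D l tau psi x =>
    \sum_(m < l.+1) series_pow (fun j => - r_coef R k j) m l / (m`!)%:R *
      iter m (bracket (laplace k tau)) D psi x.

End ExplicitTrivialisation.

(* Main.v *)
(* With a = - (i / 2) Delta and b, bbar the two parts of - d_T Delta, everything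
   rests on the relations [a, b] = 2 i k b and [a, bbar] = - 2 i k bbar, obtained
   from the curvature of the prequantum connection and the types of G, and on
   d_T a = (i / 2) (b + bbar).  For an operator D independent of tau they give
   d_T (ad_a^m D / m!) as a combination of ad_b and ad_bbar applied to the lower
   powers, with coefficients (+- 2 i k)^(m - r) / (m - r)!, so that the
   flatness equation is term by term the numeric recursion.  The same computation
   with left multiplication in place of the adjoint action proves the formal
   identity for exp (- r Delta).

   The recursion is solved by the coefficients of exp (2 i rho ad_a), where
   rho = - r expands an inverse hyperbolic tangent, and multiplication by a power
   series in s^-1 with constant coefficients acts simply transitively on the
   solutions by changing the diagonal.  Distinct solutions are told apart by the
   identity operator, given a nonzero section; one is obtained by averaging over
   the Weyl group the quasi-periodic extension of a bump function.

   For the non-formal statement, r s = (i / 2k) atan (k / s): two branches of the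
   logarithm differ by a continuous function with values in a discrete set that
   vanishes at infinity. *)

Require Import Defs.
From HB Require Import structures.
From mathcomp Require Import all_boot all_order all_algebra all_fingroup.
From mathcomp Require Import all_classical all_reals all_analysis.
From mathcomp.real_closed Require Import complex.
From mathcomp Require Import ring lra zify.
Set Implicit Arguments.
Unset Strict Implicit.
Unset Printing Implicit Defensive.
Import Order.TTheory GRing.Theory Num.Theory.
Import numFieldNormedType.Exports.
Local Open Scope classical_set_scope.
Local Open Scope ring_scope.
Local Open Scope complex_scope.

(** * Calculus in finite-dimensional spaces *)

(** The obstacle is that operators are arbitrary maps on functions, compared only on sections and at
    regular points, so they do not form an algebra. The linear operators on smooth functions do once
    they are normalised, [rep] ties a raw operator to an element of that algebra, and the commutator
    identities are proved there.

    The eigenvalues come from the product of the inverse Kaehler metric with the curvature - i k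
    omega. This product is i k J; it multiplies (2,0) tensors by - k and (0,2) tensors by k, and the
    commutator of quadratic expressions contributes a factor 4.

    One array can satisfy the recursion for both signs because of the series f = artanh (kappa y) /
    kappa with kappa = i k and y = s^-1: for lam = kappa and for lam = - kappa alike, exp (2 lam f)
    = (1 + lam y) / (1 - lam y). The left side produces the coefficients (2 lam)^j / j! of the
    recursion, the right side its powers lam^j. *)

Section LineCalculus.
Variables (R : realType) (V : normedModType R).
Implicit Types (f g : V -> R) (x v : V).

Lemma is_derive_line f x v (s : R) : derivable f (x + s *: v) v ->
  is_derive s (1 : R) (fun t : R => f (x + t *: v)) ('D_v f (x + s *: v)).
Proof.
have E : (fun h : R => h^-1 *: (((fun t : R => f (x + t *: v)) \o shift s) (h *: (1 : R)) - f (x + s *: v))) =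
   (fun h : R => h^-1 *: ((f \o shift (x + s *: v)) (h *: v) - f (x + s *: v))).
  apply/funext => h /=; congr (_ *: (f _ - _)).
  by rewrite [h%:A]mulr1 scalerDl addrCA addrC addrAC -!addrA.
move=> df; apply: DeriveDef; first by rewrite /derivable E.
by rewrite /derive E.
Qed.

Lemma mean_value_line f x v (t : R) :
  (forall s : R, `|s| <= `|t| -> derivable f (x + s *: v) v) ->
  exists2 s : R, `|s| <= `|t| & f (x + t *: v) - f x = t * 'D_v f (x + s *: v).
Proof.
move=> df; pose g (s : R) := f (x + s *: v).
have dg (s : R) : `|s| <= `|t| -> is_derive s (1 : R) g ('D_v f (x + s *: v)).
  by move=> /df; exact: is_derive_line.
have cg (a b : R) : (forall s, s \in `[a, b] -> `|s| <= `|t|) ->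
    {within `[a, b], continuous g}.
  move=> ab; apply: derivable_within_continuous => s sab.
  by have [] := dg s (ab s sab).
have g0 : g 0 = f x by rewrite /g scale0r addr0.
have [t0|t0] := leP 0 t.
  have bnd (s : R) : s \in `[0, t] -> `|s| <= `|t|.
    by rewrite in_itv /= => /andP[s0 st]; rewrite !ger0_norm.
  have [s|s st E] := @MVT_segment R g (fun s => 'D_v f (x + s *: v)) 0 t t0 _ (cg _ _ bnd).
    by move=> /(@subset_itv_oo_cc _ _ _ _ _) /bnd; exact: dg.
  exists s; first exact: bnd.
  by rewrite -g0 E subr0 mulrC.
have bnd (s : R) : s \in `[t, 0] -> `|s| <= `|t|.
  rewrite in_itv /= => /andP[st s0]; rewrite !ler0_norm ?lerN2 //.
  exact: ltW.
have [s|s st E] := @MVT_segment R g (fun s => 'D_v f (x + s *: v)) t 0 (ltW t0) _ (cg _ _ bnd).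
  by move=> /(@subset_itv_oo_cc _ _ _ _ _) /bnd; exact: dg.
exists s; first exact: bnd.
by rewrite -g0 -opprB E sub0r mulrN opprK mulrC.
Qed.

Lemma is_derive_translate f x v w : derivable f (x + w) v ->
  is_derive x v (fun y => f (y + w)) ('D_v f (x + w)).
Proof.
have E : (fun h : R => h^-1 *: (((fun y => f (y + w)) \o shift x) (h *: v) - f (x + w))) =
   (fun h : R => h^-1 *: ((f \o shift (x + w)) (h *: v) - f (x + w))).
  by apply/funext => h /=; rewrite addrA.
move=> df; apply: DeriveDef; first by rewrite /derivable E.
by rewrite /derive E.
Qed.

(** The mean value theorem is used twice: along u for the increment of [f] by h v, then along v for
    the derivative of [f] in direction u. *)
Lemma second_difference f x u v (h : R) :
  (forall s t : R, `|s| <= `|h| -> `|t| <= `|h| ->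
     derivable f (x + s *: u + t *: v) u /\ derivable ('D_u f) (x + s *: u + t *: v) v) ->
  exists s t : R, [/\ `|s| <= `|h|, `|t| <= `|h| &
   f (x + h *: u + h *: v) - f (x + h *: u) - f (x + h *: v) + f x =
   h * (h * 'D_v ('D_u f) (x + s *: u + t *: v))].
Proof.
move=> nd; have h0 : `|(0 : R)| <= `|h| by rewrite normr0.
pose g y := f (y + h *: v) - f y.
have dg (s : R) : `|s| <= `|h| -> is_derive (x + s *: u) u g
    ('D_u f (x + s *: u + h *: v) - 'D_u f (x + s *: u)).
  move=> sh; have [d1 _] := nd _ _ sh h0.
  have [d2 _] := nd _ _ sh (lexx _).
  rewrite scale0r addr0 in d1.
  apply: (@is_deriveB _ _ _ (fun y => f (y + h *: v)) f) (derivableP d1).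
  exact: is_derive_translate.
have dg' (s : R) : `|s| <= `|h| -> derivable g (x + s *: u) u by move=> /dg [].
have [s sh E] := mean_value_line dg'.
have [t th E'] := @mean_value_line ('D_u f) (x + s *: u) v h
  (fun t th => (nd s t sh th).2).
exists s, t; split => //; have [_ gs] := dg s sh.
rewrite -E' -gs -E /g; ring.
Qed.

(* Both mixed derivatives are values, at points tending to x, of the second
   difference of f over the parallelogram spanned by h u and h v. *)
Lemma derive_comm f x u v :
  (\forall y \near x, [/\ derivable f y u, derivable f y v,
     derivable ('D_u f) y v & derivable ('D_v f) y u]) ->
  {for x, continuous ('D_v ('D_u f))} -> {for x, continuous ('D_u ('D_v f))} ->
  'D_v ('D_u f) x = 'D_u ('D_v f) x.
Proof.
move=> nf cuv cvu; apply/eqP; rewrite -subr_eq0 -normr_le0.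
apply/ler_addgt0Pr => _ /posnumP[e]; rewrite add0r.
have e2 : 0 < e%:num / 2 by [].
have /cvgrPdist_le /(_ _ e2) n1 := cuv.
have /cvgrPdist_le /(_ _ e2) n2 := cvu.
have [d /= d0 nd] := (nbhs_normP _ _).1 (filterI nf (filterI n1 n2)).
have c0 : 0 < `|u| + `|v| + 1 by rewrite ltr_wpDl ?addr_ge0.
(* The sides h u and h v are together shorter than d, so the whole parallelogram lies in the ball;
   the summand 1 covers u = v = 0. *)
pose h := d / (2 * (`|u| + `|v| + 1)).
have h0 : 0 < h by rewrite divr_gt0 // mulr_gt0.
have hc : h * (`|u| + `|v|) < d.
  rewrite /h mulrAC ltr_pdivrMr ?mulr_gt0 // ltr_pM2l //; lra.
have near_x (s t : R) : `|s| <= `|h| -> `|t| <= `|h| ->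
    ball_ Num.Def.normr x d (x + s *: u + t *: v).
  rewrite (gtr0_norm h0) /= => sh th; rewrite -addrA opprD addrA subrr sub0r normrN.
  apply: le_lt_trans hc; apply: le_trans (ler_normD _ _) _.
  by rewrite !normrZ mulrDr lerD // ler_wpM2r.
have [s|s [t [sh th D]]] := @second_difference f x u v h.
  move=> t sh th; case: (nd _ (near_x _ _ sh th)) => [[d1 d2 d3 d4] _].
  exact: (conj d1 d3).
have near_x' (s' t' : R) : `|s'| <= `|h| -> `|t'| <= `|h| ->
    ball_ Num.Def.normr x d (x + s' *: v + t' *: u).
  by move=> sh' th'; rewrite addrAC; apply: near_x.
have [s'|s' [t' [sh' th' D']]] := @second_difference f x v u h.
  move=> t' sh' th'; case: (nd _ (near_x' _ _ sh' th')) => [[d1 d2 d3 d4] _].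
  exact: (conj d2 d4).
have [_ [b1 _]] := nd _ (near_x _ _ sh th).
have [_ [_ b2]] := nd _ (near_x' _ _ sh' th').
have {D'} : h * (h * 'D_v ('D_u f) (x + s *: u + t *: v)) =
    h * (h * 'D_u ('D_v f) (x + s' *: v + t' *: u)).
  apply: etrans (esym D) (etrans _ D').
  by rewrite [x + h *: v + h *: u]addrAC; congr (_ + _); exact: addrAC.
move=> /(mulfI (lt0r_neq0 h0)) /(mulfI (lt0r_neq0 h0)) ab.
move: b1 b2; rewrite -ab /=; set c := 'D_v ('D_u f) (x + _ + _) => b1 b2.
apply: le_trans (ler_distD c _ _) _; rewrite [leRHS]splitr [X in _ + X]distrC.
exact: lerD b1 b2.
Qed.

(** The little-o expansion is a local condition, so the differential of [f] at x also serves [g],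
    and uniqueness identifies it with the differential of [g]. *)
Lemma near_eq_differentiable f g x :
  (\forall y \near x, f y = g y) -> differentiable f x -> differentiable g x.
Proof.
move=> fg df.
have fx : f x = g x by exact: nbhs_singleton fg.
have E : g \o shift x = cst (g x) + 'd f x +o_ (0 : V) id.
  have [_ /eqaddoP H] := (diff_locallyP _ _).1 df.
  apply/eqaddoP => e e0; move: (H e e0); apply: filter_app.
  have : \forall h \near (0 : V), f (h + x) = g (h + x).
    by move: fg; rewrite (near_shift 0) subr0; apply: filterS => y /=.
  apply: filterS => h fgh; rewrite /= -![(_ + _ : _ -> _) _]/(_ + _) -![(- _ : _ -> _) _]/(- _).
  by rewrite /= -![(_ + _ : _ -> _) _]/(_ + _) /cst /= fgh fx.
have [dc _] := (diff_locallyP _ _).1 df.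
by apply/diff_locallyP; rewrite (diff_unique dc E).
Qed.

End LineCalculus.

(** * Partial derivatives and total differentiability *)

Section MatrixCalculus.
Variables (R : realType) (m n : nat).
Local Notation M := 'M[R]_(m, n).
Implicit Types (f : M -> R) (x : M).

Definition basis_mx (p : 'I_(m * n)) : M := vec_mx (delta_mx 0 p).

Lemma sum_basis_mx x : x = \sum_p mxvec x 0 p *: basis_mx p.
Proof.
rewrite -[LHS]mxvecK [mxvec x in LHS]row_sum_delta linear_sum /=.
by apply: eq_bigr => p _; rewrite linearZ.
Qed.

Lemma le_norm_mx (A B : M) : (forall i j, `|A i j| <= `|B i j|) -> `|A| <= `|B|.
Proof.
move=> AB; rewrite [leLHS]/Num.Def.normr [leRHS]/Num.Def.normr /= !mx_normrE.
apply/bigmax_leP; split=> [|[i j] _ /=]; first exact: bigmax_ge_id.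
by rewrite (le_trans (AB i j)) // (le_bigmax _ (fun ij : 'I_m * 'I_n => `|B ij.1 ij.2|) (i, j)).
Qed.

Lemma norm_entry_le (A : M) i j : `|A i j| <= `|A|.
Proof.
rewrite [leRHS]/Num.Def.normr /= mx_normrE.
exact: (le_bigmax _ (fun ij : 'I_m * 'I_n => `|A ij.1 ij.2|) (i, j)).
Qed.

Lemma mxvec_entry_continuous p : continuous (fun x : M => mxvec x 0 p).
Proof.
case/mxvec_indexP: p => i j.
under eq_fun do rewrite mxvecE.
exact: coord_continuous.
Qed.

(* The increment of f is split along the partial sums of the expansion of h in
   the basis; the mean value theorem applies to each piece. *)
Lemma partials_differentiable f x :
  (forall p, \forall y \near x, derivable f y (basis_mx p)) ->
  (forall p, {for x, continuous ('D_(basis_mx p) f)}) ->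
  differentiable f x /\ forall v, 'D_v f x = \sum_p mxvec v 0 p * 'D_(basis_mx p) f x.
Proof.
move=> nf cf.
pose L (h : M) : R := \sum_p mxvec h 0 p * 'D_(basis_mx p) f x.
have Llin : linear L.
  move=> a u v; rewrite /L scaler_sumr -big_split /=; apply: eq_bigr => p _.
  by rewrite linearP !mxE mulrDl /GRing.scale /= mulrA.
pose LL : {linear M -> R} := HB.pack L (GRing.isLinear.Build _ _ _ _ L Llin).
have Lc : continuous LL.
  apply: (@continuous_big _ _ (@GRing.add R)); first exact: add_continuous.
  move=> p _ h; apply: (@continuousM _ _ (fun x => mxvec x 0 p) (fun=> 'D_(basis_mx p) f x)).
    exact: mxvec_entry_continuous.
  exact: cst_continuous.
have exp : f \o shift x = cst (f x) + LL +o_ (0 : M) id.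
  apply/eqaddoP => _ /posnumP[e].
  (* Each of the m n pieces may contribute e |h| / c; the successor keeps c positive for empty
     matrices. *)
  pose c : R := (m * n).+1%:R.
  have ec : 0 < e%:num / c by rewrite divr_gt0.
  have : \forall y \near x, forall p, derivable f y (basis_mx p) /\
      `|'D_(basis_mx p) f x - 'D_(basis_mx p) f y| <= e%:num / c.
    apply: (@filter_forall _ _ (fun p y => derivable f y (basis_mx p) /\
      `|'D_(basis_mx p) f x - 'D_(basis_mx p) f y| <= e%:num / c) (nbhs x) _) => p.
    apply: filterI; first exact: nf.
    by have /cvgrPdist_le := cf p; apply.
  move=> /nbhs_normP [d /= d0 nd].
  have near0 : \forall h \near (0 : M), `|h| < d.
    by apply: (nbhs_normP (0 : M) (fun h => `|h| < d)).2; exists d => //= y /=; rewrite sub0r normrN.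
  apply: filterS near0 => h hd.
  pose w (q : nat) : M := \matrix_(i, j) (if (mxvec_index i j < q)%N then h i j else 0).
  have w0 : w 0%N = 0 by apply/matrixP => i j; rewrite !mxE.
  have wS (p : 'I_(m * n)) : w p.+1 = w p + mxvec h 0 p *: basis_mx p.
    case/mxvec_indexP: p => i j; rewrite mxvecE.
    apply/matrixP => i' j'; rewrite !mxE eqxx /= ltnS leq_eqVlt -val_eqE /=.
    have [E|_] /= := eqVneq (val (mxvec_index i' j')) (val (mxvec_index i j)); last first.
      by rewrite mulr0 addr0.
    rewrite /= in E; rewrite E ltnn add0r mulr1.
    have /(congr1 (fun q => mxvec h 0 q)) : mxvec_index i' j' = mxvec_index i j by apply: val_inj.
    by rewrite !mxvecE.
  have wmn : w (m * n)%N = h.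
    by apply/matrixP => i j; rewrite !mxE ltn_ord.
  have near_w (p : 'I_(m * n)) (s : R) : `|s| <= `|mxvec h 0 p| ->
      ball_ Num.Def.normr x d (x + w p + s *: basis_mx p).
    rewrite /= -addrA opprD addrA subrr sub0r normrN => sp.
    apply: le_lt_trans hd; apply: le_norm_mx => i j; rewrite !mxE eqxx /=.
    have [E|_] := eqVneq (mxvec_index i j) p; last first.
      by rewrite mulr0 addr0; case: ifP => //; rewrite normr0.
    by rewrite -E ltnn add0r mulr1 (le_trans sp) // -E mxvecE.
  have step (p : 'I_(m * n)) :
     `|f (x + w p.+1) - f (x + w p) - mxvec h 0 p * 'D_(basis_mx p) f x| <=
       (e%:num / c) * `|h|.
    have [s sp E] := @mean_value_line _ _ f (x + w p) (basis_mx p) (mxvec h 0 p)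
       (fun s sp => (nd _ (near_w p s sp) p).1).
    rewrite wS addrA E -mulrBr normrM mulrC ler_pM //.
      by rewrite distrC; exact: (nd _ (near_w p s sp) p).2.
    by case/mxvec_indexP: p {E sp} => i j; rewrite mxvecE norm_entry_le.
  have tele : f (x + h) - f x = \sum_(p < m * n) (f (x + w p.+1) - f (x + w p)).
    rewrite -(big_mkord xpredT (fun p => f (x + w p.+1) - f (x + w p))).
    by rewrite telescope_sumr // wmn w0 addr0.
  rewrite /= -![(_ + _ : _ -> _) _]/(_ + _) -![(- _ : _ -> _) _]/(- _) /cst /=.
  rewrite [h + x]addrC opprD addrA tele /LL /= /L -sumrB.
  apply: le_trans (ler_norm_sum _ _ _) _.
  apply: le_trans (ler_sum _ (fun p _ => step p)) _.
  rewrite sumr_const card_ord -mulr_natl mulrA ler_wpM2r //.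
  rewrite mulrC mulrAC ler_pdivrMr //.
  by rewrite ler_pM2l // /c ler_nat.
have dE := diff_unique Lc exp.
have df : differentiable f x.
  by apply/diff_locallyP; rewrite dE.
by split=> // v; rewrite deriveE // dE.
Qed.

Lemma linear_mx_continuous (W : normedModType R) (L : {linear M -> W}) : continuous L.
Proof.
have -> : (L : M -> W) = (fun x => \sum_p mxvec x 0 p *: L (basis_mx p)).
  apply/funext => x; rewrite {1}[x]sum_basis_mx linear_sum /=.
  by apply: eq_bigr => p _; rewrite linearZ.
apply: (@continuous_big _ _ (@GRing.add W)); first exact: add_continuous.
move=> p _ h; apply: (@continuousZl _ _ _ (fun x => mxvec x 0 p)).
exact: mxvec_entry_continuous.
Qed.

Lemma linear_mx_differentiable (W : normedModType R) (L : {linear M -> W}) x :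
  differentiable L x.
Proof. exact/linear_differentiable/linear_mx_continuous. Qed.

Lemma differentiable_affine (W : normedModType R) (L : {linear M -> W}) (c : W) x :
  differentiable (fun y => L y + c) x.
Proof.
apply: (@differentiableD _ _ _ L (cst c)); first exact: linear_mx_differentiable.
exact: differentiable_cst.
Qed.

Lemma differentiable_comp_affine (W : normedModType R) (L : {linear M -> W}) (c : W)
    (f : W -> R) x : differentiable f (L x + c) ->
  differentiable (fun y => f (L y + c)) x.
Proof.
move=> df; apply: (@differentiable_comp _ _ _ _ (fun y => L y + c) f) => //.
exact: differentiable_affine.
Qed.

Lemma derive_comp_affine (W : normedModType R) (L : {linear M -> W}) (c : W)
    (f : W -> R) x v : differentiable f (L x + c) ->
  'D_v (fun y => f (L y + c)) x = 'D_(L v) f (L x + c).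
Proof.
move=> df; rewrite !deriveE //; last exact: differentiable_comp_affine.
rewrite (@diff_comp _ _ _ _ (fun y => L y + c) f) //; last exact: differentiable_affine.
rewrite /= (@diffD _ _ _ L (cst c)) ?diff_cst ?diff_lin //=.
- by rewrite /GRing.add_fun /= addr0.
- exact: linear_mx_continuous.
- exact: linear_mx_differentiable.
Qed.

Lemma derive_basis f x v : differentiable f x ->
  'D_v f x = \sum_p mxvec v 0 p * 'D_(basis_mx p) f x.
Proof.
move=> df; rewrite {1}deriveE // {1}[v]sum_basis_mx linear_sum /=.
by apply: eq_bigr => p _; rewrite linearZ deriveE.
Qed.

End MatrixCalculus.

(** * Smooth functions on the regular set *)

Section Smoothness.
Variables (R : realType) (n : nat).
Local Notation M := 'M[R]_(2, n.-1).
Local Notation U := (@regular R n).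

(** The matrix of [diag]; it brings the diagonal entries, the Weyl group and the symplectic form
    within reach of matrix algebra. *)
Definition trace_free : 'M[R]_(n.-1, n.-1.+1) :=
  \matrix_(l, j) oapp (fun j' => (l == j')%:R) (- 1) (unlift ord_max j).

Lemma diagE (x : oneform R n) : diag x = (x : M) *m trace_free.
Proof.
apply/matrixP => i j; rewrite !mxE.
case: (unliftP ord_max j) => [j'|] -> /=; last first.
  under [RHS]eq_bigr => l _ do rewrite mxE unlift_none /= mulrN1.
  by rewrite sumrN.
under [RHS]eq_bigr => l _ do rewrite mxE liftK /=.
rewrite (bigD1 j') //= eqxx mulr1 big1 ?addr0 // => l /negPf ->.
by rewrite mulr0.
Qed.

Lemma near_not_int (z : R) : z \isn't a Num.int ->
  \forall y \near z, y \isn't a Num.int.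
Proof.
move=> zN; have zf : (Num.floor z)%:~R != z by rewrite -intrEfloor.
have z_itv : z \in `](Num.floor z)%:~R, (Num.floor z + 1)%:~R[.
  by rewrite in_itv /= floorD1_gt andbT lt_neqAle zf floor_le.
near=> y; apply/negP => /intrP[m ym].
have : y \in `](Num.floor z)%:~R, (Num.floor z + 1)%:~R[.
  by near: y; exact: near_in_itvoo.
by rewrite in_itv /= ym !ltr_int => /andP[zm]; rewrite ltzD1 leNgt zm.
Unshelve. all: by end_near. Qed.

(** Only finitely many pairs of entries occur, and for each of them being non-integral is an open
    condition. *)
Lemma near_regular (x : M) : U x -> \forall y \near x, U y.
Proof.
move=> Ux; apply: (@filter_forall _ _ (fun j (y : M) => forall l, j != l -> exists i,
   diag y i j - diag y i l \isn't a Num.int) (nbhs x) _) => j.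
apply: (@filter_forall _ _ (fun l (y : M) => j != l -> exists i,
   diag y i j - diag y i l \isn't a Num.int) (nbhs x) _) => l.
apply: filter_imply => jl; have [i xi] := Ux j l jl.
have cont : continuous (fun y : M => diag y i j - diag y i l).
  have lin : linear (fun y : M => diag y i j - diag y i l).
    by move=> a u v; rewrite !diagE mulmxDl -scalemxAl !mxE /GRing.scale /=; ring.
  exact: (@linear_mx_continuous _ _ _ _ (HB.pack (fun y : M => diag y i j - diag y i l) (GRing.isLinear.Build _ _ _ _ _ lin))).
have H : \forall y \near x, diag y i j - diag y i l \isn't a Num.int :=
  cont x _ (near_not_int xi).
by apply: filterS H => y ?; exists i.
Qed.

Definition rpartials (w : seq 'I_(2 * n.-1)) (f : M -> R) : M -> R :=
  foldr (fun p g => 'D_(basis_mx R p) g) f w.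

(** Total differentiability of the iterated partial derivatives, in place of their existence and
    continuity: this is the form that the chain rule consumes. [smoothP] shows that nothing
    changes. *)
Definition rsmooth (f : M -> R) : Prop :=
  forall w x, U x -> differentiable (rpartials w f) x.

Lemma rpartials_eq (f g : M -> R) w : (forall x, U x -> f x = g x) ->
  forall x, U x -> rpartials w f x = rpartials w g x.
Proof.
move=> fg; elim: w => [|p w IH] //= x Ux.
by apply: near_eq_derive; apply: filterS (near_regular Ux).
Qed.

Lemma rpartials_rcons (f : M -> R) w p :
  rpartials (rcons w p) f = rpartials w ('D_(basis_mx R p) f).
Proof. by rewrite /rpartials foldr_rcons. Qed.

(** The induction peels off the innermost derivative, the one that acts on a member of [K]. This is
    coinduction, with [K] an invariant stable under derivation up to equality on the regular set. *)
Lemma rsmooth_coind (K : (M -> R) -> Prop) :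
  (forall f, K f -> forall x, U x -> differentiable f x) ->
  (forall f p, K f -> exists2 g, K g & forall x, U x -> 'D_(basis_mx R p) f x = g x) ->
  forall f, K f -> rsmooth f.
Proof.
move=> Kd Kp f Kf w; elim/last_ind: w f Kf => [|w p IH] f Kf x Ux; first exact: Kd.
rewrite rpartials_rcons; have [g Kg fg] := Kp f p Kf.
apply: (@near_eq_differentiable _ _ (rpartials w g)); last exact: IH.
by apply: filterS (near_regular Ux) => y; apply: rpartials_eq => z /fg.
Qed.

(** A coinductive form of C^oo on the line: some class containing [h] is closed under
    differentiation. For the functions met below such a class is explicit. *)
Definition smooth1 (h : R -> R) : Prop :=
  exists2 K : (R -> R) -> Prop, K h &
    forall g, K g -> exists2 g', K g' & forall t, is_derive t (1 : R) g (g' t).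

(** A syntax stable under partial derivatives, so that [rsmooth_coind] treats the whole class at
    once. Affine inner maps suffice for translations, the Weyl group, the mapping class group and
    the cocycle. *)
Inductive smooth_expr : (M -> R) -> Prop :=
| smooth_expr_cst c : smooth_expr (fun=> c)
| smooth_expr_comp f (L : {linear M -> M}) c : rsmooth f ->
    (forall x, U x -> U (L x + c)) -> smooth_expr (fun x => f (L x + c))
| smooth_expr_comp1 h (l : {linear M -> R}) c : smooth1 h ->
    smooth_expr (fun x => h (l x + c))
| smooth_expr_add f g : smooth_expr f -> smooth_expr g -> smooth_expr (fun x => f x + g x)
| smooth_expr_mul f g : smooth_expr f -> smooth_expr g -> smooth_expr (fun x => f x * g x).

Lemma smooth_expr_sum (I : Type) (r : seq I) (F : I -> M -> R) :
  (forall i, smooth_expr (F i)) -> smooth_expr (fun x => \sum_(i <- r) F i x).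
Proof.
move=> KF; elim: r => [|i r IH].
  by under eq_fun do rewrite big_nil; exact: smooth_expr_cst.
by under eq_fun do rewrite big_cons; exact: smooth_expr_add.
Qed.

Lemma smooth_expr_differentiable f : smooth_expr f -> forall x, U x -> differentiable f x.
Proof.
elim=> {f} [c|f L c sf LU|h l c [K Kh Kd]|f g _ IHf _ IHg|f g _ IHf _ IHg] x Ux.
- exact: differentiable_cst.
- by apply: differentiable_comp_affine; exact: (sf [::] _ (LU _ Ux)).
- apply: differentiable_comp_affine; apply/derivable1_diffP.
  by have [h' _ dh] := Kd _ Kh; case: (dh (l x + c)).
- exact: differentiableD (IHf _ Ux) (IHg _ Ux).
- exact: differentiableM (IHf _ Ux) (IHg _ Ux).
Qed.

Lemma smooth_expr_derive f p : smooth_expr f ->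
  exists2 g, smooth_expr g & forall x, U x -> 'D_(basis_mx R p) f x = g x.
Proof.
elim=> {f} [c|f L c sf LU|h l c [K Kh Kd]|f g Kf [f' Kf' IHf] Kg [g' Kg' IHg]|
    f g Kf [f' Kf' IHf] Kg [g' Kg' IHg]].
- by exists (fun=> 0) => [|x _]; [exact: smooth_expr_cst|exact: derive_cst].
- exists (fun x => \sum_q mxvec (L (basis_mx R p)) 0 q * 'D_(basis_mx R q) f (L x + c)).
    apply: smooth_expr_sum => q; apply: smooth_expr_mul; first exact: smooth_expr_cst.
    apply: (@smooth_expr_comp ('D_(basis_mx R q) f)) => // w x Ux.
    by rewrite -rpartials_rcons; exact: sf.
  move=> x Ux; have df := sf [::] _ (LU _ Ux).
  by rewrite derive_comp_affine // derive_basis.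
- have [h' Kh' dh] := Kd _ Kh.
  exists (fun x => l (basis_mx R p) * h' (l x + c)).
    apply: smooth_expr_mul; first exact: smooth_expr_cst.
    by apply: smooth_expr_comp1; exists K.
  move=> x _; have [dd <-] := dh (l x + c).
  have df : differentiable h (l x + c) by apply/derivable1_diffP.
  rewrite derive_comp_affine // !deriveE // -{1}[l _]mulr1 -[l _ * 1]/(l _ *: (1 : R)).
  by rewrite linearZ.
- exists (fun x => f' x + g' x); first exact: smooth_expr_add.
  move=> x Ux; rewrite -IHf // -IHg //.
  rewrite (@deriveD _ _ _ f g) //; apply: diff_derivable;
    exact: smooth_expr_differentiable.
- exists (fun x => f x * g' x + g x * f' x).
    by apply: smooth_expr_add; apply: smooth_expr_mul.
  move=> x Ux; rewrite -IHf // -IHg //.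
  rewrite (@deriveM _ _ f g) //; apply: diff_derivable;
    exact: smooth_expr_differentiable.
Qed.

Lemma smooth_expr_rsmooth f : smooth_expr f -> rsmooth f.
Proof.
move: f; apply: rsmooth_coind => [f Kf|f p Kf]; first exact: smooth_expr_differentiable.
exact: smooth_expr_derive.
Qed.

Lemma partials_ReIm w (f : oneform R n -> R[i]) x :
  partials w f x = rpartials w (fun y => complex.Re (f y)) x +i*
                   rpartials w (fun y => complex.Im (f y)) x.
Proof.
elim: w x => [|p w IH] x /=; first by case: (f x).
rewrite /partial /cderive; congr (_ +i* _).
  by congr ('D__ _ _); apply/funext => y; rewrite IH.
by congr ('D__ _ _); apply/funext => y; rewrite IH.
Qed.

(** From left to right, [partials_differentiable] is applied to each iterated derivative, whose own
    partial derivatives are continuous on the open regular set. *)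
Lemma smoothP (f : oneform R n -> R[i]) : smooth f <->
  rsmooth (fun y => complex.Re (f y)) /\ rsmooth (fun y => complex.Im (f y)).
Proof.
split=> [sf|[s1 s2] w x Ux]; last first.
  split.
    split; rewrite partials_ReIm /=; under eq_fun do rewrite partials_ReIm /=;
      apply: differentiable_continuous; [exact: s1|exact: s2].
  move=> p; split; rewrite /=; under eq_fun do rewrite partials_ReIm /=;
    apply: diff_derivable; [exact: s1|exact: s2].
have cont w x : U x -> {for x, continuous (rpartials w (fun y => complex.Re (f y)))} /\
                       {for x, continuous (rpartials w (fun y => complex.Im (f y)))}.
  move=> Ux; have [[c1 c2] _] := sf w x Ux; split.
    by move: c1; rewrite partials_ReIm /=; under eq_fun do rewrite partials_ReIm /=.
  by move: c2; rewrite partials_ReIm /=; under eq_fun do rewrite partials_ReIm /=.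
have der w x p : U x -> derivable (rpartials w (fun y => complex.Re (f y))) x (basis_mx R p) /\
                       derivable (rpartials w (fun y => complex.Im (f y))) x (basis_mx R p).
  move=> Ux; have [_ /(_ p) [c1 c2]] := sf w x Ux; split.
    by move: c1; under eq_fun do rewrite partials_ReIm /=.
  by move: c2; under eq_fun do rewrite partials_ReIm /=.
split=> w x Ux; apply: (proj1 (partials_differentiable _ _)) => p.
- by apply: filterS (near_regular Ux) => y Uy; case: (der w y p Uy).
- by case: (cont (p :: w) x Ux).
- by apply: filterS (near_regular Ux) => y Uy; case: (der w y p Uy).
- by case: (cont (p :: w) x Ux).
Qed.

End Smoothness.

(** * Closure properties and partial derivatives of complex smooth functions *)

Section ComplexSmoothness.
Variables (R : realType) (n : nat).
Local Notation M := 'M[R]_(2, n.-1).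
Local Notation U := (@regular R n).
Implicit Types (f g : oneform R n -> R[i]).

Lemma ReM (x y : R[i]) : complex.Re (x * y) =
  complex.Re x * complex.Re y + (- 1) * (complex.Im x * complex.Im y).
Proof. by case: x => a b; case: y => c d; rewrite mulN1r. Qed.

Lemma ImM (x y : R[i]) : complex.Im (x * y) =
  complex.Re x * complex.Im y + complex.Im x * complex.Re y.
Proof. by case: x => a b; case: y => c d. Qed.

Lemma ReD (x y : R[i]) : complex.Re (x + y) = complex.Re x + complex.Re y.
Proof. by case: x => a b; case: y => c d. Qed.

Lemma ImD (x y : R[i]) : complex.Im (x + y) = complex.Im x + complex.Im y.
Proof. by case: x => a b; case: y => c d. Qed.

Lemma eqC_ReIm (x y : R[i]) :
  complex.Re x = complex.Re y -> complex.Im x = complex.Im y -> x = y.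
Proof. by case: x => a b; case: y => c d /= -> ->. Qed.

Lemma smooth_exprs f : smooth_expr (fun x : M => complex.Re (f x)) ->
  smooth_expr (fun x : M => complex.Im (f x)) -> smooth f.
Proof. by move=> sr si; apply/smoothP; split; apply: smooth_expr_rsmooth. Qed.

Lemma smooth_exprP f : smooth f -> smooth_expr (fun x : M => complex.Re (f x)) /\
  smooth_expr (fun x : M => complex.Im (f x)).
Proof.
have id_lin : linear (@idfun M) by [].
pose id' : {linear M -> M} := HB.pack (@idfun M) (GRing.isLinear.Build _ _ _ _ _ id_lin).
have base (h : M -> R) : rsmooth h -> smooth_expr h.
  move=> sh; have -> : h = (fun x => h (id' x + 0)) by apply/funext => x; rewrite addr0.
  by apply: (@smooth_expr_comp _ _ h id') => // x; rewrite addr0.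
by move=> /smoothP[s1 s2]; split; apply: base.
Qed.

Lemma smooth_local f g : (forall x, U x -> f x = g x) -> smooth f -> smooth g.
Proof.
move=> fg /smoothP[s1 s2]; apply/smoothP.
have loc (h k : M -> R) : (forall x, U x -> h x = k x) -> rsmooth h -> rsmooth k.
  move=> hk sh w x Ux; apply: near_eq_differentiable (sh w x Ux).
  by apply: filterS (near_regular Ux) => y; apply: rpartials_eq.
by split; [apply: loc s1|apply: loc s2] => x Ux; rewrite fg.
Qed.

Lemma smooth_cst c : smooth (fun _ : oneform R n => c).
Proof. by apply: smooth_exprs; apply: smooth_expr_cst. Qed.

Lemma smoothD f g : smooth f -> smooth g -> smooth (fun x => f x + g x).
Proof.
move=> /smooth_exprP[f1 f2] /smooth_exprP[g1 g2]; apply: smooth_exprs.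
  by under eq_fun do rewrite ReD; exact: smooth_expr_add.
by under eq_fun do rewrite ImD; exact: smooth_expr_add.
Qed.

Lemma smoothM f g : smooth f -> smooth g -> smooth (fun x => f x * g x).
Proof.
move=> /smooth_exprP[f1 f2] /smooth_exprP[g1 g2]; apply: smooth_exprs.
  under eq_fun do rewrite ReM.
  apply: smooth_expr_add; first exact: smooth_expr_mul.
  apply: smooth_expr_mul; first exact: smooth_expr_cst.
  exact: smooth_expr_mul.
by under eq_fun do rewrite ImM; apply: smooth_expr_add; apply: smooth_expr_mul.
Qed.

Lemma smooth_lin c f g : smooth f -> smooth g -> smooth (fun x => c * f x + g x).
Proof.
move=> sf sg; exact: (smoothD (smoothM (smooth_cst c) sf) sg).
Qed.

Lemma smooth_sum (I : Type) (r : seq I) (F : I -> oneform R n -> R[i]) :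
  (forall i, smooth (F i)) -> smooth (fun x => \sum_(i <- r) F i x).
Proof.
move=> sF; elim: r => [|i r IH].
  under eq_fun do rewrite big_nil; exact: smooth_cst.
under eq_fun do rewrite big_cons; exact: (smoothD (sF i) IH).
Qed.

Lemma smooth_partial p f : smooth f -> smooth (partial p f).
Proof.
move=> /smoothP[s1 s2]; apply/smoothP.
by split=> w x Ux; rewrite /= -rpartials_rcons; [exact: s1|exact: s2].
Qed.

Lemma smooth_partials w f : smooth f -> smooth (partials w f).
Proof. move=> sf; elim: w => [|p w IH]; [exact: sf|exact: smooth_partial IH]. Qed.

Lemma smooth_diff f x : smooth f -> U x ->
  differentiable (fun y : M => complex.Re (f y)) x /\
  differentiable (fun y : M => complex.Im (f y)) x.
Proof. by move=> /smoothP[s1 s2] Ux; split; [exact: (s1 [::])|exact: (s2 [::])]. Qed.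

Lemma smooth_derivable f x v : smooth f -> U x ->
  derivable (fun y : M => complex.Re (f y)) x v /\
  derivable (fun y : M => complex.Im (f y)) x v.
Proof.
by move=> sf Ux; have [d1 d2] := smooth_diff sf Ux; split; exact: diff_derivable.
Qed.

Lemma smooth_comp f (L : {linear M -> M}) c : smooth f ->
  (forall x, U x -> U (L x + c)) -> smooth (fun x => f (L x + c)).
Proof.
move=> /smoothP[s1 s2] LU.
by apply: smooth_exprs;
  [apply: (@smooth_expr_comp _ _ (fun y => complex.Re (f y)))
  |apply: (@smooth_expr_comp _ _ (fun y => complex.Im (f y)))].
Qed.

Lemma smooth_linear (l : {linear M -> R}) : smooth (fun x => (l x)%:C).
Proof.
apply: smooth_exprs => /=; last exact: smooth_expr_cst.
have -> : (l : M -> R) = (fun x => id (l x + 0)) by apply/funext => x; rewrite addr0.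
apply: (@smooth_expr_comp1 _ _ (@idfun R) l 0).
exists (fun h => h = id \/ exists c, h = cst c); first by left.
move=> g [->|[c ->]].
  by exists (cst 1); [right; exists 1|move=> t; exact: is_derive_id].
by exists (cst 0); [right; exists 0|move=> t; exact: is_derive_cst].
Qed.

Lemma smooth1_cos_sin a b : smooth1 (fun t : R => a * cos t + b * sin t).
Proof.
exists (fun h => exists a b, h = fun t => a * cos t + b * sin t); first by exists a, b.
move=> _ [c [d ->]]; exists (fun t => d * cos t + (- c) * sin t); first by exists d, (- c).
move=> t; have -> : (fun t => c * cos t + d * sin t) = c *: cos + d *: sin by [].
have [h1 h2] : is_derive t (1 : R) (c *: cos + d *: sin) (c *: - sin t + d *: cos t).
  by apply: is_deriveD; apply: is_deriveZ.
apply: DeriveDef; first exact: h1.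
by rewrite h2 addrC -[c *: _]/(c * _) -[d *: _]/(d * _) mulrN mulNr.
Qed.

Lemma smooth_expi (l : {linear M -> R}) c : smooth (fun x => expi (l x + c)).
Proof.
apply: smooth_exprs => /=; apply: smooth_expr_comp1.
  have -> : cos = (fun t : R => 1 * cos t + 0 * sin t).
    by apply/funext => t; rewrite mul1r mul0r addr0.
  exact: smooth1_cos_sin.
have -> : sin = (fun t : R => 0 * cos t + 1 * sin t).
  by apply/funext => t; rewrite mul1r mul0r add0r.
exact: smooth1_cos_sin.
Qed.

Lemma partial_local p f g : (forall x, U x -> f x = g x) ->
  forall x, U x -> partial p f x = partial p g x.
Proof.
move=> fg x Ux; rewrite /partial /cderive.
have near_fg := near_regular Ux.
by congr (_ +i* _); apply: near_eq_derive; apply: filterS near_fg => y /fg ->.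
Qed.

Lemma partialD p f g x : smooth f -> smooth g -> U x ->
  partial p (fun y => f y + g y) x = partial p f x + partial p g x.
Proof.
move=> sf sg Ux; rewrite /partial /cderive.
have [f1 f2] := smooth_derivable (e_ R p) sf Ux.
have [g1 g2] := smooth_derivable (e_ R p) sg Ux.
under eq_fun do rewrite ReD; under [X in _ +i* 'D__ X _]eq_fun do rewrite ImD.
by rewrite (deriveD f1 g1) (deriveD f2 g2).
Qed.

Lemma partialM p f g x : smooth f -> smooth g -> U x ->
  partial p (fun y => f y * g y) x = partial p f x * g x + f x * partial p g x.
Proof.
move=> sf sg Ux; rewrite /partial /cderive.
have [f1 f2] := smooth_derivable (e_ R p) sf Ux.
have [g1 g2] := smooth_derivable (e_ R p) sg Ux.
under eq_fun do rewrite ReM; under [X in _ +i* 'D__ X _]eq_fun do rewrite ImM.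
have d1 := derivableM f1 g1; have d2 := derivableM f2 g2.
have d3 := derivableM f1 g2; have d4 := derivableM f2 g1.
rewrite (deriveD d3 d4) (deriveD d1 (@derivableZ _ _ _ _ (- 1) _ _ d2)) (@deriveZ _ _ _ _ (- 1) _ _ d2).
rewrite (deriveM f1 g1) (deriveM f2 g2) (deriveM f1 g2) (deriveM f2 g1).
move: ('D_(e_ R p) (fun y => complex.Re (f y)) x) ('D_(e_ R p) (fun y => complex.Im (f y)) x).
move: ('D_(e_ R p) (fun y => complex.Re (g y)) x) ('D_(e_ R p) (fun y => complex.Im (g y)) x).
move: (f x) (g x) => [a1 a2] [b1 b2] c1 c2 d1' d2'.
by apply: eqC_ReIm; rewrite /= /GRing.scale /=; ring.
Qed.

Lemma partial_cst p c x : partial p (fun _ : oneform R n => c) x = 0.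
Proof. by rewrite /partial /cderive !derive_cst. Qed.

Lemma partial_linear p c f g x : smooth f -> smooth g -> U x ->
  partial p (fun y => c * f y + g y) x = c * partial p f x + partial p g x.
Proof.
move=> sf sg Ux; rewrite (partialD p (smoothM (smooth_cst c) sf) sg Ux).
by rewrite (partialM p (smooth_cst c) sf Ux) partial_cst mul0r add0r.
Qed.

Lemma partial_comm p q f x : smooth f -> U x ->
  partial p (partial q f) x = partial q (partial p f) x.
Proof.
move=> sf Ux; rewrite /partial /cderive /=.
have comm (h : M -> R) : rsmooth h ->
    'D_(e_ R p) ('D_(e_ R q) h) x = 'D_(e_ R q) ('D_(e_ R p) h) x.
  move=> sh; apply: derive_comm.
  - apply: filterS (near_regular Ux) => y Uy; split; apply: diff_derivable.
    + exact: (sh [::]).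
    + exact: (sh [::]).
    + exact: (sh [:: q]).
    + exact: (sh [:: p]).
  - exact/differentiable_continuous/(sh [:: p; q]).
  - exact/differentiable_continuous/(sh [:: q; p]).
move/smoothP: sf => [s1 s2].
rewrite (comm _ s1) (comm _ s2); exact: erefl.
Qed.

Lemma partial_comp p f (L : {linear M -> M}) c x : smooth f -> U (L x + c) ->
  partial p (fun y => f (L y + c)) x =
  \sum_q (mxvec (L (e_ R p)) 0 q)%:C * partial q f (L x + c).
Proof.
move=> sf Ux; have [d1 d2] := smooth_diff sf Ux.
rewrite /partial /cderive.
rewrite (derive_comp_affine _ d1) (derive_comp_affine _ d2) (derive_basis _ d1) (derive_basis _ d2).
have Csum (I : finType) (F G : I -> R) :
    (\sum_i F i) +i* (\sum_i G i) = \sum_i (F i +i* G i).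
  apply: eqC_ReIm => /=.
    by elim/big_rec2: _ => [|i a b _ ->]; rewrite ?ReD.
  by elim/big_rec2: _ => [|i a b _ ->]; rewrite ?ImD.
rewrite Csum; apply: eq_bigr => q _.
by apply: eqC_ReIm; rewrite ?ReM ?ImM /= ?mul0r ?mulr0 ?addr0.
Qed.

Lemma partial_linear_form p (l : {linear M -> R}) x :
  partial p (fun y => (l y)%:C) x = (l (e_ R p))%:C.
Proof.
rewrite /partial /cderive /= derive_cst; congr (_ +i* _).
rewrite deriveE; last exact: linear_mx_differentiable.
by rewrite diff_lin //; exact: linear_mx_continuous.
Qed.

Lemma partial_expi p (l : {linear M -> R}) c x :
  partial p (fun y => expi (l y + c)) x = iC R * (l (e_ R p))%:C * expi (l x + c).
Proof.
rewrite /partial /cderive /=.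
have chain (h h' : R -> R) : (forall t, is_derive t (1 : R) h (h' t)) ->
    'D_(e_ R p) (fun y => h (l y + c)) x = l (e_ R p) * h' (l x + c).
  move=> dh; have [dd <-] := dh (l x + c).
  have df : differentiable h (l x + c) by apply/derivable1_diffP.
  rewrite derive_comp_affine // !deriveE // -{1}[l _]mulr1 -[l _ * 1]/(l _ *: (1 : R)).
  by rewrite linearZ.
rewrite (chain cos (fun t => - sin t)) (chain sin cos).
by apply: eqC_ReIm; rewrite ?ReM ?ImM /=; ring.
Qed.

Lemma ordmax_cases (j : 'I_n.-1.+1) : j = ord_max \/ exists j', j = lift ord_max j'.
Proof. by case: (unliftP ord_max j) => [j' ->|->]; [right; exists j'|left]. Qed.

(** Each row has the diagonal entries d, 2 d, .. and minus their sum. They are pairwise distinct and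
    smaller than 1 / 2, so their differences are nonzero of absolute value below 1, hence not
    integers. *)
Lemma small_regular (e : R) : 0 < e ->
  exists2 x : oneform R n, U x & forall i j, `|diag x i j| < e.
Proof.
(* The square of [n.-1.+2] exceeds both the largest multiple of d that occurs and the sum of all of
   them. *)
move=> e0; pose d := Num.min e (1 / 2) / (n.-1.+2%:R ^+ 2).
have m0 : 0 < Num.min e (1 / 2) by rewrite lt_min e0 /=; lra.
have d0 : 0 < d by rewrite divr_gt0 // exprn_gt0.
have dn : d * n.-1.+2%:R ^+ 2 = Num.min e (1 / 2) by rewrite /d divfK // expf_neq0.
pose x : oneform R n := \matrix_(i, j) (d * j.+1%:R).
have xl i j : diag x i (lift ord_max j) = d * j.+1%:R.
  by rewrite /diag mxE liftK /= mxE.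
have xm i : diag x i ord_max = - \sum_(l < n.-1) d * l.+1%:R.
  by rewrite /diag mxE unlift_none /=; congr (- _); apply: eq_bigr => l _; rewrite mxE.
have small i j : `|diag x i j| < Num.min e (1 / 2).
  case: (ordmax_cases j) => [->|[j' ->]].
    rewrite xm normrN ger0_norm; last by apply: sumr_ge0 => l _; rewrite mulr_ge0 // ltW.
    rewrite -dn -mulr_sumr ltr_pM2l // -natr_sum -natrX ltr_nat.
    apply: (@leq_ltn_trans (\sum_(l < n.-1) n.-1)); first by apply: leq_sum => l _.
    by rewrite sum_nat_const card_ord expnS expn1; apply: ltn_mul.
  rewrite xl ger0_norm; last by rewrite mulr_ge0 // ltW.
  rewrite -dn ltr_pM2l // -natrX ltr_nat expnS expn1.
  apply: (@leq_trans n.-1.+2); first by rewrite ltnS leqW // ltn_ord.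
  by rewrite leq_pmulr.
have le1 : Num.min e (1 / 2) <= 1 / 2 :> R by rewrite ge_min lexx orbT.
exists x => [j l jl|i j]; last first.
  by apply: lt_le_trans (small i j) _; rewrite ge_min lexx.
exists ord0; apply/negP => /norm_intr_ge1 H.
suff /H : diag x ord0 j - diag x ord0 l != 0.
  have := ler_normB (diag x ord0 j) (diag x ord0 l).
  have := small ord0 j; have := small ord0 l; lra.
have neg : - \sum_(l < n.-1) d * l.+1%:R <= 0.
  by rewrite oppr_le0 sumr_ge0 // => q _; rewrite mulr_ge0 // ltW.
have pos (q : 'I_n.-1) : 0 < d * q.+1%:R by rewrite mulr_gt0.
rewrite subr_eq0; case: (ordmax_cases j) (ordmax_cases l) jl => [->|[j' ->]] [->|[l' ->]].
- by rewrite eqxx.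
- by rewrite xm xl => _; rewrite lt_eqF // (le_lt_trans neg).
- by rewrite xm xl => _; rewrite gt_eqF // (le_lt_trans neg).
- rewrite !xl (inj_eq (@lift_inj _ _)) => jl.
  rewrite (inj_eq (mulfI (lt0r_neq0 d0))) eqr_nat eqSS.
  by apply: contra jl => /eqP jl; apply/eqP/val_inj.
Qed.

Lemma regularP (x : oneform R n) : U x <-> forall j l : 'I_(n.-1.+1), j != l ->
  exists i : 'I_2, diag x i j - diag x i l \isn't a Num.int.
Proof. by []. Qed.

End ComplexSmoothness.

#[global] Opaque smooth partial regular.

(** * The algebra of operators on smooth functions *)

Section EndoAlgebra.
Variables (R : realType) (n : nat).
Local Notation M := 'M[R]_(2, n.-1).
Local Notation U := (@regular R n).
Implicit Types (f g : oneform R n -> R[i]).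

Definition endo_spec (A : oper R n) : Prop :=
  [/\ forall f, smooth f -> smooth (A f),
      forall f x, ~ U x -> A f x = 0,
      forall f, ~ smooth f -> A f = (fun=> 0),
      forall f g, (forall x, U x -> f x = g x) -> A f = A g
    & forall c f g, smooth f -> smooth g ->
        A (fun x => c * f x + g x) = (fun x => c * A f x + A g x)].

(* Linear operators on the smooth functions on [regular]; a function is
   represented by its extension by zero, and non-smooth arguments are sent to 0,
   so that equality of operators is Leibniz equality. *)
Record endo := Endo { endo_fun :> (oneform R n -> R[i]) -> oneform R n -> R[i]; endoP : endo_spec endo_fun }.

Lemma endo_inj (A B : endo) : (A : oper R n) = B -> A = B.
Proof.
case: A B => [A a] [B b] /= AB; case: _ / AB b => b.
by congr Endo; exact: Prop_irrelevance.
Qed.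

Lemma endo_smooth (A : endo) f : smooth f -> smooth (A f).
Proof. by case: (endoP A) => h _ _ _ _; exact: h. Qed.

Lemma endo_local (A : endo) f g : (forall x, U x -> f x = g x) -> A f = A g.
Proof. by case: (endoP A) => _ _ _ h _; exact: h. Qed.

Lemma endo_lin (A : endo) c f g : smooth f -> smooth g ->
  A (fun x => c * f x + g x) = (fun x => c * A f x + A g x).
Proof. by case: (endoP A) => _ _ _ _ h; exact: h. Qed.

Lemma endoP_ext (A B : endo) :
  (forall f x, smooth f -> U x -> A f x = B f x) -> A = B.
Proof.
case: (endoP A) => _ a1 a2 _ _; case: (endoP B) => _ b1 b2 _ _ AB.
apply: endo_inj; apply/funext => f; apply/funext => x.
have [sf|nf] := pselect (smooth f); last by rewrite a2 // b2.
by have [Ux|nU] := pselect (U x); [exact: AB|rewrite a1 // b1].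
Qed.

(** What has to be checked for a raw operator, on smooth arguments and at regular points only;
    [mask_oper] supplies the normalisation that [endo_spec] demands elsewhere. *)
Definition preendo (A : oper R n) : Prop :=
  [/\ forall f, smooth f -> smooth (A f),
      forall f g, smooth f -> smooth g -> (forall x, U x -> f x = g x) ->
        forall x, U x -> A f x = A g x
    & forall c f g x, smooth f -> smooth g -> U x ->
        A (fun x => c * f x + g x) x = c * A f x + A g x].

Definition mask_oper (A : oper R n) : oper R n :=
  fun f x => if pselect (smooth f /\ U x) then A f x else 0.

Lemma mask_operE A f x : smooth f -> U x -> mask_oper A f x = A f x.
Proof. by move=> sf Ux; rewrite /mask_oper; case: pselect => // -[]. Qed.

Lemma mask_oper0 A f x : ~ (smooth f /\ U x) -> mask_oper A f x = 0.
Proof. by move=> h; rewrite /mask_oper; case: pselect. Qed.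

Lemma mask_oper_spec A : preendo A -> endo_spec (mask_oper A).
Proof.
move=> [As Al Alin]; split.
- move=> f sf; apply: smooth_local (As f sf) => x Ux.
  exact: esym (mask_operE A sf Ux).
- move=> f x nU; apply: mask_oper0 => -[_ Ux]; exact: (nU Ux).
- move=> f nf; apply/funext => x; apply: mask_oper0 => -[sf _]; exact: (nf sf).
- move=> f g fg; apply/funext => x.
  have [[sf Ux]|h] := pselect (smooth f /\ U x).
    have sg := smooth_local fg sf.
    rewrite (mask_operE A sf Ux) (mask_operE A sg Ux); exact: Al sf sg fg x Ux.
  have h' : ~ (smooth g /\ U x).
    case=> sg Ux; apply: h; split; last exact: Ux.
    apply: smooth_local sg => y Uy; exact: esym (fg y Uy).
  exact: etrans (mask_oper0 A h) (esym (mask_oper0 A h')).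
- move=> c f g sf sg; apply/funext => x.
  have [Ux|nU] := pselect (U x).
    rewrite (mask_operE A (smooth_lin c sf sg) Ux) (mask_operE A sf Ux) (mask_operE A sg Ux).
    exact: Alin.
  have nn (h : oneform R n -> R[i]) : ~ (smooth h /\ U x) by case=> _ /nU.
  by rewrite (mask_oper0 A (nn _)) (mask_oper0 A (nn f)) (mask_oper0 A (nn g)) mulr0 addr0.
Qed.

Definition mkendo A (hA : preendo A) : endo := Endo (mask_oper_spec hA).

Lemma mkendoE A (hA : preendo A) f x : smooth f -> U x -> mkendo hA f x = A f x.
Proof. exact: mask_operE. Qed.

Lemma endo0 (A : endo) : A (fun=> 0) = (fun=> 0).
Proof.
have := endo_lin A (-1) (@smooth_cst R n 0) (@smooth_cst R n 0).
under eq_fun do rewrite mulN1r oppr0 addr0.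
move=> ->; apply/funext => x; by rewrite mulN1r addNr.
Qed.

Lemma endo_add_spec (A B : endo) : endo_spec (fun f x => A f x + B f x).
Proof.
case: (endoP A) => a1 a2 a3 a4 a5; case: (endoP B) => b1 b2 b3 b4 b5; split.
- by move=> f sf; apply: smoothD; [exact: a1|exact: b1].
- by move=> f x nU; rewrite a2 // b2 // addr0.
- by move=> f nf; rewrite a3 // b3 //; apply/funext => x; rewrite addr0.
- by move=> f g fg; rewrite (a4 _ _ fg) (b4 _ _ fg).
- by move=> c f g sf sg; rewrite a5 // b5 //; apply/funext => x; ring.
Qed.

Lemma endo_scale_spec c (A : endo) : endo_spec (fun f x => c * A f x).
Proof.
case: (endoP A) => a1 a2 a3 a4 a5; split.
- by move=> f sf; apply: smoothM; [exact: smooth_cst|exact: a1].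
- by move=> f x nU; rewrite a2 // mulr0.
- by move=> f nf; rewrite a3 //; apply/funext => x; rewrite mulr0.
- by move=> f g fg; rewrite (a4 _ _ fg).
- by move=> d f g sf sg; rewrite a5 //; apply/funext => x; ring.
Qed.

Lemma endo_mul_spec (A B : endo) : endo_spec (fun f => A (B f)).
Proof.
case: (endoP A) => a1 a2 a3 a4 a5; case: (endoP B) => b1 b2 b3 b4 b5; split.
- by move=> f sf; apply: a1; exact: b1.
- by move=> f x nU; rewrite a2.
- by move=> f nf; rewrite b3 // endo0.
- by move=> f g fg; rewrite (b4 _ _ fg).
- move=> c f g sf sg; rewrite (b5 c f g sf sg).
  exact: (a5 c _ _ (b1 f sf) (b1 g sg)).
Qed.

Lemma endo_zero_spec : endo_spec (fun _ _ => 0).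
Proof.
split.
- move=> f _; exact: (@smooth_cst R n 0).
- by [].
- by [].
- by [].
- by move=> c f g _ _; apply/funext => x; rewrite mulr0 addr0.
Qed.

Lemma preendo_id : preendo id.
Proof. by split. Qed.

HB.instance Definition _ := gen_eqMixin endo.
HB.instance Definition _ := gen_choiceMixin endo.

Definition endo_zero := Endo endo_zero_spec.
Definition endo_one := mkendo preendo_id.
Definition endo_add A B := Endo (endo_add_spec A B).
Definition endo_scale c A := Endo (endo_scale_spec c A).
Definition endo_opp A := endo_scale (-1) A.
Definition endo_mul A B := Endo (endo_mul_spec A B).

Fact endo_addA : associative endo_add.
Proof. by move=> A B C; apply: endoP_ext => f x _ _ /=; rewrite addrA. Qed.
Fact endo_addC : commutative endo_add.
Proof. by move=> A B; apply: endoP_ext => f x _ _ /=; rewrite addrC. Qed.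
Fact endo_add0 : left_id endo_zero endo_add.
Proof. by move=> A; apply: endoP_ext => f x _ _ /=; rewrite add0r. Qed.
Fact endo_addN : left_inverse endo_zero endo_opp endo_add.
Proof. by move=> A; apply: endoP_ext => f x _ _ /=; rewrite mulN1r addNr. Qed.

HB.instance Definition _ := GRing.isZmodule.Build endo endo_addA endo_addC endo_add0 endo_addN.

Fact endo_mulA : associative endo_mul.
Proof. by move=> A B C; apply: endo_inj. Qed.
Fact endo_mul1 : left_id endo_one endo_mul.
Proof.
by move=> A; apply: endoP_ext => f x sf Ux; exact: (mask_operE id (endo_smooth A sf) Ux).
Qed.
Fact endo_mulr1 : right_id endo_one endo_mul.
Proof.
move=> A; apply: endoP_ext => f x sf Ux /=.
by rewrite (@endo_local A (mask_oper id f) f) // => y Uy; exact: (mask_operE id sf Uy).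
Qed.
Fact endo_mulDl : left_distributive endo_mul +%R.
Proof. by move=> A B C; apply: endo_inj. Qed.
Fact endo_mulDr : right_distributive endo_mul +%R.
Proof.
move=> A B C; apply: endoP_ext => f x sf Ux /=.
have := endo_lin A 1 (endo_smooth B sf) (endo_smooth C sf).
under eq_fun do rewrite mul1r.
by move=> ->; rewrite mul1r.
Qed.

HB.instance Definition _ := GRing.Zmodule_isPzRing.Build endo
  endo_mulA endo_mul1 endo_mulr1 endo_mulDl endo_mulDr.

Fact endo_one_neq0 : (1 : endo) != 0.
Proof.
have [x Ux _] := @small_regular R n 1 ltr01.
apply/eqP => /(congr1 (fun A : endo => A (fun=> 1) x)) /=.
rewrite mask_operE //; last exact: smooth_cst.
exact/eqP/oner_neq0.
Qed.

HB.instance Definition _ := GRing.PzSemiRing_isNonZero.Build endo endo_one_neq0.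

Fact endo_scaleA a b (A : endo) : endo_scale a (endo_scale b A) = endo_scale (a * b) A.
Proof. by apply: endoP_ext => f x _ _ /=; rewrite mulrA. Qed.
Fact endo_scale1 : left_id 1 endo_scale.
Proof. by move=> A; apply: endoP_ext => f x _ _ /=; rewrite mul1r. Qed.
Fact endo_scaleDr : right_distributive endo_scale +%R.
Proof. by move=> a A B; apply: endoP_ext => f x _ _ /=; rewrite mulrDr. Qed.
Fact endo_scaleDl (A : endo) : {morph endo_scale^~ A : a b / a + b}.
Proof. by move=> a b; apply: endoP_ext => f x _ _ /=; rewrite mulrDl. Qed.

HB.instance Definition _ := GRing.Zmodule_isLmodule.Build R[i] endo
  endo_scaleA endo_scale1 endo_scaleDr endo_scaleDl.

Fact endo_scaleAl a (A B : endo) : a *: (A * B) = (a *: A) * B.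
Proof. by apply: endo_inj. Qed.

HB.instance Definition _ := GRing.Lmodule_isLalgebra.Build R[i] endo endo_scaleAl.

Fact endo_scaleAr a (A B : endo) : a *: (A * B) = A * (a *: B).
Proof.
apply: endoP_ext => f x sf Ux /=.
have := endo_lin A a (endo_smooth B sf) (@smooth_cst R n 0).
under eq_fun do rewrite addr0.
by move=> ->; rewrite endo0 addr0.
Qed.

HB.instance Definition _ := GRing.Lalgebra_isAlgebra.Build R[i] endo endo_scaleAr.

Lemma endoDE (A B : endo) f x : (A + B) f x = A f x + B f x. Proof. by []. Qed.
Lemma endoME (A B : endo) f : (A * B) f = A (B f). Proof. by []. Qed.
Lemma endoZE c (A : endo) f x : (c *: A) f x = c * A f x. Proof. by []. Qed.
Lemma endo0E f x : (0 : endo) f x = 0. Proof. by []. Qed.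
Lemma endoNE (A : endo) f x : (- A) f x = - A f x.
Proof. by rewrite -scaleN1r endoZE mulN1r. Qed.
Lemma endo1E f x : smooth f -> U x -> (1 : endo) f x = f x.
Proof. exact: mask_operE. Qed.
Lemma endo_sumE (I : Type) (r : seq I) (P : pred I) (F : I -> endo) f x :
  (\sum_(i <- r | P i) F i) f x = \sum_(i <- r | P i) F i f x.
Proof. by elim/big_rec2: _ => // i a b _ <-. Qed.

End EndoAlgebra.

(** * The numeric recursion *)

Section NumericRecursion.
Variable R : realType.
Local Notation C := R[i].
Implicit Types (alpha : nat -> nat -> C).

Lemma iC_sqr : iC R * iC R = -1.
Proof. by have := sqr_i R; rewrite expr2. Qed.

Lemma iC_neq0 : iC R != 0.
Proof. by rewrite eq_complex /= eqxx oner_eq0. Qed.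

Lemma ik_neq0 k : (0 < k)%N -> ik R k != 0.
Proof. by move=> k0; rewrite mulf_neq0 ?iC_neq0 // pnatr_eq0 -lt0n. Qed.

Lemma triangle_sum (V : nmodType) N (F : nat -> nat -> V) :
  \sum_(r < N) \sum_(j < r.+1) F r j = \sum_(j < N) \sum_(r < N - j) F (j + r)%N j.
Proof.
elim: N => [|N IH]; first by rewrite !big_ord0.
rewrite big_ord_recr /= IH [RHS]big_ord_recr /= subSn // subnn big_ord1 addn0.
have -> : \sum_(j < N) \sum_(r < N.+1 - j) F (j + r)%N j =
    \sum_(j < N) (\sum_(r < N - j) F (j + r)%N j + F N j).
  by apply: eq_bigr => j _; rewrite subSn 1?ltnW // big_ord_recr /= subnKC // ltnW.
by rewrite big_split /= -addrA; congr (_ + _); rewrite big_ord_recr.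
Qed.

Lemma triangle_sum_rev (V : nmodType) N (F : nat -> nat -> V) :
  \sum_(r < N) \sum_(j < r.+1) F r j = \sum_(j < N) \sum_(r < N - j) F (j + r)%N r.
Proof.
under eq_bigr => r _ do rewrite (reindex_inj rev_ord_inj) /=.
rewrite (triangle_sum N (fun r j => F r (r.+1 - j.+1)%N)).
by apply: eq_bigr => j _; apply: eq_bigr => r _; rewrite subSS addKn.
Qed.

(** Coefficients up to L of a power depend only on coefficients up to L of the series, so a
    truncation may replace it and polynomial algebra becomes available. *)
Lemma series_pow_coef (f : nat -> C) (P : {poly C}) L :
  (forall i, (i <= L)%N -> P`_i = f i) ->
  forall m l, (l <= L)%N -> series_pow f m l = (P ^+ m)`_l.
Proof.
move=> Pf; elim=> [|m IH] l lL; first by rewrite expr0 coef1.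
have -> : series_pow f m.+1 l = cauchy_prod f (series_pow f m) l by [].
rewrite exprS coefM; apply: eq_bigr => j _; have jl : (j <= l)%N by rewrite -ltnS.
by rewrite (Pf _ (leq_trans jl lL)) (IH _ (leq_trans (leq_subr _ _) lL)).
Qed.

(* The branch of 2 artanh(kappa y) / (2 kappa), divided by y and truncated;
   -2i times the expansion of r is the series [y artanh_poly]. *)
Definition artanh_poly k N : {poly C} :=
  \poly_(i < N) (if odd i then 0 else ik R k ^+ i / i.+1%:R).

(** * The generating function behind the recursion *)

Section CoreIdentity.
Variables (k N : nat) (lam : C).
Hypothesis lam2 : lam ^+ 2 = ik R k ^+ 2.
Let rho := 'X * artanh_poly k N.
Let Q M := \sum_(j < M.+1) ((2 * lam) ^+ j / j`!%:R) *: rho ^+ j.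

Lemma rho_pow_low j i : (i < j)%N -> (rho ^+ j)`_i = 0.
Proof. by move=> ij; rewrite /rho exprMn mulrC coefMXn ij. Qed.

(** This is the differential equation (1 - kappa^2 y^2) rho' = 1 of rho = artanh (kappa y) / kappa,
    kappa = i k, below the degree of truncation. *)
Lemma rho_deriv_low i : (i.+2 < N)%N ->
  ((1 - (ik R k ^+ 2) *: 'X^2) * rho^`())`_i = if i == 0%N then 1 else 0.
Proof.
move=> iN.
have dc j : (j < N)%N -> (rho^`())`_j = if odd j then 0 else ik R k ^+ j.
  move=> jN; rewrite coef_deriv /rho coefXM /= coef_poly jN.
  case: ifP => _; first by rewrite mul0rn.
  by rewrite -[LHS]mulr_natr divfK // pnatr_eq0.
rewrite mulrBl mul1r coefB -scalerAl coefZ coefXnM.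
rewrite dc; last by apply: leq_trans iN; rewrite leqW.
case: i iN => [|[|i]] iN /=; rewrite ?mulr0 ?subr0 ?expr0 //.
rewrite subSS subSS subn0 dc; last by apply: leq_trans iN; rewrite !ltnS !leqW.
rewrite negbK; case: ifP => _; first by rewrite mulr0 subr0.
by rewrite -exprD subrr.
Qed.

Lemma Q_deriv M : (Q M.+1)^`() = (2 * lam) *: (rho^`() * Q M).
Proof.
rewrite /Q big_ord_recl /= expr0 alg_polyC derivD derivC add0r.
rewrite (big_morph (@deriv C) (@derivD _) (raddf0 _)) mulr_sumr scaler_sumr; apply: eq_bigr => j _.
rewrite (_ : bump 0 j = j.+1) // derivZ deriv_exp /=.
have -> : rho^`() * (((2 * lam) ^+ j / j`!%:R) *: rho ^+ j) =
    ((2 * lam) ^+ j / j`!%:R) *: (rho^`() * rho ^+ j) by rewrite scalerAr.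
rewrite -[_ *+ j.+1]scaler_nat !scalerA; congr (_ *: _).
rewrite exprS factS natrM; field.
by rewrite nat1r !pnatr_eq0 /= -lt0n fact_gt0.
Qed.

(** [Q M] truncates exp (2 lam rho), which is (1 + lam y) / (1 - lam y) since lam^2 = (i k)^2. In
    the degrees considered, (1 - lam^2 y^2) Q' = 2 lam Q determines the coefficients one after the
    other. *)
Lemma coef_Q M l : (l <= M)%N -> (l.+1 < N)%N ->
  (Q M)`_l = if l == 0%N then 1 else 2 * lam ^+ l.
Proof.
have Qstab l' M' : (l' <= M')%N -> (Q M'.+1)`_l' = (Q M')`_l'.
  by move=> lM; rewrite /Q big_ord_recr /= coefD coefZ rho_pow_low // mulr0 addr0.
elim/ltn_ind: l M => -[|l] IH M lM lN.
  rewrite /Q coef_sum big_ord_recl /= coefZ expr0 coef1 divr1 mul1r big1 ?addr0 //.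
  by move=> j _; rewrite coefZ rho_pow_low ?mulr0.
case: M lM => // M lM.
have E : ((1 - (ik R k ^+ 2) *: 'X^2) * (Q M.+1)^`())`_l = 2 * lam * (Q M)`_l.
  rewrite Q_deriv -scalerAr coefZ mulrA; congr (_ * _).
  rewrite coefM big_ord_recl rho_deriv_low; last by rewrite /=; lia.
  rewrite [X in X * _ + _]/= mul1r subn0 big1 ?addr0 // => j _.
  by rewrite rho_deriv_low ?mul0r //= /bump /=; have := ltn_ord j; lia.
move: E; rewrite mulrBl mul1r coefB -scalerAl coefZ coefXnM coef_deriv.
have step c : (Q M.+1)`_l.+1 *+ l.+1 = c *+ l.+1 -> (Q M.+1)`_l.+1 = c.
  have l0 : (l.+1%:R : C) != 0 by rewrite pnatr_eq0.
  by move=> E'; apply: (mulIf l0); rewrite !mulr_natr; exact: E'.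
rewrite -lam2; case: ltnP => [l2|l2].
  rewrite mulr0 subr0 => E; apply: step; rewrite E.
  rewrite IH //; last by rewrite ltnW.
  case: l {IH E} l2 lM lN => [|[|//]] _ _ _ /=; first by rewrite expr1 mulr1.
  by rewrite expr1 expr2; ring.
case: l IH lM lN l2 step => [|[|l]] // IH lM lN _ step.
rewrite !subSS subn0 coef_deriv => /(canRL (subrK _)) E; apply: step; rewrite E.
rewrite IH //; last by rewrite ltnW.
rewrite IH //=; try lia.
rewrite -[RHS]mulr_natr -[_ *+ l.+1]mulr_natr !exprS (_ : l.+3%:R = l.+1%:R + 2 :> C); last by rewrite -natrD addn2.
by move: (l.+1%:R : C) (lam ^+ l) => y z; ring.
Qed.
End CoreIdentity.

(* ad_Delta^m / m! = (2 i)^m A^(m), as Delta = 2 i a. *)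
Definition alpha_exp k (l r : nat) : C :=
  (2 * iC R) ^+ (l - r) * series_pow (fun j => - r_coef R k j) (l - r) l.

Lemma alpha_expE k l r N : (0 < k)%N -> (l < N)%N ->
  alpha_exp k l r = (('X * artanh_poly k N) ^+ (l - r))`_l.
Proof.
move=> k0 lN; have k0' : (k%:R : C) != 0 by rewrite pnatr_eq0 -lt0n.
have i2 : (2 * iC R) != 0 by rewrite mulf_neq0 ?iC_neq0 // pnatr_eq0.
rewrite /alpha_exp.
rewrite (@series_pow_coef _ ((2 * iC R)^-1 *: ('X * artanh_poly k N)) l) //.
  by rewrite exprZn coefZ mulrA -exprMn mulfV // expr1n mul1r.
move=> [|j] jl; rewrite coefZ coefXM /= /r_coef /=; first by rewrite mulr0 oppr0.
rewrite coef_poly (leq_trans jl) 1?ltnW //=; case: (odd j) => /=; first by rewrite mulr0 oppr0.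
rewrite exprS /ik; move: iC_sqr; rewrite -/(iC R) => i2'.
have iV : (iC R)^-1 = - iC R.
  by apply: (mulfI iC_neq0); rewrite mulfV ?iC_neq0 // mulrN i2' opprK.
rewrite !invfM iV; field.
by rewrite nat1r k0' pnatr_eq0.
Qed.

Lemma alpha_exp_diag k r : alpha_exp k r r = (r == 0%N)%:R.
Proof. by rewrite /alpha_exp subnn expr0 mul1r. Qed.

(** The number [alpha_exp k l r] is the coefficient of y^l in rho^(l - r), so both sums in [E_] are
    coefficients of y^l in multiples of rho^(l - m), which is divisible by y^(l - m). It remains
    that the cofactor [Z] vanishes up to degree m. *)
Lemma alpha_exp_recursion k : (0 < k)%N -> numeric_recursion k (alpha_exp k).
Proof.
move=> k0 m l /andP[m0 ml].
have main eps : eps ^+ 2 = 1 -> E_ k eps (alpha_exp k) m l = 0.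
  move=> eps2; set lam := eps * ik R k.
  have lam2 : lam ^+ 2 = ik R k ^+ 2 by rewrite exprMn eps2 mul1r.
  pose N := l.+3; pose rho := 'X * artanh_poly k N.
  (* Half of exp (2 lam rho) - 1, minus the geometric series of lam y without its constant term,
     each cut after m terms; by [coef_Q] the two agree up to degree m. *)
  pose Z : {poly C} := \sum_(j < m) ((2 * lam) ^+ j.+1 / (2 * j.+1`!%:R)) *: rho ^+ j.+1
              - \sum_(j < m) lam ^+ j.+1 *: 'X^(j.+1).
  have Zlow i : (i <= m)%N -> Z`_i = 0.
    move=> im; have iN : (i.+1 < N)%N by rewrite !ltnS (leq_trans im) // leqW.
    have := coef_Q lam2 im iN.
    rewrite big_ord_recl /= coefD coefZ expr0 divr1 mul1r coef1 => H.
    have H' : \sum_(j < m) ((2 * lam) ^+ j.+1 / j.+1`!%:R) * (rho ^+ j.+1)`_i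
       = if i == 0%N then 0 else 2 * lam ^+ i.
      move: H; rewrite coef_sum; under eq_bigr do rewrite coefZ.
      by case: (i =P 0%N) => _; [move=> /(canRL (addKr _)); rewrite addNr|rewrite add0r].
    rewrite /Z coefB !coef_sum.
    under eq_bigr do rewrite coefZ invfM mulrCA -mulrA.
    under [X in _ - X]eq_bigr do rewrite coefZ coefXn.
    rewrite -mulr_sumr H'; case: i im {iN H H'} => [|i] im /=.
      by rewrite mulr0 big1 ?subrr // => j _; rewrite mulr0.
    rewrite mulrA mulVf ?pnatr_eq0 // mul1r (bigD1 (Ordinal im)) //= eqxx mulr1 big1 ?addr0 ?subrr //.
    by move=> j; rewrite -val_eqE /= eq_sym eqSS => /negPf ->; rewrite mulr0.
  have -> : E_ k eps (alpha_exp k) m l = (rho ^+ (l - m) * Z)`_l.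
    rewrite /E_ (reindex_inj rev_ord_inj) /= /Z mulrBr coefB !mulr_sumr !coef_sum -sumrB.
    apply: eq_bigr => j _; have jm := ltn_ord j.
    rewrite subKn //; congr (_ - _).
      rewrite -scalerAr coefZ -exprD (@alpha_expE _ _ _ N) //; last by rewrite !ltnS !leqW.
      rewrite subnA // 1?leqW // /lam ?leq_subr //.
      congr (_ / _ * _); congr (_ ^+ _); ring.
    rewrite -scalerAr coefZ coefMXn (@alpha_expE _ _ _ N) //; last first.
      by rewrite !ltnS (leq_trans _ (leqW (leqnSn l))) // -[X in (_ <= X)%N](subnK ml) leq_add2l leq_subr.
    rewrite ltnNge (leq_trans jm ml) /= addnBA // subnK //; congr (_ * _).
    by rewrite (_ : l - j.+1 - (m - j.+1) = l - m)%N //; lia.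
  rewrite /rho exprMn -mulrA mulrC coefMXn ltnNge leq_subr /= subKn // mulrC coefM big1 // => j _.
  by rewrite Zlow ?mul0r // -ltnS.
by split; apply: main; rewrite ?expr1n // sqrrN expr1n.
Qed.

(* The effect on the solution of multiplying the trivialisation by the power
   series with coefficients c. *)
Definition twist (c : nat -> C) alpha (l r : nat) : C :=
  \sum_(j < r.+1) c j * alpha (l - j)%N (r - j)%N.

(** [E_] is linear in alpha, and lowering m, l and r together by j leaves m - r and l - m unchanged.
    Hence [E_] of the twist at (m, l) is a combination of [E_] of alpha at the points (m - j, l -
    j). *)
Lemma twist_recursion k c alpha : numeric_recursion k alpha ->
  numeric_recursion k (twist c alpha).
Proof.
move=> rec m l /andP[m0 ml].
have main eps : (forall m l, (1 <= m <= l)%N -> E_ k eps alpha m l = 0) ->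
    E_ k eps (twist c alpha) m l = 0.
  move=> H; rewrite /E_ /twist.
  pose F r j := c j * ((eps * 2 * ik R k) ^+ (m - r) / (2 * ((m - r)`!)%:R) * alpha (l - j)%N (r - j)%N
     - (eps * ik R k) ^+ (m - r) * alpha (l - m + r - j)%N (r - j)%N).
  rewrite (eq_bigr (fun r : 'I_m => \sum_(j < r.+1) F r j)); last first.
    move=> r _; rewrite !mulr_sumr -sumrB; apply: eq_bigr => j _; rewrite /F; ring.
  rewrite triangle_sum big1 // => j _; have jm := ltn_ord j.
  have Ejm := H (m - j)%N (l - j)%N ltac:(lia).
  transitivity (c j * E_ k eps alpha (m - j) (l - j)); last by rewrite Ejm mulr0.
  rewrite /E_ mulr_sumr; apply: eq_bigr => r _; rewrite /F addKn subnDA.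
  by congr (_ * (_ - _ * alpha _ _)); lia.
split; apply: main => m' l' ml'; by have [] := rec m' l' ml'.
Qed.

(** In the equation at m = r + 1 with sign +, the last term is i k (alpha l r - alpha (l - 1) r) and
    the others lie in columns before r. So alpha l r is determined by entries already known. *)
Lemma recursion_unique k alpha alpha' : (0 < k)%N ->
  numeric_recursion k alpha -> numeric_recursion k alpha' ->
  (forall r, alpha r r = alpha' r r) ->
  forall l r, (r <= l)%N -> alpha l r = alpha' l r.
Proof.
move=> k0 rec rec' diag; elim/ltn_ind => l IHl; elim/ltn_ind => r IHr.
rewrite leq_eqVlt => /predU1P[->|rl]; first exact: diag.
have [] : E_ k 1 alpha r.+1 l = 0 /\ E_ k 1 alpha' r.+1 l = 0.
  by have [h _] := rec r.+1 l rl; have [h' _] := rec' r.+1 l rl.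
rewrite /E_ !big_ord_recr /= !subSn // !subnn !expr1 factS fact0 muln1 mulr1.
have l0 : (l - r.+1 + r)%N = l.-1 by lia.
rewrite l0.
have -> : \sum_(i < r) ((1 * 2 * ik R k) ^+ (r.+1 - i) / (2 * (r.+1 - i)`!%:R) * alpha l i -
      (1 * ik R k) ^+ (r.+1 - i) * alpha (l - r.+1 + i)%N i) =
   \sum_(i < r) ((1 * 2 * ik R k) ^+ (r.+1 - i) / (2 * (r.+1 - i)`!%:R) * alpha' l i -
      (1 * ik R k) ^+ (r.+1 - i) * alpha' (l - r.+1 + i)%N i).
  apply: eq_bigr => i _; have ir := ltn_ord i.
  by rewrite IHr ?IHl //; lia.
move=> E1 E2; have /addrI := etrans E1 (esym E2).
rewrite (IHl l.-1); try lia.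
move=> /addIr; rewrite !mul1r [2 * _]mulrC mulfK ?pnatr_eq0 // => E.
by apply: (mulfI (ik_neq0 k0)); rewrite E.
Qed.

(** Division of power series. [g n] holds the first n coefficients of the quotient, which turns a
    course-of-values recursion into a structural one. *)
Lemma series_quotient (d e : nat -> C) : d 0%N = 1 ->
  exists c : nat -> C, forall r, \sum_(j < r.+1) c j * d (r - j)%N = e r.
Proof.
move=> d0.
pose fix g (n : nat) : nat -> C := if n is n'.+1 then
  fun j => if j == n' then e n' - \sum_(i < n') g n' i * d (n' - i)%N else g n' j
  else fun=> 0.
have stab n j : (j < n)%N -> g n j = g j.+1 j.
  elim: n => // n IH; rewrite ltnS leq_eqVlt => /predU1P[->//|jn] /=.
  by rewrite ltn_eqF // IH //= .
exists (fun j => g j.+1 j) => r.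
rewrite big_ord_recr /= eqxx subnn d0 mulr1.
under eq_bigr => j _ do [rewrite -/(g j.+1 j) -(stab r j) //].
by rewrite addrC subrK.
Qed.

(** The series is the quotient of the two diagonals; [recursion_unique] carries the agreement from
    the diagonal to the whole array. *)
Lemma normalised_twist k alpha alpha' : (0 < k)%N ->
  normalised_solution k alpha -> normalised_solution k alpha' ->
  exists c, forall l r, (r <= l)%N -> alpha' l r = twist c alpha l r.
Proof.
move=> k0 [a0 rec] [_ rec'].
have [c cE] := series_quotient (fun r => alpha' r r) (d := fun r => alpha r r) a0.
by exists c; apply: recursion_unique k0 rec' (twist_recursion c rec) _ => r; rewrite -cE.
Qed.

(** The diagonal of [alpha_exp] is that of the series 1, so its twist by c has diagonal c. *)
Lemma normalised_exists k (beta : nat -> C) : (0 < k)%N ->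
  exists alpha, normalised_solution k alpha /\
    forall r : nat, (1 <= r)%N -> alpha r r = beta r.
Proof.
move=> k0; pose c r := if r == 0%N then 1 else beta r.
have diag r : twist c (alpha_exp k) r r = c r.
  rewrite /twist (bigD1 ord_max) //= subnn alpha_exp_diag mulr1 big1 ?addr0 // => j jr.
  rewrite alpha_exp_diag subn_eq0 leqNgt.
  have -> : (j < r)%N; last by rewrite mulr0.
  by rewrite ltn_neqAle -ltnS ltn_ord andbT.
exists (twist c (alpha_exp k)); split; last by move=> [//|r] _; rewrite diag.
split; first by rewrite diag.
exact/twist_recursion/alpha_exp_recursion.
Qed.

Lemma normalised_alpha_exp k : (0 < k)%N -> normalised_solution k (alpha_exp k).
Proof. by move=> k0; split; [rewrite alpha_exp_diag|exact: alpha_exp_recursion]. Qed.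

End NumericRecursion.

(** * Flatness from the recursion *)

Section FlatSeries.
Variables (R : realType) (V : lmodType R[i]).
Local Notation C := R[i].

Section OneSide.
Variables (L B : {linear V -> V}) (lam : C) (u : nat -> V).
Hypothesis uS : forall m, m.+1%:R *: u m.+1 = L (u m).
Hypothesis LB : forall x, L (B x) = B (L x) + lam *: B x.

Definition flow_deriv (m : nat) : V :=
  \sum_(j < m) (lam ^+ j / (j.+1)`!%:R) *: B (u (m - j.+1)%N).

(* If u m = L^m u_0 / m! then flow_deriv m is the derivative of u m when that of
   L is B: since [L, B] = lam B, it is obtained from ((X + lam)^m - X^m) / (m! lam). *)
Lemma flow_derivS m :
  m.+1%:R *: flow_deriv m.+1 = B (u m) + L (flow_deriv m).
Proof.
pose v j := B (u (m - j)%N).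
have -> : L (flow_deriv m) =
    \sum_(j < m.+1) ((m - j)%:R * (lam ^+ j / (j.+1)`!%:R)) *: v j +
    \sum_(j < m) (lam ^+ j.+1 / (j.+1)`!%:R) *: v j.+1.
  rewrite big_ord_recr /= subnn mul0r scale0r addr0 -big_split /= /flow_deriv linear_sum.
  apply: eq_bigr => j _; have jm := ltn_ord j.
  rewrite linearZ /= LB scalerDr scalerA; congr (_ + _); last first.
    by rewrite exprS /v; congr (_ *: _); ring.
  have E : (m - j)%N = (m - j.+1).+1 by lia.
  by rewrite -uS -E linearZ /= scalerA /v mulrC.
have -> : B (u m) + (\sum_(j < m.+1) ((m - j)%:R * (lam ^+ j / (j.+1)`!%:R)) *: v j +
    \sum_(j < m) (lam ^+ j.+1 / (j.+1)`!%:R) *: v j.+1) =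
    \sum_(j < m.+1) ((m - j)%:R * (lam ^+ j / (j.+1)`!%:R)) *: v j +
    \sum_(j < m.+1) (lam ^+ j / j`!%:R) *: v j.
  rewrite addrCA; congr (_ + _); rewrite [RHS]big_ord_recl /= expr0 divr1 scale1r /v subn0.
  by congr (_ + _).
rewrite /flow_deriv scaler_sumr -big_split /=; apply: eq_bigr => j _.
rewrite /v subSS scalerA -scalerDl; congr (_ *: _).
have jm : (j <= m)%N by rewrite -ltnS.
rewrite natrB // -natr1 factS natrM; field.
by rewrite nat1r !pnatr_eq0 /= -lt0n fact_gt0.
Qed.

(** When the multiples of [B (u (l - m.+1))] are collected, the two sides differ by 2 E_(m + 1, l),
    for each m < l. Here flatness turns into the numeric recursion. *)
Lemma flow_deriv_series k eps alpha l : lam = eps * 2 * ik R k ->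
  (forall m, (1 <= m <= l)%N -> E_ k eps alpha m l = 0) ->
  lam *: \sum_(r < l.+1) alpha l r *: flow_deriv (l - r)%N =
  2 *: \sum_(1 <= j < l.+1) (eps * ik R k) ^+ j *:
     B (\sum_(r < (l - j).+1) alpha (l - j)%N r *: u (l - j - r)%N).
Proof.
move=> lamE E0; rewrite big_ord_recr /= subnn /flow_deriv big_ord0 scaler0 addr0.
pose F m r := (lam ^+ (m.+1 - r) / ((m.+1 - r)`!)%:R * alpha l r) *: B (u (l - m.+1)%N).
pose H m r := (2 * (eps * ik R k) ^+ (m.+1 - r) * alpha (l - m.+1 + r)%N r) *: B (u (l - m.+1)%N).
have -> : lam *: (\sum_(r < l) alpha l r *: (\sum_(j < l - r) (lam ^+ j / (j.+1)`!%:R) *: B (u (l - r - j.+1)%N)))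
   = \sum_(m < l) \sum_(r < m.+1) F m r.
  rewrite triangle_sum scaler_sumr; apply: eq_bigr => r _.
  rewrite !scaler_sumr; apply: eq_bigr => j _.
  rewrite /F !scalerA (_ : (r + j).+1 - r = j.+1)%N; last by lia.
  rewrite (_ : l - (r + j).+1 = l - r - j.+1)%N; last by lia.
  by rewrite exprS; congr (_ *: _); ring.
have -> : 2 *: (\sum_(1 <= j < l.+1) (eps * ik R k) ^+ j *:
     B (\sum_(r < (l - j).+1) alpha (l - j)%N r *: u (l - j - r)%N)) =
   \sum_(m < l) \sum_(r < m.+1) H m r.
  rewrite triangle_sum_rev big_add1 /= big_mkord scaler_sumr; apply: eq_bigr => j _.
  have jl := ltn_ord j.
  rewrite linear_sum !scaler_sumr (_ : (l - j.+1).+1 = l - j)%N; last by lia.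
  apply: eq_bigr => r _; have rl := ltn_ord r; rewrite [B (_ *: _)]linearZ /= !scalerA /H.
  rewrite (_ : (j + r).+1 - r = j.+1)%N; last by lia.
  rewrite (_ : l - (j + r).+1 + r = l - j.+1)%N; last by lia.
  by rewrite (_ : l - (j + r).+1 = l - j.+1 - r)%N //; lia.
apply: eq_bigr => m _; have ml := ltn_ord m.
apply/eqP; rewrite -subr_eq0 -sumrB.
have -> : \sum_(r < m.+1) (F m r - H m r) = (2 * E_ k eps alpha m.+1 l) *: B (u (l - m.+1)%N).
  rewrite /E_ mulr_sumr scaler_suml; apply: eq_bigr => r _.
  rewrite /F /H -scalerBl lamE; congr (_ *: _); field.
  by rewrite pnatr_eq0 -lt0n fact_gt0.
by rewrite E0 ?mulr0 ?scale0r.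
Qed.
End OneSide.

(** The derivative [du] splits into the flows of [B] and [Bb], with eigenvalues 2 i k and - 2 i k,
    which call for the recursion with sign + and - respectively. Writing i / 2 as (4 k)^-1 (2 i k),
    and as - (4 k)^-1 (- 2 i k), supplies the factor [lam] of [flow_deriv_series] and leaves the (2
    k)^-1 of the connection. *)
Lemma flat_series k alpha (L B Bb : {linear V -> V}) (u du : nat -> V) l :
  (0 < k)%N -> numeric_recursion k alpha ->
  (forall m, m.+1%:R *: u m.+1 = L (u m)) ->
  du 0%N = 0 ->
  (forall m, m.+1%:R *: du m.+1 = (iC R / 2) *: (B (u m) + Bb (u m)) + L (du m)) ->
  (forall x, L (B x) = B (L x) + (2 * ik R k) *: B x) ->
  (forall x, L (Bb x) = Bb (L x) - (2 * ik R k) *: Bb x) ->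
  let S j := \sum_(r < j.+1) alpha j r *: u (j - r)%N in
  \sum_(r < l.+1) alpha l r *: du (l - r)%N =
  (2 * k%:R)^-1 *: \sum_(1 <= j < l.+1) ik R k ^+ j *: (B (S (l - j)%N) - (-1) ^+ j *: Bb (S (l - j)%N)).
Proof.
move=> k0 rec uS du0 duS LB LBb S.
have LBb' x : L (Bb x) = Bb (L x) + (- (2 * ik R k)) *: Bb x by rewrite scaleNr.
have k0' : (k%:R : C) != 0 by rewrite pnatr_eq0 -lt0n.
have duE m : du m = (iC R / 2) *: (flow_deriv B (2 * ik R k) u m + flow_deriv Bb (- (2 * ik R k)) u m).
  elim: m => [|m IH]; first by rewrite du0 /flow_deriv !big_ord0 addr0 scaler0.
  have mS : (m.+1%:R : C) != 0 by rewrite pnatr_eq0.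
  apply: (scalerI mS); rewrite duS IH [L (_ *: _)]linearZ [L (_ + _)]linearD /= -scalerDr.
  rewrite [RHS]scalerA [_ * (_ / 2)]mulrC -[RHS]scalerA [m.+1%:R *: _]scalerDr.
  by rewrite (flow_derivS uS LB) (flow_derivS uS LBb') addrACA.
have rec1 m : (1 <= m <= l)%N -> E_ k 1 alpha m l = 0 by move=> /rec[].
have rec2 m : (1 <= m <= l)%N -> E_ k (-1) alpha m l = 0 by move=> /rec[].
have lam1 : 2 * ik R k = 1 * 2 * ik R k by rewrite mul1r.
have lam2 : - (2 * ik R k) = (-1) * 2 * ik R k by ring.
have F1 := flow_deriv_series B u lam1 rec1.
have F2 := flow_deriv_series Bb u lam2 rec2.
have c1 : iC R / 2 = (4 * k%:R)^-1 * (2 * ik R k).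
  by rewrite /ik; field; rewrite k0'.
have c2 : iC R / 2 = - (4 * k%:R)^-1 * (- (2 * ik R k)) by rewrite mulrNN.
under eq_bigr do rewrite duE scalerA mulrC -scalerA scalerDr.
have h1 : (4 * k%:R)^-1 * 2 = (2 * k%:R)^-1 :> C by field; rewrite k0'.
have h2 : - (4 * k%:R)^-1 * 2 = - (2 * k%:R)^-1 :> C by field; rewrite k0'.
have G1 := congr1 (fun x => (4 * k%:R)^-1 *: x) F1.
have G2 := congr1 (fun x => - (4 * k%:R)^-1 *: x) F2.
rewrite /= !scalerA -c1 h1 in G1; rewrite /= !scalerA -c2 h2 in G2.
rewrite -scaler_sumr big_split /= scalerDr G1 G2.
rewrite scaleNr -scalerBr -sumrB; congr (_ *: _); apply: eq_bigr => j _.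
rewrite scalerBr scalerA -/(S _); congr (_ *: _ - _ *: _).
  by rewrite mul1r.
by rewrite exprMn mulrC.
Qed.

End FlatSeries.

(** * Commutators of quadratic expressions *)

Section Commutators.
Variables (K : comNzRingType) (A : algType K).
Implicit Types x y z : A.

Definition comm_op x y := x * y - y * x.

Lemma comm_op_linear x : linear (comm_op x).
Proof.
move=> a y z; rewrite /comm_op mulrDr mulrDl -scalerAr -scalerAl opprD scalerBr.
by rewrite addrACA.
Qed.
HB.instance Definition _ x := GRing.isLinear.Build K A A _ (comm_op x) (comm_op_linear x).

Lemma comm_op_linear_l y : linear (comm_op^~ y).
Proof.
move=> a x z; rewrite /comm_op mulrDr mulrDl -scalerAr -scalerAl opprD scalerBr.
by rewrite addrACA.
Qed.
Lemma comm_opDl x y z : comm_op (x + y) z = comm_op x z + comm_op y z.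
Proof. by have := comm_op_linear_l z 1 x y; rewrite /= !scale1r. Qed.
Lemma comm_opZl a x z : comm_op (a *: x) z = a *: comm_op x z.
Proof.
have := comm_op_linear_l z a x 0; rewrite /= addr0 => ->.
by rewrite [comm_op 0 z]/comm_op mul0r mulr0 subrr addr0.
Qed.
Lemma comm_op_suml (I : Type) (r : seq I) (P : pred I) (F : I -> A) z :
  comm_op (\sum_(i <- r | P i) F i) z = \sum_(i <- r | P i) comm_op (F i) z.
Proof. by rewrite /comm_op mulr_suml mulr_sumr sumrB. Qed.

Lemma comm_opM x y z : comm_op x (y * z) = comm_op x y * z + y * comm_op x z.
Proof. by rewrite /comm_op mulrBl mulrBr !mulrA addrA subrK. Qed.
Lemma comm_opMl x y z : comm_op (x * y) z = x * comm_op y z + comm_op x z * y.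
Proof. by rewrite /comm_op mulrBl mulrBr !mulrA addrA subrK. Qed.

Lemma comm_op_Jacobi x y z : comm_op x (comm_op y z) = comm_op y (comm_op x z) + comm_op (comm_op x y) z.
Proof.
have -> : comm_op y z = y * z - z * y by [].
rewrite linearB /= !comm_opM; set u := comm_op x y; set v := comm_op x z.
by rewrite /comm_op opprD [u * z + _]addrC addrACA.
Qed.

Definition lmul x y := x * y.
Lemma lmul_linear x : linear (lmul x).
Proof. by move=> a y z; rewrite /lmul mulrDr scalerAr. Qed.
HB.instance Definition _ x := GRing.isLinear.Build K A A _ (lmul x) (lmul_linear x).

Section Quadratic.
Variables (d : nat) (X : 'I_d -> A).
Implicit Types S T : 'M[K]_d.

Definition quad S : A := \sum_p \sum_q S p q *: (X p * X q).

Lemma quad_linear : linear quad.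
Proof.
move=> a S T; rewrite /quad scaler_sumr -big_split; apply: eq_bigr => p _ /=.
rewrite scaler_sumr -big_split; apply: eq_bigr => q _ /=.
by rewrite !mxE scalerDl scalerA.
Qed.
HB.instance Definition _ := GRing.isLinear.Build K 'M[K]_d A _ quad quad_linear.

Variable W : 'M[K]_d.
Hypothesis XX : forall p q, comm_op (X p) (X q) = (W p q)%:A.
Hypothesis Wt : W^T = - W.

Lemma comm_quad_r p T : T^T = T ->
  comm_op (X p) (quad T) = 2 *: \sum_s (W *m T) p s *: X s.
Proof.
move=> Tt; rewrite /quad linear_sum /=.
have -> : 2 *: \sum_s (W *m T) p s *: X s =
    \sum_s (W *m T) p s *: X s + \sum_s (W *m T) p s *: X s.
  by rewrite scaler_nat mulr2n.
have -> : \sum_s (W *m T) p s *: X s = \sum_r \sum_s (W p r * T r s) *: X s.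
  by rewrite exchange_big; apply: eq_bigr => s _; rewrite mxE scaler_suml.
rewrite [X in _ = _ + X]exchange_big /=.
rewrite -big_split; apply: eq_bigr => r _ /=.
rewrite linear_sum -big_split; apply: eq_bigr => s _ /=.
rewrite linearZ /= comm_opM !XX scalerDr mulr_algl -[in X in _ + X]scalerAr mulr1.
rewrite !scalerA [T r s * W p r]mulrC; congr (_ + _ *: _).
by rewrite mulrC -{1}Tt mxE.
Qed.

(** The [X p] have scalar commutators, so their quadratic expressions form a Lie algebra; S |-> 2 S
    W carries its bracket to the matrix commutator, as in the metaplectic representation. *)
Lemma comm_quad S T : S^T = S -> T^T = T ->
  comm_op (quad S) (quad T) = quad (2 *: (S *m W *m T - T *m W *m S)).
Proof.
move=> St Tt; rewrite linearZ linearB /= {1}/quad comm_op_suml.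
have E p q : comm_op (S p q *: (X p * X q)) (quad T) =
   2 *: (\sum_s (S p q * (W *m T) q s) *: (X p * X s) + \sum_s (S p q * (W *m T) p s) *: (X s * X q)).
  rewrite comm_opZl comm_opMl !comm_quad_r // -scalerAr -scalerAl -scalerDr scalerA mulrC -scalerA.
  congr (_ *: _); rewrite scalerDr mulr_sumr mulr_suml !scaler_sumr; congr (_ + _).
    by apply: eq_bigr => s _; rewrite -scalerAr scalerA.
  by apply: eq_bigr => s _; rewrite -scalerAl scalerA.
under eq_bigr => p _ do [rewrite comm_op_suml; under eq_bigr => q _ do rewrite E].
under eq_bigr => p _ do rewrite -scaler_sumr big_split /=.
rewrite -scaler_sumr big_split /=; congr (_ *: (_ + _)).
  rewrite /quad; apply: eq_bigr => p _; rewrite exchange_big; apply: eq_bigr => s _.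
  by rewrite -scaler_suml -mulmxA mxE.
rewrite -linearN /= -mulNmx -mulmxN -Wt -{2}Tt -trmx_mul /quad exchange_big /=.
rewrite [RHS]exchange_big; apply: eq_bigr => q _ /=.
rewrite exchange_big; apply: eq_bigr => s _ /=.
rewrite -scaler_suml; congr (_ *: _); rewrite mxE; apply: eq_bigr => p _.
by rewrite [(_ ^T) s p]mxE mulrC.
Qed.

Lemma quad_pullback (P : A) (L S : 'M[K]_d) :
  (forall p, X p * P = P * \sum_q L q p *: X q) ->
  quad S * P = P * quad (L *m S *m L^T).
Proof.
move=> XP.
have E p q : X p * X q * P = P * \sum_s \sum_t (L s p * L t q) *: (X s * X t).
  rewrite -mulrA XP mulrA XP -mulrA; congr (_ * _).
  rewrite mulr_suml; apply: eq_bigr => s _; rewrite mulr_sumr; apply: eq_bigr => t _.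
  by rewrite -scalerAr -scalerAl scalerA mulrC.
rewrite /quad mulr_suml.
transitivity (P * \sum_p \sum_q \sum_s \sum_t (S p q * (L s p * L t q)) *: (X s * X t)).
  rewrite mulr_sumr; apply: eq_bigr => p _.
  rewrite mulr_suml mulr_sumr; apply: eq_bigr => q _.
  rewrite -scalerAl E scalerAr scaler_sumr; congr (_ * _); apply: eq_bigr => s _.
  by rewrite scaler_sumr; apply: eq_bigr => t _; rewrite scalerA.
congr (_ * _).
under eq_bigr => p _ do rewrite exchange_big.
rewrite exchange_big; apply: eq_bigr => s _ /=.
under eq_bigr => p _ do rewrite exchange_big.
rewrite exchange_big; apply: eq_bigr => t _ /=.
under eq_bigr => p _ do rewrite -scaler_suml.
rewrite -scaler_suml; congr (_ *: _).
rewrite mxE exchange_big; apply: eq_bigr => q _ /=.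
rewrite !mxE mulr_suml; apply: eq_bigr => p _.
by rewrite mulrCA mulrA.
Qed.

End Quadratic.
End Commutators.

(** * Covariant derivatives and sections *)

Section SymplecticForm.
Variables (R : realType) (n : nat).
Local Notation M := 'M[R]_(2, n.-1).
Local Notation U := (@regular R n).
Local Notation trace_free := (trace_free R n).

(** Up to sign, the trace form on the Cartan subalgebra, in the coordinates that omit the last
    diagonal entry. *)
Definition gram : 'M[R]_(n.-1) := trace_free *m trace_free^T.

Lemma gram_trace_free : gram = trace_free *m trace_free^T.
Proof. by []. Qed.

Lemma omegaE (x y : oneform R n) : omega x y =
  2 * pi * (((x : M) *m gram *m y^T) 0 1 - ((x : M) *m gram *m y^T) 1 0).
Proof.
rewrite /omega sumrB /gram mulmxA -mulmxA -trmx_mul -!diagE; congr (_ * (_ - _)).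
  by rewrite mxE; apply: eq_bigr => j _; rewrite [(diag y)^T _ _]mxE.
by rewrite mxE; apply: eq_bigr => j _; rewrite [(diag y)^T _ _]mxE.
Qed.

Lemma omega_linear_l (y : oneform R n) : linear (fun x : M => omega x y).
Proof.
move=> a u v; rewrite !omegaE /GRing.scale /= !mulmxDl -!scalemxAl !mxE; ring.
Qed.

Definition omega_form (y : oneform R n) : {linear M -> R} :=
  HB.pack (fun x : M => omega x y) (GRing.isLinear.Build _ _ _ _ _ (omega_linear_l y)).

Lemma omegaC (x y : oneform R n) : omega y x = - omega x y.
Proof.
rewrite /omega -mulrN -sumrN; congr (_ * _); apply: eq_bigr => j _; ring.
Qed.

Lemma omegaDl (x x' y : oneform R n) : omega (x + x') y = omega x y + omega x' y.
Proof. exact: (linearD (omega_form y)). Qed.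

Lemma omegaDr (x y y' : oneform R n) : omega x (y + y') = omega x y + omega x y'.
Proof. by rewrite omegaC omegaDl opprD -!omegaC. Qed.

Lemma omega_sumr (x : oneform R n) (I : Type) (r : seq I) (F : I -> oneform R n) :
  omega x (\sum_(i <- r) F i) = \sum_(i <- r) omega x (F i).
Proof.
transitivity (- omega_form x (\sum_(i <- r) F i)); first exact: omegaC.
by rewrite linear_sum -sumrN; apply: eq_bigr => i _; rewrite [RHS]omegaC.
Qed.

Lemma omegaZr (x y : oneform R n) a : omega x (a *: y) = a * omega x y.
Proof.
rewrite !omegaE linearZ /= -scalemxAr !mxE; ring.
Qed.

Lemma omega_basis_expand (x y : oneform R n) :
  omega x y = \sum_q mxvec (y : M) 0 q * omega x (e_ R q).
Proof.
rewrite {1}(sum_basis_mx (y : M)) omega_sumr; apply: eq_bigr => q _.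
exact: omegaZr.
Qed.

Lemma diagD (x y : oneform R n) i j : diag (x + y) i j = diag x i j + diag y i j.
Proof. by rewrite !diagE mulmxDl mxE. Qed.

Lemma diag_integral (m : 'M[int]_(2, n.-1)) i j :
  diag (integral_form R m) i j \is a Num.int.
Proof.
rewrite /diag mxE; case: (unlift _ _) => [j'|] /=; first by rewrite mxE intr_int.
by rewrite rpredN rpred_sum // => l _; rewrite mxE intr_int.
Qed.

Lemma regular_translate (m : 'M[int]_(2, n.-1)) (x : oneform R n) :
  U x -> U (x + integral_form R m).
Proof.
move=> /regularP Ux; apply/regularP => j l jl; have [i xi] := Ux j l jl; exists i.
apply: contra xi => h.
have := rpredB h (rpredB (diag_integral m i j) (diag_integral m i l)).
by rewrite !diagD; congr (_ \is a Num.int); ring.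
Qed.

Lemma sum_diag (x : oneform R n) i : \sum_j diag x i j = 0.
Proof.
rewrite big_ord_recr /= [X in _ + X]mxE unlift_none /=; apply/eqP; rewrite subr_eq0; apply/eqP.
apply: eq_bigr => l _; rewrite mxE.
have -> : widen_ord (leqnSn n.-1) l = lift ord_max l by apply: val_inj; rewrite /= /bump leqNgt ltn_ord.
by rewrite liftK.
Qed.

(** The definition of [weyl] gives all entries but the last, and the last one follows because both
    rows sum to zero. *)
Lemma diag_weyl w (x : oneform R n) i j : diag (weyl w x) i j = diag x i (w j).
Proof.
have lft l : diag (weyl w x) i (lift ord_max l) = diag x i (w (lift ord_max l)).
  by rewrite {1}/diag mxE liftK /= mxE.
case: (ordmax_cases j) => [->|[j' ->]]; last exact: lft.
have S1 := sum_diag x i; have S2 := sum_diag (weyl w x) i.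
have wid (l : 'I_n.-1) : widen_ord (leqnSn n.-1) l = lift ord_max l.
  by apply: val_inj; rewrite /= /bump leqNgt ltn_ord.
rewrite (reindex_inj (@perm_inj _ w)) /= in S1.
rewrite big_ord_recr /= in S1; rewrite big_ord_recr /= in S2.
have := etrans S2 (esym S1); under eq_bigr do rewrite wid lft.
by under [X in _ = X + _]eq_bigr do rewrite wid; exact: addrI.
Qed.

Lemma regular_weyl w (x : oneform R n) : U x -> U (weyl w x).
Proof.
move=> /regularP Ux; apply/regularP => j l jl.
have /Ux[i xi] : w j != w l by rewrite (inj_eq perm_inj).
by exists i; rewrite !diag_weyl.
Qed.

Lemma omega_weyl w (x y : oneform R n) : omega (weyl w x) (weyl w y) = omega x y.
Proof.
rewrite /omega [in RHS](reindex_inj (@perm_inj _ w)) /=.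
by congr (_ * _); apply: eq_bigr => j _; rewrite !diag_weyl.
Qed.

Lemma weylE w (x : oneform R n) i j : weyl w x i j = diag x i (w (lift ord_max j)).
Proof. by rewrite mxE. Qed.

Lemma weyl_linear w : linear (weyl w : M -> M).
Proof.
move=> a x y; apply/matrixP => i j.
transitivity (a * weyl w x i j + weyl w y i j); last by rewrite [RHS]mxE [X in _ = X + _]mxE.
by rewrite !weylE !diagE mulmxDl -scalemxAl [LHS]mxE [X in X + _ = _]mxE.
Qed.

Lemma comm_opE (A B : endo R n) f x : comm_op A B f x = A (B f) x - B (A f) x.
Proof. by rewrite -[- B _ _]mulN1r. Qed.

Definition weyl_lin w : {linear M -> M} :=
  HB.pack (weyl w : M -> M) (GRing.isLinear.Build _ _ _ _ _ (weyl_linear w)).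

Definition lin_coord (L : M -> M) : 'M[R]_(2 * n.-1) :=
  \matrix_(q, p) mxvec (L (e_ R p)) 0 q.

End SymplecticForm.

(** * The prequantum connection inside the algebra of operators *)

Section CovariantDerivatives.
Variables (R : realType) (n k : nat).
Local Notation M := 'M[R]_(2, n.-1).
Local Notation U := (@regular R n).
Local Notation C := R[i].
Local Notation E := (endo R n).
Implicit Types (f g psi : oneform R n -> C).

Lemma preendo_partial p : preendo (@partial R n p).
Proof.
split=> [f|f g sf sg fg x Ux|c f g x sf sg Ux].
- exact: smooth_partial.
- exact: partial_local fg x Ux.
- exact: partial_linear.
Qed.

Definition partial_endo p : E := mkendo (preendo_partial p).

Lemma preendo_mul c : smooth c -> preendo (fun f x => c x * f x).
Proof.
move=> sc; split=> [f sf|f g sf sg fg x Ux|d f g x sf sg Ux].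
- exact: smoothM sc sf.
- by rewrite fg.
- ring.
Qed.

Definition mul_endo (c : oneform R n -> C) : E :=
  match pselect (smooth c) with
  | left sc => mkendo (preendo_mul sc)
  | right _ => 0
  end.

Lemma mul_endoE c f x : smooth c -> smooth f -> U x -> mul_endo c f x = c x * f x.
Proof.
move=> sc sf Ux; rewrite /mul_endo; case: pselect => [h|/(_ sc)//].
exact: mkendoE.
Qed.

(** The connection form of [nabla]. The summand 0 gives it the shape c f + g of [smooth_lin] and
    [partial_linear]. *)
Definition potential (p : 'I_(2 * n.-1)) (x : oneform R n) : C :=
  - (iC R * (k%:R / 2)%:C) * (omega_form (e_ R p) x)%:C + 0.

Lemma potentialE p x : potential p x = - (iC R * (k%:R / 2 * omega x (e_ R p))%:C).
Proof. by rewrite /potential addr0 [(_ * omega _ _)%:C]rmorphM mulrA mulNr. Qed.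

Lemma smooth_potential p : smooth (potential p).
Proof. exact: smooth_lin _ (smooth_linear _) (@smooth_cst R n 0). Qed.

Lemma partial_potential q p x : U x ->
  partial q (potential p) x = - (iC R * (k%:R / 2 * omega (e_ R q) (e_ R p))%:C).
Proof.
move=> Ux; rewrite (partial_linear _ _ (smooth_linear _) (@smooth_cst R n 0) Ux).
by rewrite partial_cst addr0 partial_linear_form [(_ * omega _ _)%:C]rmorphM mulrA mulNr.
Qed.

Lemma nabla_potential p f x : nabla k p f x = partial p f x + potential p x * f x.
Proof. by rewrite /nabla potentialE mulNr. Qed.

Definition nabla_endo p : E := partial_endo p + mul_endo (potential p).

Lemma nabla_endoE p f x : smooth f -> U x -> nabla_endo p f x = nabla k p f x.
Proof.
move=> sf Ux; rewrite nabla_potential /nabla_endo endoDE.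
by rewrite (mkendoE _ sf Ux) (mul_endoE (smooth_potential p) sf Ux).
Qed.

Lemma nabla_local p f g : (forall x, U x -> f x = g x) ->
  forall x, U x -> nabla k p f x = nabla k p g x.
Proof.
by move=> fg x Ux; rewrite !nabla_potential (partial_local p fg Ux) fg.
Qed.

Lemma nabla_nabla p q f x : smooth f -> U x ->
  nabla_endo p (nabla_endo q f) x =
  partial p (partial q f) x +
  (- (iC R * (k%:R / 2 * omega (e_ R p) (e_ R q))%:C) * f x + potential q x * partial p f x)
   + potential p x * (partial q f x + potential q x * f x).
Proof.
move=> sf Ux; rewrite (nabla_endoE p (endo_smooth (nabla_endo q) sf) Ux).
have loc : forall y, U y -> nabla_endo q f y = partial q f y + potential q y * f y.
  by move=> y Uy; rewrite (nabla_endoE q sf Uy) nabla_potential.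
rewrite (nabla_local p loc Ux) nabla_potential.
rewrite (partialD p (smooth_partial q sf) (smoothM (smooth_potential q) sf) Ux).
by rewrite (partialM p (smooth_potential q) sf Ux) (partial_potential p q Ux).
Qed.

Definition Omega : 'M[R]_(2 * n.-1) := \matrix_(p, q) omega (e_ R p) (e_ R q).
Definition curvature : 'M[C]_(2 * n.-1) := (- ik R k) *: map_mx (real_complex R) Omega.

Lemma curvatureT : curvature^T = - curvature.
Proof. by apply/matrixP => p q; rewrite !mxE omegaC rmorphN mulrN. Qed.

(** The derivative of [potential q] along p is - (i k / 2) omega_pq, and by antisymmetry the
    opposite order doubles it. The remaining terms are symmetric in p and q. *)
Lemma comm_nabla p q : comm_op (nabla_endo p) (nabla_endo q) = (curvature p q)%:A.
Proof.
apply: endoP_ext => f x sf Ux; rewrite comm_opE endoZE (endo1E sf Ux).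
apply: (etrans (congr2 (fun a b => a - b) (nabla_nabla p q sf Ux) (nabla_nabla q p sf Ux))).
rewrite (partial_comm p q sf Ux).
rewrite /curvature !mxE [omega (e_ R q) _]omegaC.
have half : (2^-1 : R)%:C = 2^-1 by rewrite fmorphV rmorph_nat.
move: (omega (e_ R p) (e_ R q)) (partial q _ x) (partial p f x) (partial q f x) => w D1 D2 D3.
have e v : (k%:R / 2 * v)%:C = k%:R / 2 * v%:C :> C.
  by rewrite -half -(rmorph_nat (real_complex R) k) -!rmorphM.
by rewrite !e rmorphN /ik; field.
Qed.

Lemma second_orderE S f x : smooth f -> U x ->
  second_order k S f x = quad nabla_endo S f x.
Proof.
move=> sf Ux; rewrite /second_order /quad endo_sumE; apply: eq_bigr => p _.
rewrite endo_sumE; apply: eq_bigr => q _; rewrite endoZE endoME; congr (_ * _).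
rewrite (nabla_endoE p (endo_smooth (nabla_endo q) sf) Ux).
apply: nabla_local Ux => y Uy; exact: esym (nabla_endoE q sf Uy).
Qed.

Lemma second_order_local S f g : (forall x, U x -> f x = g x) ->
  forall x, U x -> second_order k S f x = second_order k S g x.
Proof.
move=> fg x Ux; apply: eq_bigr => p _; apply: eq_bigr => q _; congr (_ * _).
exact: (nabla_local p (fun y Uy => nabla_local q fg Uy) Ux).
Qed.

Section Pullback.
Variable L : {linear M -> M}.
Hypothesis LU : forall x, U x -> U (L x).

Lemma smooth_pull f : smooth f -> smooth (fun x => f (L x)).
Proof.
move=> sf; have -> : (fun x => f (L x)) = (fun x => f (L x + 0)).
  by apply/funext => x; rewrite addr0.
apply: (smooth_comp sf) => x Ux; rewrite addr0; exact: LU.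
Qed.

Lemma preendo_pull : preendo (fun f x => f (L x)).
Proof.
split=> [f|f g sf sg fg x Ux|c f g x sf sg Ux].
- exact: smooth_pull.
- exact: fg (LU Ux).
- by [].
Qed.

Definition pull_endo : E := mkendo preendo_pull.

Lemma pull_endoE f x : smooth f -> U x -> pull_endo f x = f (L x).
Proof. exact: mkendoE. Qed.

Hypothesis Lomega : forall x y, omega (L x) (L y) = omega x y.

(** As [L] preserves omega, omega (x, e_p) = omega (L x, L e_p) expands in the coordinates of L e_p.
    The potential thus transforms like the coordinate derivatives, and so does [nabla]. *)
Lemma nabla_pull p : nabla_endo p * pull_endo =
  pull_endo * \sum_q map_mx (real_complex R) (lin_coord L) q p *: nabla_endo q.
Proof.
apply: endoP_ext => f x sf Ux; rewrite !endoME.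
have ULx : U (L x + 0) by rewrite addr0; exact: LU.
rewrite (nabla_endoE p (endo_smooth pull_endo sf) Ux).
have loc : forall y, U y -> pull_endo f y = f (L y + 0).
  by move=> y Uy; rewrite (pull_endoE sf Uy) addr0.
rewrite (nabla_local p loc Ux) nabla_potential (partial_comp p sf ULx).
rewrite (pull_endoE (endo_smooth _ sf) Ux) addr0 endo_sumE.
have -> : potential p x * f (L x) = \sum_q (mxvec (L (e_ R p)) 0 q)%:C * (potential q (L x) * f (L x)).
  rewrite potentialE -Lomega (omega_basis_expand (L x) (L (e_ R p))).
  rewrite mulr_sumr rmorph_sum mulr_sumr -sumrN mulr_suml; apply: eq_bigr => q _.
  rewrite potentialE !rmorphM /=; ring.
have E q : (map_mx (real_complex R) (lin_coord L) q p *: nabla_endo q) f (L x) =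
    (mxvec (L (e_ R p)) 0 q)%:C * partial q f (L x) +
    (mxvec (L (e_ R p)) 0 q)%:C * (potential q (L x) * f (L x)).
  by rewrite endoZE !mxE (nabla_endoE q sf (LU Ux)) nabla_potential mulrDr.
by rewrite [RHS](eq_bigr _ (fun q _ => E q)) big_split.
Qed.

Lemma quad_pull S : quad nabla_endo S * pull_endo =
  pull_endo * quad nabla_endo (map_mx (real_complex R) (lin_coord L) *m S *m
    (map_mx (real_complex R) (lin_coord L))^T).
Proof. exact/quad_pullback/nabla_pull. Qed.

End Pullback.

Definition quasi_periodic psi := forall (m : 'M[int]_(2, n.-1)) x, U x ->
  psi (x + integral_form R m) = cocycle k (integral_form R m) x * psi x.

Definition cocycle_form (m : oneform R n) (x : M) : R := - (k%:R / 2) * omega x m.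

Lemma cocycle_form_linear m : linear (cocycle_form m).
Proof.
move=> a u v; rewrite /cocycle_form (omega_linear_l m a u v) /GRing.scale /=; ring.
Qed.

Definition cocycle_lin m : {linear M -> R} :=
  HB.pack (cocycle_form m) (GRing.isLinear.Build _ _ _ _ _ (cocycle_form_linear m)).

Lemma cocycleE (m x : oneform R n) : cocycle k m x =
  expi (cocycle_lin m x + k%:R * (pi * \sum_j diag m 0 j * diag m 1 j)).
Proof. by rewrite /cocycle /= /cocycle_form; congr expi; field. Qed.

Lemma smooth_cocycle m : @smooth R n (cocycle k m).
Proof.
have -> : cocycle k m = fun x => expi (cocycle_lin m x + k%:R * (pi * \sum_j diag m 0 j * diag m 1 j)).
  by apply/funext => x; rewrite cocycleE.
exact: smooth_expi.
Qed.

Lemma partial_cocycle p m x : partial p (@cocycle R n k m) x =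
  iC R * (- (k%:R / 2) * omega (e_ R p) m)%:C * cocycle k m x.
Proof.
have -> : cocycle k m = fun x => expi (cocycle_lin m x + k%:R * (pi * \sum_j diag m 0 j * diag m 1 j)).
  by apply/funext => y; rewrite cocycleE.
exact: partial_expi.
Qed.

(** The logarithmic derivative of the cocycle, - (i k / 2) omega (e_p, m), cancels the increment -
    (i k / 2) omega (m, e_p) of the potential under translation by m. *)
Lemma quasi_periodic_nabla p psi : smooth psi -> quasi_periodic psi ->
  quasi_periodic (nabla_endo p psi).
Proof.
move=> sp qp m x Ux; set m' := integral_form R m.
have Um := regular_translate m Ux.
rewrite (nabla_endoE p sp Um) (nabla_endoE p sp Ux) !nabla_potential.
have id_lin : linear (@idfun M) by [].
pose id' : {linear M -> M} := HB.pack (@idfun M) (GRing.isLinear.Build _ _ _ _ _ id_lin).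
have E1 : partial p psi (x + m') = partial p (fun y => psi (id' y + m')) x.
  rewrite (@partial_comp _ _ p psi id' m' x sp Um) /= (bigD1 p) //=.
  rewrite /e_ vec_mxK mxE !eqxx mul1r big1 ?addr0 // => q qp'.
  by rewrite mxE eqxx (negPf qp') mul0r.
have loc y : U y -> psi (id' y + m') = cocycle k m' y * psi y by exact: qp.
rewrite E1 (partial_local p loc Ux) (partialM p (smooth_cocycle m') sp Ux).
rewrite partial_cocycle (qp m x Ux) !potentialE omegaDl [omega m' _]omegaC !(rmorphM, rmorphD, rmorphN) /=.
ring.
Qed.

Lemma quasi_periodic_lin c psi phi : quasi_periodic psi -> quasi_periodic phi ->
  quasi_periodic (fun x => c * psi x + phi x).
Proof. by move=> q1 q2 m x Ux; rewrite (q1 m x Ux) (q2 m x Ux); ring. Qed.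

Lemma is_section_local psi phi : (forall x, U x -> psi x = phi x) ->
  is_section k psi -> is_section k phi.
Proof.
move=> pp [s q w]; split.
- exact: smooth_local pp s.
- move=> m x Ux; rewrite -(pp _ (regular_translate m Ux)) -(pp x Ux); exact: q.
- move=> v x Ux; rewrite -(pp _ (regular_weyl v Ux)) -(pp x Ux); exact: w.
Qed.

Lemma is_section_smooth psi : is_section k psi -> smooth psi.
Proof. by case. Qed.

Lemma is_section_zero : is_section k (fun _ : oneform R n => 0).
Proof. split; [exact: (@smooth_cst R n 0)|by move=> m x _; rewrite mulr0|by []]. Qed.

Lemma is_section_lin c psi phi : is_section k psi -> is_section k phi ->
  is_section k (fun x => c * psi x + phi x).
Proof.
move=> [s1 q1 w1] [s2 q2 w2]; split.
- exact: smooth_lin.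
- exact: quasi_periodic_lin.
- by move=> w x Ux; rewrite (w1 w x Ux) (w2 w x Ux).
Qed.

Definition preserves_sections (A : E) := forall psi, is_section k psi -> is_section k (A psi).

Lemma preserves1 : preserves_sections 1.
Proof.
move=> psi sp; apply: is_section_local (sp) => x Ux.
exact: esym (endo1E (is_section_smooth sp) Ux).
Qed.

Lemma preservesM A B : preserves_sections A -> preserves_sections B -> preserves_sections (A * B).
Proof. move=> hA hB psi sp; exact: hA (hB _ sp). Qed.

Lemma preserves_lin c A B : preserves_sections A -> preserves_sections B ->
  preserves_sections (c *: A + B).
Proof. by move=> hA hB psi sp; exact: is_section_lin (hA _ sp) (hB _ sp). Qed.

Lemma preserves0 : preserves_sections 0.
Proof. by move=> psi _; exact: is_section_zero. Qed.

Lemma preservesZ c A : preserves_sections A -> preserves_sections (c *: A).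
Proof. by move=> hA; rewrite -[_ *: _]addr0; apply: preserves_lin => //; exact: preserves0. Qed.

Lemma preservesD A B : preserves_sections A -> preserves_sections B -> preserves_sections (A + B).
Proof. by move=> hA hB; rewrite -[A]scale1r; exact: preserves_lin. Qed.

Lemma preserves_comm A B : preserves_sections A -> preserves_sections B ->
  preserves_sections (comm_op A B).
Proof.
move=> hA hB; rewrite /comm_op -scaleN1r addrC; apply: preserves_lin; exact: preservesM.
Qed.

(** Each [nabla] respects the translations by itself. The Weyl group mixes the directions, so
    invariance of [S] is what makes the contraction commute with it. *)
Lemma quad_section S :
  (forall w, map_mx (real_complex R) (lin_coord (weyl w : M -> M)) *m S *m
     (map_mx (real_complex R) (lin_coord (weyl w : M -> M)))^T = S) ->
  preserves_sections (quad nabla_endo S).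
Proof.
move=> SW psi sp; case: (sp) => s q w; split.
- exact: endo_smooth.
- have qsum (I : Type) (r : seq I) (F : I -> E) :
      (forall i, quasi_periodic (F i psi)) -> quasi_periodic ((\sum_(i <- r) F i) psi).
    move=> qF; elim: r => [|i r IH]; first by rewrite big_nil => m x _; rewrite !endo0E mulr0.
    by rewrite big_cons => m x Ux; rewrite !endoDE (qF i m x Ux) (IH m x Ux) mulrDr.
  apply: (qsum) => p; apply: (qsum) => r m x Ux; rewrite !endoZE !endoME.
  rewrite (quasi_periodic_nabla _ (endo_smooth _ s) (quasi_periodic_nabla _ s q) m Ux); ring.
- move=> v x Ux.
  have WU y : U y -> U (weyl_lin R v y) by exact: regular_weyl.
  have Wo y z : omega (weyl_lin R v y) (weyl_lin R v z) = omega y z by exact: omega_weyl.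
  have : (quad nabla_endo S * pull_endo WU) psi x = (pull_endo WU * quad nabla_endo S) psi x.
    by rewrite (quad_pull WU Wo) (SW v).
  rewrite !endoME (pull_endoE WU (endo_smooth _ s) Ux).
  move=> <-; congr (_ x); apply: endo_local => y Uy.
  by rewrite (pull_endoE WU s Uy) w.
Qed.

End CovariantDerivatives.

(** * The Kaehler metric *)

Section Kronecker.
Variables (K : comNzRingType) (m n : nat).
Implicit Types (A : 'M[K]_m) (B : 'M[K]_n).

(** For forms, the first factor acts on the two directions of the torus and the second on the Cartan
    subalgebra. The dependence on tau and the mapping class group live in the first, the Weyl group
    in the second. *)
Definition kron A B : 'M[K]_(m * n) :=
  \matrix_(p, q) mxvec (A *m vec_mx (delta_mx 0 q) *m B^T) 0 p.

Lemma mxvec_index_eq (i i' : 'I_m) (j j' : 'I_n) :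
  (mxvec_index i j == mxvec_index i' j') = (i == i') && (j == j').
Proof.
have := congr1 (fun u : 'rV[int]_(m * n) => u 0 (mxvec_index i j))
  (mxvec_delta _ i' j' : mxvec (delta_mx i' j' : 'M[int]_(m, n)) = delta_mx 0 _).
rewrite mxvecE !mxE eqxx /=.
move/eqP; rewrite eqr_nat => /eqP.
by case: (mxvec_index i j == _); case: (_ && _).
Qed.

Lemma kronE A B i a j b :
  kron A B (mxvec_index i a) (mxvec_index j b) = A i j * B a b.
Proof.
rewrite mxE mxvecE vec_mx_delta mxE (bigD1 b) //= big1 ?addr0; last first.
  move=> c cb; rewrite mxE big1 ?mul0r // => l _; by rewrite mxE (negPf cb) andbF mulr0.
rewrite !mxE (bigD1 j) //= big1 ?addr0; last first.
  by move=> l lj; rewrite mxE (negPf lj) mulr0.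
by rewrite mxE !eqxx mulr1.
Qed.

Lemma sum_mxvec_index (F : 'I_(m * n) -> K) :
  \sum_p F p = \sum_i \sum_j F (mxvec_index i j).
Proof.
rewrite pair_bigA /= (reindex _ (curry_mxvec_bij m n)) /=.
by apply: eq_bigr => -[i j] _.
Qed.

Lemma kronM A B A' B' : kron A B *m kron A' B' = kron (A *m A') (B *m B').
Proof.
apply/matrixP => p q; case/mxvec_indexP: p => i a; case/mxvec_indexP: q => j b.
rewrite mxE sum_mxvec_index kronE !mxE mulr_suml; apply: eq_bigr => l _.
by rewrite mulr_sumr; apply: eq_bigr => c _; rewrite !kronE mulrACA.
Qed.

Lemma kronT A B : (kron A B)^T = kron A^T B^T.
Proof.
apply/matrixP => p q; case/mxvec_indexP: p => i a; case/mxvec_indexP: q => j b.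
by rewrite mxE !kronE !mxE.
Qed.

Lemma kron11 : kron 1%:M 1%:M = 1%:M.
Proof.
apply/matrixP => p q; case/mxvec_indexP: p => i a; case/mxvec_indexP: q => j b.
by rewrite kronE !mxE mxvec_index_eq -natrM mulnb.
Qed.

Lemma kronDl A A' B : kron (A + A') B = kron A B + kron A' B.
Proof.
apply/matrixP => p q; case/mxvec_indexP: p => i a; case/mxvec_indexP: q => j b.
by rewrite [RHS]mxE !kronE mxE mulrDl.
Qed.

Lemma kronZl c A B : kron (c *: A) B = c *: kron A B.
Proof.
apply/matrixP => p q; case/mxvec_indexP: p => i a; case/mxvec_indexP: q => j b.
by rewrite [RHS]mxE !kronE mxE mulrA.
Qed.

Lemma kronNl A B : kron (- A) B = - kron A B.
Proof. by rewrite -scaleN1r kronZl scaleN1r. Qed.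

End Kronecker.

Lemma map_kron (K L : comNzRingType) (f : {rmorphism K -> L}) m n
    (A : 'M[K]_m) (B : 'M[K]_n) :
  map_mx f (kron A B) = kron (map_mx f A) (map_mx f B).
Proof.
apply/matrixP => p q; case/mxvec_indexP: p => i a; case/mxvec_indexP: q => j b.
by rewrite mxE !kronE !mxE rmorphM.
Qed.

Section KahlerMetric.
Variables (R : realType) (n : nat).
Local Notation M := 'M[R]_(2, n.-1).
Local Notation U := (@regular R n).
Local Notation C := R[i].
Local Notation trace_free := (trace_free R n).
Local Notation gram := (gram R n).
Implicit Types (tau v : R * R).

Lemma gramE : gram = 1%:M + const_mx 1.
Proof.
apply/matrixP => a b; rewrite !mxE big_ord_recr /= !mxE unlift_none /= mulrNN mulr1.
congr (_ + _).
have wid (l : 'I_n.-1) : widen_ord (leqnSn n.-1) l = lift ord_max l.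
  by apply: val_inj; rewrite /= /bump leqNgt ltn_ord.
rewrite (bigD1 a) //= big1 ?addr0.
  by rewrite !mxE wid liftK /= eqxx mul1r eq_sym.
by move=> l la; rewrite !mxE wid liftK /= eq_sym (negPf la) mul0r.
Qed.

Lemma gram_unit : gram \in unitmx.
Proof.
(* The Gram matrix is 1 + J with J the all-one matrix of size [n.-1]. As J J is [n.-1] times J, the
   inverse is 1 - J / [n.-1.+1]. *)
pose c : R := n.-1.+1%:R^-1.
suff /mulmx1_unit[] : gram *m (1%:M - c *: const_mx 1) = 1%:M by [].
have JJ : (const_mx 1 : 'M[R]_(n.-1)) *m (const_mx 1 : 'M[R]_(n.-1)) = n.-1%:R *: const_mx 1 :> 'M[R]_(n.-1).
  apply/matrixP => a b; rewrite !mxE (eq_bigr (fun _ => 1)); last by move=> i _; rewrite !mxE mulr1.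
  by rewrite sumr_const card_ord mulr1.
rewrite gramE mulmxBr mulmx1 -scalemxAr mulmxDl mul1mx JJ.
apply/matrixP => a b; rewrite !mxE /c -natr1; field.
by rewrite natr1 pnatr_eq0.
Qed.

Lemma gramT : gram^T = gram.
Proof. by rewrite gram_trace_free trmx_mul trmxK. Qed.

Definition weyl_mx (w : 'S_(n.-1.+1)) : 'M[R]_(n.-1) :=
  \matrix_(l, j) trace_free l (w (lift ord_max j)).

Lemma weyl_mxE w (x : M) : weyl w x = x *m weyl_mx w.
Proof.
apply/matrixP => i j; rewrite weylE diagE !mxE; apply: eq_bigr => l _.
by rewrite [weyl_mx _ _ _]mxE.
Qed.

Lemma lin_coordE (L : M -> M) (A : 'M[R]_2) (B : 'M[R]_(n.-1)) :
  (forall x, L x = A *m x *m B) -> lin_coord L = kron A B^T.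
Proof. by move=> LE; apply/matrixP => p q; rewrite !mxE LE trmxK. Qed.

(** On all the diagonal entries a Weyl element permutes the columns of [trace_free], which does not
    affect the product of that matrix with its transpose. *)
Lemma weyl_gram w : weyl_mx w *m gram *m (weyl_mx w)^T = gram.
Proof.
have WT : weyl_mx w *m trace_free = col_perm w trace_free.
  apply/matrixP => l j; pose x : M := delta_mx 0 l.
  have row0 p (B : 'M[R]_(n.-1, p)) c : (x *m B) 0 c = B l c.
    rewrite mxE (bigD1 l) //= big1 ?addr0 ?mxE ?eqxx ?mul1r // => l' l'l.
    by rewrite mxE (negPf l'l) andbF mul0r.
  have := diag_weyl w x 0 j; rewrite !diagE weyl_mxE -mulmxA !row0 => ->.
  by rewrite [RHS]mxE.
rewrite gram_trace_free mulmxA -mulmxA -trmx_mul WT.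
apply/matrixP => a b; rewrite !mxE [RHS](reindex_inj (@perm_inj _ w)) /=.
by apply: eq_bigr => j _; rewrite !mxE.
Qed.

Lemma weyl_invgram w : (weyl_mx w)^T *m invmx gram *m weyl_mx w = invmx gram.
Proof.
have := weyl_gram w; set W := weyl_mx w => WgW.
have Wu : W \in unitmx.
  by have := gram_unit; rewrite -WgW !unitmx_mul => /andP[/andP[]].
have WTu : W^T \in unitmx by rewrite unitmx_tr.
have gWT : gram *m W^T = invmx W *m gram by rewrite -{2}WgW !mulmxA mulVmx // mul1mx.
apply: (can_inj (mulKmx gram_unit)).
by rewrite !mulmxA gWT mulmxK ?gram_unit // mulVmx // mulmxV ?gram_unit.
Qed.

Definition eps2 (K : pzRingType) : 'M[K]_2 := mx2 0 1 (- 1) 0.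

Lemma mx2P (K : Type) (A : 'M[K]_2) : A = mx2 (A 0 0) (A 0 1) (A 1 0) (A 1 1).
Proof.
apply/matrixP => i j; rewrite mxE.
by case: i => [[|[|//]]] hi; case: j => [[|[|//]]] hj //=; congr (A _ _); apply: val_inj.
Qed.

Lemma mx2E (K : Type) (a b c d : K) :
  ((mx2 a b c d 0 0 = a) * (mx2 a b c d 0 1 = b) * (mx2 a b c d 1 0 = c) * (mx2 a b c d 1 1 = d))%type.
Proof. by rewrite !mxE. Qed.

Lemma mx2_mul (K : pzRingType) (a b c d a' b' c' d' : K) :
  mx2 a b c d *m mx2 a' b' c' d' =
  mx2 (a * a' + b * c') (a * b' + b * d') (c * a' + d * c') (c * b' + d * d').
Proof. by rewrite [LHS]mx2P !mxE !big_ord_recl !big_ord0 !mxE !addr0. Qed.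

Lemma mx2_T (K : Type) (a b c d : K) : (mx2 a b c d)^T = mx2 a c b d.
Proof. by rewrite [LHS]mx2P !mxE. Qed.

Lemma mx2_scale (K : pzRingType) (x a b c d : K) :
  x *: mx2 a b c d = mx2 (x * a) (x * b) (x * c) (x * d).
Proof. by rewrite [LHS]mx2P !mxE. Qed.

Lemma mx2_opp (K : pzRingType) (a b c d : K) : - mx2 a b c d = mx2 (- a) (- b) (- c) (- d).
Proof. by rewrite [LHS]mx2P !mxE. Qed.

Lemma mx2_1 (K : pzRingType) : 1%:M = mx2 1 0 0 1 :> 'M[K]_2.
Proof. by rewrite [LHS]mx2P !mxE. Qed.

Lemma mx2_det (K : comNzRingType) (a b c d : K) : \det (mx2 a b c d) = a * d - b * c.
Proof.
rewrite (expand_det_row _ 0) !big_ord_recl big_ord0 addr0 /cofactor !det_mx11 !mxE /=.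
by rewrite !expr0 !expr1 mul1r mulN1r mulrN.
Qed.

Section FixedPoint.
Variable tau : R * R.
Hypothesis htau : teich tau.
Let t2 : tau.2 != 0. Proof. by apply: lt0r_neq0; exact: htau. Qed.

Lemma det_metric : \det (metric tau) = tau.2 ^+ 2.
Proof. rewrite /metric mx2_det; ring. Qed.

Lemma hodgeE : hodge tau = mx2 (tau.1 / tau.2) (- tau.2^-1)
  ((tau.1 ^+ 2 + tau.2 ^+ 2) / tau.2) (- (tau.1 / tau.2)).
Proof.
have inv : invmx (metric tau) = tau.2 ^- 2 *: mx2 (tau.1 ^+ 2 + tau.2 ^+ 2) (- tau.1) (- tau.1) 1.
  have mu : metric tau \in unitmx by rewrite unitmxE det_metric unitfE expf_neq0.
  apply: (can_inj (mulKmx mu)); rewrite mulmxV // -scalemxAr mx2_mul mx2_scale mx2_1.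
  by congr mx2; field.
rewrite /hodge det_metric sqrtr_sqr (gtr0_norm htau) inv mx2_T -scalemxAr mx2_mul !mx2_scale.
by congr mx2; field.
Qed.

Lemma hodge_sqr : hodge tau *m hodge tau = - 1%:M.
Proof. by rewrite hodgeE mx2_mul mx2_1 mx2_opp; congr mx2; field. Qed.

(** The metric of tau scaled to determinant one, so a function of the conformal class alone; it is
    inverse to the Hodge inner product on constant 1-forms. *)
Definition metric_dual : 'M[R]_2 := mx2 (tau.2^-1) (tau.1 / tau.2) (tau.1 / tau.2)
  ((tau.1 ^+ 2 + tau.2 ^+ 2) / tau.2).

Lemma hodge_eps2 : hodge tau *m eps2 R = metric_dual.
Proof. by rewrite hodgeE mx2_mul; congr mx2; field. Qed.

Lemma eps2_sqr : eps2 R *m eps2 R = - 1%:M.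
Proof. by rewrite mx2_mul mx2_1 mx2_opp; congr mx2; ring. Qed.

Lemma lin_coord_J : lin_coord (J tau : M -> M) = kron (hodge tau) 1%:M.
Proof. by rewrite (@lin_coordE _ (hodge tau) 1%:M) ?trmx1 // => x; rewrite mulmx1. Qed.

Lemma Omega_kron : Omega R n = kron ((2 * pi) *: eps2 R) gram.
Proof.
apply/matrixP => p q; case/mxvec_indexP: p => i a; case/mxvec_indexP: q => j b.
rewrite kronE mxE omegaE /e_ !vec_mx_delta trmx_delta.
have E i' j' : (delta_mx i a *m gram *m delta_mx b j : 'M[R]_2) i' j' =
    ((i' == i) && (j' == j))%:R * gram a b.
  rewrite mxE (bigD1 b) //= big1 ?addr0; last first.
    by move=> c cb; rewrite [delta_mx b j _ _]mxE (negPf cb) mulr0.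
  rewrite [delta_mx b j _ _]mxE eqxx /= mxE (bigD1 a) //= big1 ?addr0; last first.
    by move=> c ca; rewrite [delta_mx i a _ _]mxE (negPf ca) andbF mul0r.
  rewrite [delta_mx i a _ _]mxE eqxx andbT mulrAC -natrM mulnb.
  by [].
rewrite !E /eps2 mx2_scale; move: (gram a b) => g; rewrite mxE.
case: i {E} => [[|[|//]]] hi; case: j => [[|[|//]]] hj /=; ring.
Qed.

Lemma kahler_kron : kahler n tau = Omega R n *m kron (hodge tau) 1%:M.
Proof.
rewrite -lin_coord_J; apply/matrixP => p q; rewrite !mxE omega_basis_expand.
by apply: eq_bigr => r _; rewrite !mxE mulrC.
Qed.

Lemma pi2_neq0 : 2 * pi != 0 :> R.
Proof. by rewrite mulf_neq0 ?pnatr_eq0 // gt_eqF // pi_gt0. Qed.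

Lemma inv_kahlerE : inv_kahler n tau = kron ((2 * pi)^-1 *: metric_dual) (invmx gram).
Proof.
have E : kahler n tau *m kron ((2 * pi)^-1 *: metric_dual) (invmx gram) = 1%:M.
  rewrite kahler_kron Omega_kron !kronM mulmx1 mulmxV ?gram_unit // -kron11; congr kron.
  rewrite -!scalemxAl -scalemxAr scalerA mulfV ?pi2_neq0 // scale1r -hodge_eps2.
  by rewrite !mulmxA -[_ *m hodge tau *m hodge tau]mulmxA hodge_sqr mulmxN mulmx1 mulNmx eps2_sqr opprK.
have [ku _] := mulmx1_unit E.
by apply: (can_inj (mulKmx ku)); rewrite E /inv_kahler mulmxV.
Qed.

Lemma inv_kahler_Omega : inv_kahler n tau *m Omega R n = - kron (hodge tau) 1%:M.
Proof.
rewrite inv_kahlerE Omega_kron kronM mulVmx ?gram_unit // -kronNl; congr kron.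
rewrite -scalemxAl -scalemxAr scalerA mulVf ?pi2_neq0 // scale1r -hodge_eps2.
by rewrite -mulmxA eps2_sqr mulmxN mulmx1.
Qed.

Lemma inv_kahlerT : (inv_kahler n tau)^T = inv_kahler n tau.
Proof.
rewrite inv_kahlerE kronT linearZ /= trmx_inv gramT; congr kron; congr (_ *: _).
by rewrite /metric_dual mx2_T.
Qed.
End FixedPoint.

Lemma weyl_coord w : lin_coord (weyl w : M -> M) = kron 1%:M (weyl_mx w)^T.
Proof. by apply: lin_coordE => x; rewrite mul1mx weyl_mxE. Qed.

Definition metric_dual_deriv v tau : 'M[R]_2 :=
  mx2 (- (v.2 / tau.2 ^+ 2)) (v.1 / tau.2 - tau.1 * v.2 / tau.2 ^+ 2)
      (v.1 / tau.2 - tau.1 * v.2 / tau.2 ^+ 2)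
      ((2 * tau.1 * v.1 + 2 * tau.2 * v.2) / tau.2 - (tau.1 ^+ 2 + tau.2 ^+ 2) * v.2 / tau.2 ^+ 2).

(** By [hodge_eps2] the matrix is the derivative of J times a constant, and differentiating J^2 = -
    1 makes that derivative anticommute with J. In terms of types, the variation of the metric has
    no (1,1) part. *)
Lemma hodge_deriv v tau : teich tau ->
  hodge tau *m metric_dual_deriv v tau *m (hodge tau)^T = - metric_dual_deriv v tau.
Proof.
move=> htau; have t2 : tau.2 != 0 by apply: lt0r_neq0; exact: htau.
rewrite hodgeE // mx2_T /metric_dual_deriv !mx2_mul mx2_opp.
by congr mx2; field.
Qed.

Lemma differentiable_fst_snd tau : differentiable (fst : R * R -> R) tau /\
  differentiable (snd : R * R -> R) tau.
Proof.
have l1 : linear (fst : R * R -> R) by [].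
have l2 : linear (snd : R * R -> R) by [].
pose f1 : {linear (R * R)%type -> R} := HB.pack (fst : R * R -> R) (GRing.isLinear.Build _ _ _ _ _ l1).
pose f2 : {linear (R * R)%type -> R} := HB.pack (snd : R * R -> R) (GRing.isLinear.Build _ _ _ _ _ l2).
split; [apply: (@linear_differentiable _ _ _ f1)|apply: (@linear_differentiable _ _ _ f2)] => x.
  exact: cvg_fst.
exact: cvg_snd.
Qed.

Lemma derive_fst_snd v tau : 'D_v (fst : R * R -> R) tau = v.1 /\ 'D_v (snd : R * R -> R) tau = v.2.
Proof.
have [d1 d2] := differentiable_fst_snd tau.
have l1 : linear (fst : R * R -> R) by [].
have l2 : linear (snd : R * R -> R) by [].
pose f1 : {linear (R * R)%type -> R} := HB.pack (fst : R * R -> R) (GRing.isLinear.Build _ _ _ _ _ l1).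
pose f2 : {linear (R * R)%type -> R} := HB.pack (snd : R * R -> R) (GRing.isLinear.Build _ _ _ _ _ l2).
rewrite !deriveE //; split.
  by rewrite (@diff_lin _ _ _ f1) // => x; exact: cvg_fst.
by rewrite (@diff_lin _ _ _ f2) // => x; exact: cvg_snd.
Qed.

Lemma metric_dual_is_derive v tau i j : teich tau ->
  differentiable (fun t => metric_dual t i j) tau /\
  'D_v (fun t => metric_dual t i j) tau = metric_dual_deriv v tau i j.
Proof.
move=> htau; have t2 : tau.2 != 0 by apply: lt0r_neq0; exact: htau.
have [d1 d2] := differentiable_fst_snd tau; have [e1 e2] := derive_fst_snd v tau.
have di := differentiableV d2 t2.
have D1 := @diff_derivable _ _ _ _ _ v d1; have D2 := @diff_derivable _ _ _ _ _ v d2.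
have Di := @diff_derivable _ _ _ _ _ v di.
have ei := deriveV t2 D2.
have dti := differentiableM d1 di.
have eti := deriveM D1 Di.
have dq := differentiableM (differentiableD (differentiableM d1 d1) (differentiableM d2 d2)) di.
have dq' := differentiableD (differentiableM d1 d1) (differentiableM d2 d2).
have eq1 := deriveM (@diff_derivable _ _ _ _ _ v dq') Di.
have eq2 := deriveD (@diff_derivable _ _ _ _ _ v (differentiableM d1 d1)) (@diff_derivable _ _ _ _ _ v (differentiableM d2 d2)).
have eq3 := deriveM D1 D1; have eq4 := deriveM D2 D2.
case: i => [[|[|//]]] hi; case: j => [[|[|//]]] hj.
- have -> : (fun t => metric_dual t (Ordinal hi) (Ordinal hj)) = (fun t => t.2^-1).
    by apply/funext => t; rewrite mxE.
  split; first exact: di.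
  by rewrite ei e2 mxE /= /GRing.scale /= mulNr mulrC.
- have -> : (fun t => metric_dual t (Ordinal hi) (Ordinal hj)) = (fun t => t.1 * t.2^-1).
    by apply/funext => t; rewrite mxE.
  split; first exact: dti.
  rewrite eti ei e1 e2 mxE /= /GRing.scale /=; field; exact: t2.
- have -> : (fun t => metric_dual t (Ordinal hi) (Ordinal hj)) = (fun t => t.1 * t.2^-1).
    by apply/funext => t; rewrite mxE.
  split; first exact: dti.
  rewrite eti ei e1 e2 mxE /= /GRing.scale /=; field; exact: t2.
- have -> : (fun t => metric_dual t (Ordinal hi) (Ordinal hj)) = (fun t => (t.1 * t.1 + t.2 * t.2) * t.2^-1).
    by apply/funext => t; rewrite mxE /= !expr2.
  split; first exact: dq.
  rewrite eq1 -[(_ + _) tau]/(tau.1 * tau.1 + tau.2 * tau.2) eq2 eq3 eq4 ei e1 e2 mxE /= /GRing.scale /=; field; exact: t2.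
Qed.

Lemma near_teich tau : teich tau -> \forall t \near tau, teich t.
Proof.
move=> htau; have c : (snd : R * R -> R) @ tau --> tau.2 by exact: cvg_snd.
have H : \forall t \near tau, 0 < t.2 := @cvgr_gt _ _ _ _ _ _ c 0 htau.
exact: H.
Qed.

Lemma inv_kahler_entry tau p q : teich tau ->
  exists c i j, forall t, teich t -> inv_kahler n t p q = c * metric_dual t i j /\
   forall t v, kron ((2 * pi)^-1 *: metric_dual_deriv v t) (invmx gram) p q = c * metric_dual_deriv v t i j.
Proof.
move=> htau; case/mxvec_indexP: p => i a; case/mxvec_indexP: q => j b.
exists ((2 * pi)^-1 * invmx gram a b), i, j => t ht; split=> [|t' v].
  by rewrite inv_kahlerE // kronE mxE mulrAC.
by rewrite kronE mxE mulrAC.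
Qed.

Lemma inv_kahler_is_derive v tau p q : teich tau ->
  differentiable (fun t => inv_kahler n t p q) tau /\
  V_inv_kahler n v tau p q = kron ((2 * pi)^-1 *: metric_dual_deriv v tau) (invmx gram) p q.
Proof.
move=> htau; have [c [i [j E]]] := inv_kahler_entry p q htau.
have [dm em] := metric_dual_is_derive v i j htau.
have nr : \forall t \near tau, inv_kahler n t p q = c * metric_dual t i j.
  by apply: filterS (near_teich htau) => t /E[].
have dcm : differentiable (fun t => c * metric_dual t i j) tau by exact: (differentiableZ c dm).
split.
  by apply: near_eq_differentiable dcm; apply: filterS nr => t ->.
rewrite mxE (near_eq_derive v nr) (E tau htau).2.
have := @deriveZ _ _ _ _ c _ _ (@diff_derivable _ _ _ _ _ v dm).
by rewrite em.
Qed.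

End KahlerMetric.

(** * The Laplace operator and its variation *)

Section HitchinWitten.
Variables (R : realType) (n k : nat).
Local Notation M := 'M[R]_(2, n.-1).
Local Notation U := (@regular R n).
Local Notation C := R[i].
Local Notation E := (endo R n).
Local Notation gram := (gram R n).
Local Notation CM := (map_mx (real_complex R)).
Local Notation Nb := (@nabla_endo R n k).
Implicit Types (tau v : R * R) (f psi : oneform R n -> C).

Definition laplace_endo tau : E := quad Nb (CM (inv_kahler n tau)).
Definition b_endo v tau : E := quad Nb (G n v tau).
Definition bbar_endo v tau : E := quad Nb (Gbar n v tau).
Definition a_endo tau : E := (- iC R / 2) *: laplace_endo tau.

(** Any [A] is allowed, because the Weyl group acts on the other factor only and preserves the
    inverse Gram matrix. *)
Lemma kron_preserves (A : 'M[C]_2) :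
  preserves_sections k (quad Nb (kron A (CM (invmx gram)))).
Proof.
apply: quad_section => w.
rewrite weyl_coord map_kron map_mx1 kronM mul1mx kronT kronM trmx1 mulmx1.
have {2}<- := weyl_invgram R w.
rewrite !map_mxM; congr (kron _ (_ *m _)).
by apply/matrixP => i j; rewrite !mxE.
Qed.

Section AtTau.
Variables (v tau : R * R).
Hypothesis htau : teich tau.

Let J2 : 'M[C]_2 := (CM (hodge tau)).
Let dH : 'M[R]_2 := (2 * pi)^-1 *: metric_dual_deriv v tau.
Let P10 : 'M[C]_2 := 2^-1 *: (1%:M - iC R *: J2).
Let P01 : 'M[C]_2 := 2^-1 *: (1%:M + iC R *: J2).
Let ig : 'M[C]_(n.-1) := (CM (invmx gram)).

Lemma Jmx_kron : Jmx n tau = kron J2 1%:M.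
Proof.
rewrite /J2 -(map_mx1 (real_complex R)) -map_kron -lin_coord_J.
by apply/matrixP => p q; rewrite !mxE.
Qed.

Lemma proj10_kron : proj10 n tau = kron P10 1%:M.
Proof.
by rewrite /proj10 Jmx_kron /P10 kronZl kronDl kronNl kronZl kron11.
Qed.

Lemma proj01_kron : proj01 n tau = kron P01 1%:M.
Proof. by rewrite /proj01 Jmx_kron /P01 kronZl kronDl kronZl kron11. Qed.

Lemma V_inv_kahlerE : V_inv_kahler n v tau = kron dH (invmx gram).
Proof. by apply/matrixP => p q; rewrite (inv_kahler_is_derive v p q htau).2. Qed.

Lemma G_kron : G n v tau = kron (P10 *m (CM (- dH)) *m P10^T) ig.
Proof.
rewrite /G proj10_kron V_inv_kahlerE -kronNl map_kron kronM kronT kronM.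
by rewrite mul1mx trmx1 mulmx1.
Qed.

Lemma Gbar_kron : Gbar n v tau = kron (P01 *m (CM (- dH)) *m P01^T) ig.
Proof.
rewrite /Gbar proj01_kron V_inv_kahlerE -kronNl map_kron kronM kronT kronM.
by rewrite mul1mx trmx1 mulmx1.
Qed.

Lemma J2_sqr : J2 *m J2 = - 1%:M.
Proof. by rewrite /J2 -map_mxM hodge_sqr // map_mxN map_mx1. Qed.

Lemma J2_P10 : J2 *m P10 = iC R *: P10.
Proof.
rewrite /P10 -scalemxAr mulmxBr mulmx1 -scalemxAr J2_sqr scalerA mulrC -scalerA; congr (_ *: _).
by rewrite scalerBr scalerA iC_sqr scaleN1r opprK scalerN opprK addrC.
Qed.

Lemma J2_P01 : J2 *m P01 = - iC R *: P01.
Proof.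
rewrite /P01 -scalemxAr mulmxDr mulmx1 -scalemxAr J2_sqr scalerA mulrC -scalerA; congr (_ *: _).
by rewrite scalerDr scalerA mulNr iC_sqr opprK scale1r scalerN scaleNr addrC.
Qed.

Lemma dH_T : dH^T = dH.
Proof. by rewrite /dH linearZ /= /metric_dual_deriv mx2_T. Qed.

Lemma invgramT : (invmx gram)^T = invmx gram.
Proof. by rewrite trmx_inv gramT. Qed.

Lemma map_T m p (A : 'M[R]_(m, p)) : (CM A)^T = (CM (A^T)).
Proof. by apply/matrixP => i j; rewrite !mxE. Qed.

Lemma GT : (G n v tau)^T = G n v tau.
Proof.
rewrite G_kron kronT /ig map_T invgramT !trmx_mul trmxK map_T linearN /= dH_T.
by rewrite mulmxA.
Qed.

Lemma GbarT : (Gbar n v tau)^T = Gbar n v tau.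
Proof.
rewrite Gbar_kron kronT /ig map_T invgramT !trmx_mul trmxK map_T linearN /= dH_T.
by rewrite mulmxA.
Qed.

Lemma inv_kahlerCT : ((CM (inv_kahler n tau)))^T = (CM (inv_kahler n tau)).
Proof. by rewrite map_T inv_kahlerT. Qed.

Lemma inv_kahler_curvature : (CM (inv_kahler n tau)) *m curvature R n k = ik R k *: kron J2 1%:M.
Proof.
rewrite /curvature -scalemxAr -map_mxM inv_kahler_Omega // map_mxN map_kron map_mx1.
by rewrite scalerN scaleNr opprK.
Qed.

(** Transposing the hypothesis gives the product in the opposite order with eigenvalue - c. The two
    terms of [comm_quad] therefore agree, and 2 (c + c) = 4 c. *)
Lemma comm_type c (S : 'M[C]_(2 * n.-1)) : S^T = S ->
  (CM (inv_kahler n tau)) *m curvature R n k *m S = c *: S ->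
  comm_op (laplace_endo tau) (quad Nb S) = (4 * c) *: quad Nb S.
Proof.
move=> St E1; rewrite (comm_quad (@comm_nabla R n k) (@curvatureT R n k) inv_kahlerCT St).
have E2 : S *m curvature R n k *m (CM (inv_kahler n tau)) = - (c *: S).
  have := congr1 trmx E1; rewrite !trmx_mul [(c *: S)^T]linearZ /= St curvatureT inv_kahlerCT mulNmx mulmxN mulmxA.
  by move=> <-; rewrite opprK.
by rewrite E1 E2 opprK -[quad _ _]/(quad _ _) -scalerDl scalerA linearZ /=; congr (_ *: _); ring.
Qed.

(** On the image of the (1,0) projection J is i, so i k J acts on [G] as - k. *)
Lemma comm_laplace_b : comm_op (laplace_endo tau) (b_endo v tau) = (- 4 * k%:R) *: b_endo v tau.
Proof.
rewrite /b_endo (@comm_type (- k%:R)); first by congr (_ *: _); ring.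
  exact: GT.
rewrite inv_kahler_curvature -scalemxAl G_kron kronM mul1mx !mulmxA J2_P10 -!scalemxAl kronZl scalerA.
congr (_ *: _); rewrite /ik mulrAC iC_sqr; ring.
Qed.

Lemma comm_laplace_bbar : comm_op (laplace_endo tau) (bbar_endo v tau) = (4 * k%:R) *: bbar_endo v tau.
Proof.
rewrite /bbar_endo (@comm_type k%:R) //; first exact: GbarT.
rewrite inv_kahler_curvature -scalemxAl Gbar_kron kronM mul1mx !mulmxA J2_P01 -!scalemxAl kronZl scalerA.
by congr (_ *: _); rewrite /ik mulrN mulrAC iC_sqr; ring.
Qed.

Lemma comm_a_b : comm_op (a_endo tau) (b_endo v tau) = (2 * ik R k) *: b_endo v tau.
Proof.
by rewrite /a_endo comm_opZl comm_laplace_b scalerA; congr (_ *: _); rewrite /ik; field.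
Qed.

Lemma comm_a_bbar : comm_op (a_endo tau) (bbar_endo v tau) = - ((2 * ik R k) *: bbar_endo v tau).
Proof.
by rewrite /a_endo comm_opZl comm_laplace_bbar scalerA -scaleNr; congr (_ *: _); rewrite /ik; field.
Qed.

(** For c = i and c = - i, J A J^T = - A reduces (1 + c J) A (1 + c J)^T to 2 A + c (J A + A J^T).
    In the sum of the two the mixed terms cancel. *)
Lemma G_Gbar : G n v tau + Gbar n v tau = (CM (- V_inv_kahler n v tau)).
Proof.
set A : 'M[C]_2 := CM (- dH).
have JAJ : J2 *m A *m J2^T = - A.
  rewrite /J2 /A map_T -!map_mxM -map_mxN; congr map_mx.
  rewrite mulmxN mulNmx; congr (- _).
  by rewrite /dH -scalemxAr -scalemxAl hodge_deriv // scalerN.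
transitivity (kron (P10 *m A *m P10^T + P01 *m A *m P01^T) ig).
  by rewrite G_kron Gbar_kron kronDl.
transitivity (kron A ig); last by rewrite V_inv_kahlerE -kronNl map_kron.
congr (kron _ ig).
have key c : c * c = -1 -> (1%:M + c *: J2) *m A *m (1%:M + c *: J2)^T =
    2 *: A + c *: (J2 *m A + A *m J2^T).
  move=> cc; rewrite [(_ + _)^T]linearD /= [(c *: J2)^T]linearZ /= trmx1 mulmxDl mul1mx.
  rewrite mulmxDr mulmx1 mulmxDl -!scalemxAr -!scalemxAl scalerA cc scaleN1r JAJ opprK.
  by rewrite scalerDr scaler_nat mulr2n [_ *: (A *m _) + A]addrC addrACA.
have half (B : 'M[C]_2) : (2^-1 *: B) *m A *m (2^-1 *: B)^T = 4^-1 *: (B *m A *m B^T).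
  rewrite [(2^-1 *: B)^T]linearZ /= -!scalemxAl -scalemxAr scalerA.
  by congr (_ *: _); field.
have iNi : - iC R * - iC R = -1 by rewrite mulrNN iC_sqr.
rewrite /P10 /P01 !half -scaleNr (key _ iNi) (key _ (@iC_sqr R)) -scalerDr scaleNr.
rewrite addrACA addNr addr0 -scalerDl scalerA.
by rewrite (_ : 4^-1 * (2 + 2) = 1 :> C) ?scale1r //; field.
Qed.

End AtTau.

Lemma laplace_preserves tau : teich tau -> preserves_sections k (laplace_endo tau).
Proof.
by move=> htau; rewrite /laplace_endo inv_kahlerE // map_kron; exact: kron_preserves.
Qed.

Lemma b_preserves v tau : teich tau -> preserves_sections k (b_endo v tau).
Proof. by move=> htau; rewrite /b_endo G_kron //; exact: kron_preserves. Qed.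

Lemma bbar_preserves v tau : teich tau -> preserves_sections k (bbar_endo v tau).
Proof. by move=> htau; rewrite /bbar_endo Gbar_kron //; exact: kron_preserves. Qed.

(** The bridge from raw operators, meaningful on sections only, to the algebra acting on all smooth
    functions. Preservation of sections is included so that [rep] is stable under composition. *)
Definition rep (D : oper R n) (A : E) : Prop := preserves_sections k A /\
  forall psi x, is_section k psi -> U x -> D psi x = A psi x.

Lemma rep_section D A psi : rep D A -> is_section k psi -> is_section k (D psi).
Proof.
move=> [pA DA] sp; apply: is_section_local (pA _ sp) => x Ux; exact: esym (DA _ _ sp Ux).
Qed.

Lemma rep_second_order S : preserves_sections k (quad Nb S) ->
  rep (second_order k S) (quad Nb S).
Proof.
by move=> pS; split=> // psi x sp Ux; exact: second_orderE (is_section_smooth sp) Ux.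
Qed.

Lemma rep_laplace tau : teich tau -> rep (laplace k tau) (laplace_endo tau).
Proof. by move=> htau; apply: rep_second_order; exact: laplace_preserves. Qed.

Lemma rep_b v tau : teich tau -> rep (b_op k v tau) (b_endo v tau).
Proof. by move=> htau; apply: rep_second_order; exact: b_preserves. Qed.

Lemma rep_bbar v tau : teich tau -> rep (bbar_op k v tau) (bbar_endo v tau).
Proof. by move=> htau; apply: rep_second_order; exact: bbar_preserves. Qed.

Lemma repZ c D A : rep D A -> rep (fun psi x => c * D psi x) (c *: A).
Proof.
move=> [pA DA]; split; first exact: preservesZ.
by move=> psi x sp Ux; rewrite endoZE (DA psi x sp Ux).
Qed.

Lemma repD D A D' A' : rep D A -> rep D' A' -> rep (fun psi x => D psi x + D' psi x) (A + A').
Proof.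
move=> [pA DA] [pA' DA']; split; first exact: preservesD.
by move=> psi x sp Ux; rewrite endoDE (DA psi x sp Ux) (DA' psi x sp Ux).
Qed.

Lemma rep_sum (I : Type) (r : seq I) (P : pred I) (D : I -> oper R n) (A : I -> E) :
  (forall i, P i -> rep (D i) (A i)) ->
  rep (fun psi x => \sum_(i <- r | P i) D i psi x) (\sum_(i <- r | P i) A i).
Proof.
move=> h; split; first by apply: big_ind => [||i /h[]//]; [exact: preserves0|exact: preservesD].
by move=> psi x sp Ux; rewrite endo_sumE; apply: eq_bigr => i /h[_ ->].
Qed.

Lemma repM D A D' A' : rep D A -> rep D' A' -> rep (fun psi => D (D' psi)) (A * A').
Proof.
move=> rA rA'; have [pA DA] := rA; have [pA' DA'] := rA'.
split; first exact: preservesM.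
move=> psi x sp Ux; rewrite endoME (DA _ x (rep_section rA' sp) Ux).
have loc y : U y -> D' psi y = A' psi y by exact: DA'.
by rewrite (endo_local A loc).
Qed.

Lemma rep_bracket D A D' A' : rep D A -> rep D' A' -> rep (bracket D D') (comm_op A A').
Proof.
move=> rA rA'; have r1 := repM rA rA'; have r2 := repM rA' rA.
split; first by apply: preserves_comm; [case: rA|case: rA'].
move=> psi x sp Ux; rewrite comm_opE /bracket.
by case: r1 => _ ->//; case: r2 => _ ->.
Qed.

Lemma rep_iter_bracket D A D' A' m : rep D A -> rep D' A' ->
  rep (iter m (bracket D) D') (iter m (comm_op A) A').
Proof. by move=> rA rA'; elim: m => [//|m IH]; exact: rep_bracket. Qed.

Lemma rep_eq D A D' A' : rep D A -> rep D' A' -> A = A' -> eq_oper k D D'.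
Proof.
by move=> [_ DA] [_ DA'] AA psi x sp Ux; rewrite (DA psi x sp Ux) (DA' psi x sp Ux) AA.
Qed.

Lemma rep_eq_oper D D' A : eq_oper k D D' -> rep D A -> rep D' A.
Proof. by move=> DD [pA DA]; split=> // psi x sp Ux; rewrite -(DD psi x sp Ux) DA. Qed.

Lemma rep_id : rep id 1.
Proof.
split; first exact: preserves1.
by move=> psi x sp Ux; rewrite endo1E //; exact: is_section_smooth sp.
Qed.

Definition power_endo (D : E) m tau : E := (m`!%:R)^-1 *: iter m (comm_op (a_endo tau)) D.

Lemma rep_A D A m tau : teich tau -> rep D A -> rep (A_op k m D tau) (power_endo A m tau).
Proof.
move=> htau rA; apply: repZ; apply: rep_iter_bracket => //.
by apply: repZ; exact: rep_laplace.
Qed.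
End HitchinWitten.

(** * Differential operators and their dependence on tau *)

Section DifferentialOperators.
Variables (R : realType) (n k : nat).
Local Notation U := (@regular R n).
Local Notation C := R[i].
Local Notation E := (endo R n).
Local Notation CM := (map_mx (real_complex R)).
Local Notation Nb := (@nabla_endo R n k).
Implicit Types (f psi : oneform R n -> C) (A B : E).

(** Terms are indexed by an arbitrary finite type, so that sums and the Leibniz rule are handled by
    disjoint unions; [dop_diffop] enumerates it at the end. *)
Definition dop A : Prop :=
  exists (I : finType) (c : I -> oneform R n -> C) (w : I -> seq 'I_(2 * n.-1)),
    (forall i, smooth (c i)) /\
    forall f x, smooth f -> U x -> A f x = \sum_i c i x * partials (w i) f x.

Definition word_endo (w : seq 'I_(2 * n.-1)) : E := \prod_(p <- w) partial_endo R p.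

Lemma word_endoE w f x : smooth f -> U x -> word_endo w f x = partials w f x.
Proof.
move=> sf; elim: w x => [|p w IH] x Ux.
  by rewrite /word_endo big_nil; exact: endo1E.
rewrite /word_endo big_cons endoME.
rewrite (mkendoE (@preendo_partial R n p) (endo_smooth (word_endo w) sf) Ux).
exact: partial_local IH x Ux.
Qed.

Lemma dop0 : dop 0.
Proof.
exists 'I_0, (fun _ _ => 0), (fun _ => [::]); split=> [[]//|f x _ _].
by rewrite big_ord0.
Qed.

Lemma dopD A B : dop A -> dop B -> dop (A + B).
Proof.
move=> [I [c [w [sc Aw]]]] [J [d [v [sd Bv]]]].
exists (I + J)%type, (fun s => match s with inl i => c i | inr j => d j end),
  (fun s => match s with inl i => w i | inr j => v j end).
split=> [[i|j]|f x sf Ux]; [exact: sc|exact: sd|].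
by rewrite endoDE big_sumType /= (Aw f x sf Ux) (Bv f x sf Ux).
Qed.

Lemma dop_sum (I : Type) (r : seq I) (F : I -> E) :
  (forall i, dop (F i)) -> dop (\sum_(i <- r) F i).
Proof. by move=> h; apply: big_ind => [|x y|i _]; [exact: dop0|exact: dopD|exact: h]. Qed.

Lemma dop_mul_fun c A : smooth c -> dop A -> dop (mul_endo c * A).
Proof.
move=> sc [I [d [w [sd Aw]]]]; exists I, (fun i x => c x * d i x), w.
split=> [i|f x sf Ux]; first exact: smoothM sc (sd i).
rewrite endoME (mul_endoE sc (endo_smooth A sf) Ux) (Aw f x sf Ux) mulr_sumr.
by apply: eq_bigr => i _; rewrite mulrA.
Qed.

Lemma dopZ c A : dop A -> dop (c *: A).
Proof.
move=> [I [d [w [sd Aw]]]]; exists I, (fun i x => c * d i x), w.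
split=> [i|f x sf Ux]; first exact: smoothM (@smooth_cst R n c) (sd i).
rewrite endoZE (Aw f x sf Ux) mulr_sumr.
by apply: eq_bigr => i _; rewrite mulrA.
Qed.

Lemma partial_sum p (I : Type) (r : seq I) (F : I -> oneform R n -> C) x :
  (forall i, smooth (F i)) -> U x ->
  partial p (fun y => \sum_(i <- r) F i y) x = \sum_(i <- r) partial p (F i) x.
Proof.
move=> sF Ux; elim: r => [|i r IH].
  by rewrite big_nil; under eq_fun do rewrite big_nil; exact: partial_cst.
rewrite big_cons -IH -(partialD p (sF i) (smooth_sum r sF) Ux).
by under eq_fun do rewrite big_cons.
Qed.

Lemma dop_partial p A : dop A -> dop (partial_endo R p * A).
Proof.
move=> [I [d [w [sd Aw]]]].
exists (I + I)%type, (fun s => match s with inl i => partial p (d i) | inr i => d i end),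
  (fun s => match s with inl i => w i | inr i => p :: w i end).
split=> [[i|i]|f x sf Ux]; [exact: smooth_partial (sd i)|exact: sd|].
rewrite endoME (mkendoE (@preendo_partial R n p) (endo_smooth A sf) Ux).
have loc y : U y -> A f y = \sum_i d i y * partials (w i) f y by exact: Aw.
have sF i : smooth (fun y => d i y * partials (w i) f y).
  exact: smoothM (sd i) (smooth_partials (w i) sf).
rewrite (partial_local p loc Ux) (partial_sum p (index_enum I) sF Ux).
rewrite big_sumType /= -big_split; apply: eq_bigr => i _.
exact: partialM (sd i) (smooth_partials (w i) sf) Ux.
Qed.

Lemma dop_word w A : dop A -> dop (word_endo w * A).
Proof.
move=> dA; elim: w => [|p w IH]; first by rewrite /word_endo big_nil mul1r.
by rewrite /word_endo big_cons -mulrA; exact: dop_partial.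
Qed.

(** The left factor is written as a sum of multiplications composed with words of partial
    derivatives; these are absorbed one at a time, by the Leibniz rule. *)
Lemma dopM A B : dop A -> dop B -> dop (A * B).
Proof.
move=> [I [c [w [sc Aw]]]] dB.
suff -> : A * B = \sum_i mul_endo (c i) * (word_endo (w i) * B).
  by apply: dop_sum => i; exact: dop_mul_fun (sc i) (dop_word _ dB).
apply: endoP_ext => f x sf Ux; rewrite endoME endo_sumE (Aw _ x (endo_smooth B sf) Ux).
apply: eq_bigr => i _; rewrite endoME (mul_endoE (sc i) (endo_smooth _ sf) Ux) endoME.
by rewrite (word_endoE _ (endo_smooth B sf) Ux).
Qed.

Lemma dop1 : dop 1.
Proof.
exists unit, (fun _ _ => 1), (fun _ => [::]); split=> [_|f x sf Ux]; first exact: smooth_cst.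
by rewrite (endo1E sf Ux) big_const card_unit /= addr0 mul1r.
Qed.

Lemma dop_nabla p : dop (Nb p).
Proof.
apply: dopD; first by rewrite -[partial_endo R p]mulr1; exact: dop_partial dop1.
rewrite -[mul_endo _]mulr1; exact: dop_mul_fun (smooth_potential k p) dop1.
Qed.

Lemma dop_quad S : dop (quad Nb S).
Proof.
apply: dop_sum => p; apply: dop_sum => q; apply: dopZ; apply: dopM; exact: dop_nabla.
Qed.

Lemma dop_comm A B : dop A -> dop B -> dop (comm_op A B).
Proof.
move=> dA dB; rewrite /comm_op -scaleN1r; apply: dopD; first exact: dopM.
by apply: dopZ; exact: dopM.
Qed.

Lemma dop_power A m tau : dop A -> dop (power_endo k A m tau).
Proof.
move=> dA; apply: dopZ; elim: m => [//|m IH] /=; apply: dop_comm => //.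
by apply: dopZ; exact: dop_quad.
Qed.

Lemma dop_diffop D A : rep k D A -> dop A -> is_diffop k D.
Proof.
move=> rA [I [c [w [sc Aw]]]]; split; first by move=> psi sp; exact: rep_section rA sp.
exists #|I|, (fun j => c (enum_val j)), (fun j => w (enum_val j)); split=> [j|psi x sp Ux].
  exact: sc.
case: rA => _ DA; rewrite (DA psi x sp Ux) (Aw psi x (is_section_smooth sp) Ux).
rewrite (reindex (@enum_val I predT)) //=.
by apply: onW_bij; exact: enum_val_bij.
Qed.

(** [D] is controlled on sections only; its coefficients define an extension to all smooth
    functions. *)
Lemma diffop_rep D : is_diffop k D -> exists2 A, rep k D A & dop A.
Proof.
move=> [Ds [N [c [w [sc Dw]]]]].
pose A : E := \sum_j mul_endo (c j) * word_endo (w j).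
have AE f x : smooth f -> U x -> A f x = \sum_j c j x * partials (w j) f x.
  move=> sf Ux; rewrite endo_sumE; apply: eq_bigr => j _.
  by rewrite endoME (mul_endoE (sc j) (endo_smooth _ sf) Ux) (word_endoE _ sf Ux).
have DA psi x : is_section k psi -> U x -> D psi x = A psi x.
  by move=> sp Ux; rewrite (AE psi x (is_section_smooth sp) Ux) (Dw psi x sp Ux).
exists A; last by exists 'I_N, c, w.
split=> // psi sp; apply: is_section_local (Ds psi sp) => x Ux; exact: DA.
Qed.

End DifferentialOperators.

(** * Differentiation of operators along Teichmueller space *)

Section TeichmuellerFamilies.
Variables (R : realType) (n : nat).
Local Notation U := (@regular R n).
Local Notation C := R[i].
Local Notation E := (endo R n).
Implicit Types (tau v : R * R).

Lemma cdiff_cst (c : C) tau : cdifferentiable (fun _ : R * R => c) tau.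
Proof. by split; exact: differentiable_cst. Qed.

Lemma cderive_cst (c : C) v tau : cderive v (fun _ : R * R => c) tau = 0.
Proof. by rewrite /cderive !derive_cst. Qed.

Lemma cdiffM (f g : R * R -> C) tau : cdifferentiable f tau -> cdifferentiable g tau ->
  cdifferentiable (fun t => f t * g t) tau /\
  forall v, cderive v (fun t => f t * g t) tau = cderive v f tau * g tau + f tau * cderive v g tau.
Proof.
move=> [f1 f2] [g1 g2]; split.
  split; rewrite /=.
    under eq_fun do rewrite ReM.
    exact: differentiableD (differentiableM f1 g1) (differentiableZ (-1) (differentiableM f2 g2)).
  by under eq_fun do rewrite ImM; exact: differentiableD (differentiableM f1 g2) (differentiableM f2 g1).
move=> v; rewrite /cderive.
under eq_fun do rewrite ReM; under [X in _ +i* 'D__ X _]eq_fun do rewrite ImM.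
have F1 := @diff_derivable _ _ _ _ _ v f1; have F2 := @diff_derivable _ _ _ _ _ v f2.
have G1 := @diff_derivable _ _ _ _ _ v g1; have G2 := @diff_derivable _ _ _ _ _ v g2.
have d1 := derivableM F1 G1; have d2 := derivableM F2 G2.
have d3 := derivableM F1 G2; have d4 := derivableM F2 G1.
rewrite (deriveD d3 d4) (deriveD d1 (@derivableZ _ _ _ _ (- 1) _ _ d2)) (@deriveZ _ _ _ _ (- 1) _ _ d2).
rewrite (deriveM F1 G1) (deriveM F2 G2) (deriveM F1 G2) (deriveM F2 G1).
move: ('D_v (fun y => complex.Re (f y)) tau) ('D_v (fun y => complex.Im (f y)) tau).
move: ('D_v (fun y => complex.Re (g y)) tau) ('D_v (fun y => complex.Im (g y)) tau).
move: (f tau) (g tau) => [a1 a2] [b1 b2] c1 c2 d1' d2'.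
by apply: eqC_ReIm; rewrite /= /GRing.scale /=; ring.
Qed.

Lemma cdiffD (f g : R * R -> C) tau : cdifferentiable f tau -> cdifferentiable g tau ->
  cdifferentiable (fun t => f t + g t) tau /\
  forall v, cderive v (fun t => f t + g t) tau = cderive v f tau + cderive v g tau.
Proof.
move=> [f1 f2] [g1 g2]; split.
  split; rewrite /=.
    by under eq_fun do rewrite ReD; exact: differentiableD f1 g1.
  by under eq_fun do rewrite ImD; exact: differentiableD f2 g2.
move=> v; rewrite /cderive.
under eq_fun do rewrite ReD; under [X in _ +i* 'D__ X _]eq_fun do rewrite ImD.
rewrite (deriveD (@diff_derivable _ _ _ _ _ v f1) (@diff_derivable _ _ _ _ _ v g1)).
by rewrite (deriveD (@diff_derivable _ _ _ _ _ v f2) (@diff_derivable _ _ _ _ _ v g2)).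
Qed.

Lemma cdiff_sum (I : Type) (r : seq I) (F : I -> R * R -> C) tau :
  (forall i, cdifferentiable (F i) tau) ->
  cdifferentiable (fun t => \sum_(i <- r) F i t) tau /\
  forall v, cderive v (fun t => \sum_(i <- r) F i t) tau = \sum_(i <- r) cderive v (F i) tau.
Proof.
move=> dF; elim: r => [|i r [IH1 IH2]].
  split=> [|v]; under eq_fun do rewrite big_nil; first exact: cdiff_cst.
  by rewrite big_nil cderive_cst.
have [h1 h2] := cdiffD (dF i) IH1.
split=> [|v]; under eq_fun do rewrite big_cons; first exact: h1.
by rewrite big_cons h2 IH2.
Qed.

(* Such a family of operators depends on tau through scalar coefficients only,
   so that differentiation in tau commutes with composition of operators. *)
Definition family_deriv (F : R * R -> E) tau (F' : R * R -> E) : Prop :=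
  exists (I : finType) (c : I -> R * R -> C) (B : I -> E),
    [/\ forall i, cdifferentiable (c i) tau,
        forall t, F t = \sum_i c i t *: B i
      & forall v, F' v = \sum_i cderive v (c i) tau *: B i].

Lemma family_deriv_cst (A : E) tau : family_deriv (fun _ => A) tau (fun _ => 0).
Proof.
exists unit, (fun _ _ => 1), (fun _ => A); split=> [_|_|v].
- exact: cdiff_cst.
- by rewrite big_const card_unit /= addr0 scale1r.
- by rewrite big_const card_unit /= addr0 cderive_cst scale0r.
Qed.

Lemma family_derivD F G tau F' G' : family_deriv F tau F' -> family_deriv G tau G' ->
  family_deriv (fun t => F t + G t) tau (fun v => F' v + G' v).
Proof.
move=> [I [c [B [dc FE FE']]]] [J [d [D [dd GE GE']]]].
exists (I + J)%type, (fun s => match s with inl i => c i | inr j => d j end),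
  (fun s => match s with inl i => B i | inr j => D j end).
split=> [[i|j]|t|v]; [exact: dc|exact: dd| |].
  by rewrite big_sumType /= FE GE.
by rewrite big_sumType /= FE' GE'.
Qed.

Lemma family_derivM F G tau F' G' : family_deriv F tau F' -> family_deriv G tau G' ->
  family_deriv (fun t => F t * G t) tau (fun v => F' v * G tau + F tau * G' v).
Proof.
move=> [I [c [B [dc FE FE']]]] [J [d [D [dd GE GE']]]].
exists (I * J)%type, (fun s t => c s.1 t * d s.2 t), (fun s => B s.1 * D s.2).
split=> [s|t|v]; first by have [] := cdiffM (dc s.1) (dd s.2).
  rewrite FE GE mulr_suml -(pair_bigA _ (fun i j => (c i t * d j t) *: (B i * D j))) /=.
  apply: eq_bigr => i _; rewrite mulr_sumr; apply: eq_bigr => j _.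
  by rewrite -scalerAl -scalerAr scalerA.
rewrite FE FE' GE GE' !mulr_suml -big_split /=.
transitivity (\sum_i \sum_j cderive v (fun t => c i t * d j t) tau *: (B i * D j)); last first.
  by rewrite pair_bigA.
apply: eq_bigr => i _; rewrite !mulr_sumr -big_split /=; apply: eq_bigr => j _.
have [_ ->] := cdiffM (dc i) (dd j).
by rewrite scalerDl -!scalerAl -!scalerAr !scalerA.
Qed.

Lemma family_derivZ a F tau F' : family_deriv F tau F' ->
  family_deriv (fun t => a *: F t) tau (fun v => a *: F' v).
Proof.
move=> [I [c [B [dc FE FE']]]]; exists I, c, (fun i => a *: B i); split=> // [t|v].
  by rewrite FE scaler_sumr; apply: eq_bigr => i _; rewrite !scalerA mulrC.
by rewrite FE' scaler_sumr; apply: eq_bigr => i _; rewrite !scalerA mulrC.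
Qed.

Lemma family_deriv_sum (I : Type) (r : seq I) (F : I -> R * R -> E) tau F' :
  (forall i, family_deriv (F i) tau (F' i)) ->
  family_deriv (fun t => \sum_(i <- r) F i t) tau (fun v => \sum_(i <- r) F' i v).
Proof.
move=> dF; elim: r => [|i r IH].
  under eq_fun do rewrite big_nil; under [X in family_deriv _ _ X]eq_fun do rewrite big_nil.
  exact: family_deriv_cst.
under eq_fun do rewrite big_cons; under [X in family_deriv _ _ X]eq_fun do rewrite big_cons.
exact: family_derivD.
Qed.

Lemma family_deriv_comm F G tau F' G' : family_deriv F tau F' -> family_deriv G tau G' ->
  family_deriv (fun t => comm_op (F t) (G t)) tau
    (fun v => comm_op (F' v) (G tau) + comm_op (F tau) (G' v)).
Proof.
move=> dF dG.
have h := family_derivD (family_derivM dF dG) (family_derivZ (-1) (family_derivM dG dF)).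
have -> : (fun t => comm_op (F t) (G t)) = (fun t => F t * G t + -1 *: (G t * F t)).
  by apply/funext => t; rewrite scaleN1r.
have -> // : (fun v => comm_op (F' v) (G tau) + comm_op (F tau) (G' v)) =
  (fun v => F' v * G tau + F tau * G' v + -1 *: (G' v * F tau + G tau * F' v)).
apply/funext => v; rewrite scaleN1r /comm_op opprD addrACA; congr (_ + _).
by rewrite addrC.
Qed.

Lemma family_deriv_eval F tau F' f x : family_deriv F tau F' ->
  cdifferentiable (fun t => F t f x) tau /\
  forall v, cderive v (fun t => F t f x) tau = F' v f x.
Proof.
move=> [I [c [B [dc FE FE']]]].
have E1 : (fun t => F t f x) = (fun t => \sum_i c i t * B i f x).
  by apply/funext => t; rewrite FE endo_sumE; apply: eq_bigr => i _; rewrite endoZE.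
have h i := cdiffM (dc i) (cdiff_cst (B i f x) tau).
have [h1 h2] := cdiff_sum (index_enum I) (fun i => (h i).1).
rewrite E1; split=> // v; rewrite h2 FE' endo_sumE; apply: eq_bigr => i _.
by rewrite (h i).2 cderive_cst mulr0 addr0 endoZE.
Qed.

End TeichmuellerFamilies.

(** * Trivialisations *)

Section Trivialisations.
Variables (R : realType) (n k : nat).
Hypothesis k0 : (0 < k)%N.
Local Notation U := (@regular R n).
Local Notation C := R[i].
Local Notation E := (endo R n).
Local Notation CM := (map_mx (real_complex R)).
Local Notation Nb := (@nabla_endo R n k).
Local Notation a_ := (@a_endo R n k).
Local Notation b_ := (@b_endo R n k).
Local Notation bbar_ := (@bbar_endo R n k).
Implicit Types (tau v : R * R) (A B : E) (D : oper R n).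

Lemma cderive_near (f g : R * R -> C) tau : (\forall t \near tau, f t = g t) ->
  (cdifferentiable g tau -> cdifferentiable f tau) /\
  forall v, cderive v f tau = cderive v g tau.
Proof.
move=> nr.
have n1 : \forall t \near tau, complex.Re (f t) = complex.Re (g t) by apply: filterS nr => t ->.
have n2 : \forall t \near tau, complex.Im (f t) = complex.Im (g t) by apply: filterS nr => t ->.
split=> [[g1 g2]|v].
  split.
    by apply: near_eq_differentiable g1; apply: filterS n1 => t ->.
  by apply: near_eq_differentiable g2; apply: filterS n2 => t ->.
by rewrite /cderive (near_eq_derive v n1) (near_eq_derive v n2).
Qed.

Lemma family_deriv_scal (c : R * R -> C) B tau : cdifferentiable c tau ->
  family_deriv (fun t => c t *: B) tau (fun v => cderive v c tau *: B).
Proof.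
move=> dc; exists unit, (fun _ => c), (fun _ => B); split=> // t.
  by rewrite big_const card_unit /= addr0.
by rewrite big_const card_unit /= addr0.
Qed.

(** The covariant derivatives are independent of tau, so only the entries of the inverse metric are
    differentiated; [G_Gbar] identifies the result. *)
Lemma laplace_family tau : teich tau ->
  family_deriv (@laplace_endo R n k) tau (fun v => - (b_ v tau + bbar_ v tau)).
Proof.
move=> htau.
have dp p q : cdifferentiable (fun t => CM (inv_kahler n t) p q) tau.
  have [d _] := @inv_kahler_is_derive R n 0 tau p q htau.
  split; under eq_fun do rewrite mxE /=; first exact: d.
  exact: differentiable_cst.
have h := family_deriv_sum (index_enum _) (fun p => family_deriv_sum (index_enum _)
  (fun q => family_deriv_scal (Nb p * Nb q) (dp p q))).
have -> // : (fun v => - (b_ v tau + bbar_ v tau)) = (fun v => \sum_p \sum_q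
  cderive v (fun t => CM (inv_kahler n t) p q) tau *: (Nb p * Nb q)).
apply/funext => v; rewrite -[b_ _ _ + _]linearD /= (G_Gbar n v htau).
rewrite map_mxN [quad _ (- _)]linearN /= opprK.
apply: eq_bigr => p _; apply: eq_bigr => q _; congr (_ *: _).
rewrite /cderive !mxE; under [in RHS]eq_fun do rewrite mxE /=.
under [X in _ +i* 'D__ X _]eq_fun do rewrite mxE /=.
by rewrite derive_cst.
Qed.

Lemma a_family tau : teich tau ->
  family_deriv a_ tau (fun v => (iC R / 2) *: (b_ v tau + bbar_ v tau)).
Proof.
move=> htau; have h := family_derivZ (- iC R / 2) (laplace_family htau).
have -> // : (fun v => (iC R / 2) *: (b_ v tau + bbar_ v tau)) =
  (fun v => (- iC R / 2) *: - (b_ v tau + bbar_ v tau)).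
by apply/funext => v; rewrite scalerN -scaleNr mulNr opprK.
Qed.

(* The two cases of interest are the adjoint action [comm_op], for the formal
   Hitchin-Witten connection on operators, and left multiplication [lmul], for the
   one on sections. *)
Section Action.
Variable act : E -> {linear E -> E}.
Hypothesis actD : forall A B x, act (A + B) x = act A x + act B x.
Hypothesis actZ : forall c A x, act (c *: A) x = c *: act A x.
Hypothesis act_comm : forall A B x,
  act A (act B x) = act B (act A x) + act (comm_op A B) x.
Hypothesis act_family : forall F G tau F' G',
  family_deriv F tau F' -> family_deriv G tau G' ->
  family_deriv (fun t => act (F t) (G t)) tau
    (fun v => act (F' v) (G tau) + act (F tau) (G' v)).

Definition act_power A m tau : E := (m`!%:R)^-1 *: iter m (act (a_ tau)) A.

Lemma act_powerS A m tau : m.+1%:R *: act_power A m.+1 tau = act (a_ tau) (act_power A m tau).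
Proof.
rewrite /act_power iterS [act _ (_ *: _)]linearZ /= scalerA; congr (_ *: _).
by rewrite factS natrM invfM mulrA divff ?mul1r.
Qed.

Fixpoint act_power_deriv A tau v m : E :=
  if m is m'.+1 then (m'.+1%:R)^-1 *:
    ((iC R / 2) *: (act (b_ v tau) (act_power A m' tau) + act (bbar_ v tau) (act_power A m' tau))
     + act (a_ tau) (act_power_deriv A tau v m'))
  else 0.

Lemma act_power_family A m tau : teich tau ->
  family_deriv (act_power A m) tau (fun v => act_power_deriv A tau v m).
Proof.
move=> htau; elim: m => [|m IH].
  rewrite /act_power /=; exact: (family_deriv_cst (1%:R^-1 *: A) tau).
have h := family_derivZ (m.+1%:R)^-1 (act_family (a_family htau) IH).
have -> : act_power A m.+1 = (fun t => (m.+1%:R)^-1 *: act (a_ t) (act_power A m t)).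
  by apply/funext => t; rewrite -act_powerS scalerA mulVf ?scale1r.
have -> // : (fun v => act_power_deriv A tau v m.+1) = (fun v => (m.+1%:R)^-1 *:
  (act ((iC R / 2) *: (b_ v tau + bbar_ v tau)) (act_power A m tau) +
   act (a_ tau) (act_power_deriv A tau v m))).
by apply/funext => v; rewrite (actZ (iC R / 2)) (actD (b_ v tau)).
Qed.

Definition act_series (alpha : nat -> nat -> C) A l tau : E :=
  \sum_(r < l.+1) alpha l r *: act_power A (l - r) tau.

Lemma act_series_family alpha A l tau : numeric_recursion k alpha -> teich tau ->
  family_deriv (act_series alpha A l) tau (fun v => (2 * k%:R)^-1 *:
    \sum_(1 <= j < l.+1) ik R k ^+ j *:
      (act (b_ v tau) (act_series alpha A (l - j) tau)
       - (-1) ^+ j *: act (bbar_ v tau) (act_series alpha A (l - j) tau))).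
Proof.
move=> rec htau.
have h := family_deriv_sum (index_enum 'I_l.+1) (fun r : 'I_l.+1 =>
  family_derivZ (alpha l r) (act_power_family A (l - r) htau)).
set F' := (X in family_deriv _ _ X).
have -> // : F' = (fun v => \sum_(r < l.+1) alpha l r *: act_power_deriv A tau v (l - r)).
apply/funext => v; apply/esym.
apply: (@flat_series R E k alpha (act (a_ tau)) (act (b_ v tau)) (act (bbar_ v tau))
  (fun m => act_power A m tau) (act_power_deriv A tau v) l k0 rec) => //.
- by move=> m; exact: act_powerS.
- by move=> m /=; rewrite scalerA divff ?scale1r.
- by move=> x; rewrite act_comm (comm_a_b n k v htau) (actZ (2 * ik R k)).
- by move=> x; rewrite act_comm (comm_a_bbar n k v htau) -scaleNr (actZ (- (2 * ik R k))) scaleNr.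
Qed.
End Action.

Definition adjoint (A : E) : {linear E -> E} := comm_op A.
Definition leftmul (A : E) : {linear E -> E} := lmul A.

Lemma adjoint_series_family alpha A l tau : numeric_recursion k alpha -> teich tau ->
  family_deriv (act_series adjoint alpha A l) tau (fun v => (2 * k%:R)^-1 *:
    \sum_(1 <= j < l.+1) ik R k ^+ j *:
      (comm_op (b_ v tau) (act_series adjoint alpha A (l - j) tau)
       - (-1) ^+ j *: comm_op (bbar_ v tau) (act_series adjoint alpha A (l - j) tau))).
Proof.
apply: (@act_series_family adjoint).
- exact: comm_opDl.
- exact: comm_opZl.
- exact: comm_op_Jacobi.
- exact: family_deriv_comm.
Qed.

Lemma leftmul_series_family alpha A l tau : numeric_recursion k alpha -> teich tau ->
  family_deriv (act_series leftmul alpha A l) tau (fun v => (2 * k%:R)^-1 *: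
    \sum_(1 <= j < l.+1) ik R k ^+ j *:
      (b_ v tau * act_series leftmul alpha A (l - j) tau
       - (-1) ^+ j *: (bbar_ v tau * act_series leftmul alpha A (l - j) tau))).
Proof.
apply: (@act_series_family leftmul).
- by move=> x y z; exact: mulrDl.
- by move=> c x y; apply/esym; exact: scalerAl.
- by move=> x y z; rewrite /= /lmul /comm_op mulrBl !mulrA addrC subrK.
- exact: family_derivM.
Qed.

Lemma repB D A D' A' : rep k D A -> rep k D' A' ->
  rep k (fun psi x => D psi x - D' psi x) (A - A').
Proof.
move=> rA rA'; have h := repD rA (repZ (-1) rA').
rewrite -scaleN1r; apply: rep_eq_oper h => psi x _ _.
by rewrite mulN1r.
Qed.

(** The common property of [solution_map] and [exp_triv], from which flatness and invariance are
    derived once for both. *)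
Definition represented (alpha : nat -> nat -> C) (T : opmap R n) : Prop :=
  forall D A l tau, rep k D A -> teich tau ->
    rep k (T D l tau) (act_series adjoint alpha A l tau).

Lemma represented_trivialisation alpha T :
  normalised_solution k alpha -> represented alpha T -> trivialisation k T.
Proof.
move=> [al0 rec] rT; split=> [D D' l tau dD _ htau DD|D dD].
  have [A rA _] := diffop_rep dD.
  exact: rep_eq (rT _ _ l _ rA htau) (rT _ _ l _ (rep_eq_oper DD rA) htau) erefl.
have [A rA dA] := diffop_rep dD.
(* The representation holds only over the upper half-plane; this set is open, so a derivative at tau
   does not see the other parameters. *)
have nT l tau psi x : teich tau -> is_section k psi -> U x ->
    \forall t \near tau, T D l t psi x = act_series adjoint alpha A l t psi x.
  move=> htau sp Ux; apply: filterS (near_teich htau) => t ht.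
  by have [_ ->] := rT D A l t rA ht.
split.
- move=> l tau htau; apply: dop_diffop (rT _ _ l _ rA htau) _.
  by apply: dop_sum => r; apply: dopZ; exact: dop_power dA.
- move=> tau htau; apply: rep_eq (rT _ _ 0%N _ rA htau) rA _.
  by rewrite /act_series big_ord1 al0 scale1r /act_power /= invr1 scale1r.
- move=> l tau htau psi x sp Ux; have [h _] := cderive_near (nT l _ _ _ htau sp Ux).
  apply: h; exact: (family_deriv_eval psi x (adjoint_series_family A l rec htau)).1.
- move=> v l tau htau psi x sp Ux; rewrite /formalHW /dT /zero_oper.
  have [_ ->] := cderive_near (nT l _ _ _ htau sp Ux).
  rewrite (family_deriv_eval psi x (adjoint_series_family A l rec htau)).2.
  rewrite endoZE endo_sumE; apply/eqP; rewrite subr_eq0; apply/eqP.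
  congr (_ * _); apply: eq_bigr => j _; rewrite endoZE; congr (_ * _).
  have rb := repB (rep_b n k v htau) (repZ ((-1) ^+ j) (rep_bbar n k v htau)).
  have [_ ->//] := rep_bracket rb (rT D A (l - j)%N tau rA htau).
  have -> : b_ v tau - (-1) ^+ j *: bbar_ v tau = b_ v tau + (- (-1) ^+ j) *: bbar_ v tau.
    by rewrite scaleNr.
  by rewrite comm_opDl comm_opZl scaleNr.
Qed.

Definition solution_map (alpha : nat -> nat -> C) : opmap R n :=
  fun D l tau psi x => \sum_(r < l.+1) alpha l r * A_op k (l - r) D tau psi x.

Lemma represented_solution_map alpha : represented alpha (solution_map alpha).
Proof.
move=> D A l tau rA htau; apply: rep_sum => r _; apply: repZ.
exact: rep_A.
Qed.

Lemma laplace_a tau : @laplace_endo R n k tau = (2 * iC R) *: a_ tau.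
Proof.
rewrite /a_endo scalerA (_ : 2 * iC R * (- iC R / 2) = - (iC R * iC R)); last by field.
by rewrite iC_sqr opprK scale1r.
Qed.

Lemma iter_comm_laplace A m tau : iter m (comm_op (@laplace_endo R n k tau)) A =
  (m`!%:R * (2 * iC R) ^+ m) *: act_power adjoint A m tau.
Proof.
rewrite /act_power scalerA mulrAC divff ?mul1r; last by rewrite pnatr_eq0 -lt0n fact_gt0.
elim: m => [|m IH]; first by rewrite scale1r.
by rewrite !iterS IH linearZ /= laplace_a comm_opZl scalerA exprSr.
Qed.

Lemma expr_laplace m tau : (@laplace_endo R n k tau) ^+ m =
  (m`!%:R * (2 * iC R) ^+ m) *: act_power leftmul 1 m tau.
Proof.
rewrite /act_power scalerA mulrAC divff ?mul1r; last by rewrite pnatr_eq0 -lt0n fact_gt0.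
elim: m => [|m IH]; first by rewrite scale1r.
rewrite !iterS !exprS IH laplace_a /= /lmul -scalerAl -scalerAr scalerA; congr (_ *: _).
Qed.

Lemma represented_exp_triv : represented (alpha_exp R k) (exp_triv k).
Proof.
move=> D A l tau rA htau.
have -> : act_series adjoint (alpha_exp R k) A l tau = \sum_(m < l.+1)
    (series_pow (fun j => - r_coef R k j) m l / (m`!)%:R) *: iter m (comm_op (@laplace_endo R n k tau)) A.
  rewrite /act_series (reindex_inj rev_ord_inj) /=; apply: eq_bigr => m _.
  have ml : (m <= l)%N by rewrite -ltnS.
  rewrite subSS subKn // iter_comm_laplace [RHS]scalerA /alpha_exp subKn //; congr (_ *: _).
  have f0 : (m`!%:R : C) != 0 by rewrite pnatr_eq0 -lt0n fact_gt0.
  by field.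
apply: rep_sum => m _; apply: repZ; apply: rep_iter_bracket rA; exact: rep_laplace.
Qed.

Definition exp_endo (c : nat -> C) l tau : E :=
  \sum_(m < l.+1) (series_pow c m l / (m`!)%:R) *: (@laplace_endo R n k tau) ^+ m.

Lemma rep_formal_exp c l tau : teich tau ->
  rep k (formal_exp c (laplace k tau) l) (exp_endo c l tau).
Proof.
move=> htau; apply: rep_sum => m _; apply: repZ; elim: (nat_of_ord m) => [|j IH].
  exact: rep_id.
by rewrite exprS; exact: repM (rep_laplace n k htau) IH.
Qed.

Lemma exp_endo_series l tau :
  exp_endo (fun j => - r_coef R k j) l tau = act_series leftmul (alpha_exp R k) 1 l tau.
Proof.
rewrite /act_series (reindex_inj rev_ord_inj) /=; apply: eq_bigr => m _.
have ml : (m <= l)%N by rewrite -ltnS.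
rewrite subSS subKn // expr_laplace scalerA /alpha_exp subKn //; congr (_ *: _).
have f0 : (m`!%:R : C) != 0 by rewrite pnatr_eq0 -lt0n fact_gt0.
by field.
Qed.

Lemma near_formal_exp l tau psi x : teich tau -> is_section k psi -> U x ->
  \forall t \near tau, formal_exp (fun j => - r_coef R k j) (laplace k t) l psi x =
    act_series leftmul (alpha_exp R k) 1 l t psi x.
Proof.
move=> htau sp Ux; apply: filterS (near_teich htau) => t ht; rewrite -exp_endo_series.
by have [_ ->] := rep_formal_exp (fun j => - r_coef R k j) l ht.
Qed.

Lemma formal_exp_dT_exists l tau : teich tau ->
  dT_exists k (fun t => formal_exp (n := n) (fun j => - r_coef R k j) (laplace k t) l) tau.
Proof.
move=> htau psi x sp Ux; have [h _] := cderive_near (near_formal_exp l htau sp Ux).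
apply: h.
exact: (family_deriv_eval psi x (leftmul_series_family 1 l (alpha_exp_recursion R k0) htau)).1.
Qed.

(** The derivative given by [leftmul_series_family] is, term by term, minus the expanded connection
    form applied to the lower coefficients. The connection form has no term of order zero. *)
Lemma HW_expansion_eq0 v tau l psi x : teich tau -> is_section k psi -> U x ->
  HW_expansion k v (fun t => formal_exp (n := n) (fun j => - r_coef R k j) (laplace k t)) tau l psi x = 0.
Proof.
move=> htau sp Ux; rewrite /HW_expansion /dT.
have [_ ->] := cderive_near (near_formal_exp l htau sp Ux).
rewrite (family_deriv_eval psi x (leftmul_series_family 1 l (alpha_exp_recursion R k0) htau)).2.
rewrite endoZE endo_sumE big_add1 /= big_mkord /formal_comp big_ord_recl.
rewrite {1}/HW_form_coef eqxx add0r mulr_sumr -big_split /=.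
rewrite big1 // => j _; rewrite -exp_endo_series (_ : bump 0 j = j.+1) //.
have rF := rep_formal_exp (fun j => - r_coef R k j) (l - j.+1) htau.
have [_ hb] := repM (rep_b n k v htau) rF; have [_ hbb] := repM (rep_bbar n k v htau) rF.
have := hb psi x sp Ux; rewrite endoME => E1.
have := hbb psi x sp Ux; rewrite endoME => E2.
have cancel (c d e B B' Z Z' : C) : B' = B -> Z' = Z ->
    c * (d * (B - e * Z)) + - c * d * (B' - e * Z') = 0 by move=> -> ->; ring.
rewrite mulN1r; exact: cancel E1 E2.
Qed.

Lemma laplace_local tau f g : (forall y, U y -> f y = g y) ->
  forall y, U y -> laplace k tau f y = laplace k tau g y.
Proof. by move=> fg y Uy; exact: second_order_local fg y Uy. Qed.

Lemma formal_exp_zero c l tau f x : (forall y, U y -> f y = 0) -> U x ->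
  formal_exp (n := n) c (laplace k tau) l f x = 0.
Proof.
move=> f0 Ux; rewrite /formal_exp big1 // => m _.
suff -> : iter m (laplace k tau) f x = 0 by rewrite mulr0.
elim: (nat_of_ord m) x Ux => [|j IH] x Ux; first exact: f0.
have z : forall y, U y -> iter j (laplace k tau) f y = (fun=> 0) y by exact: IH.
rewrite iterS (laplace_local tau z Ux) /laplace (second_orderE k _ (@smooth_cst R n 0) Ux).
by rewrite endo0.
Qed.

(** The binomial theorem: the commutator with x is left multiplication by x plus right
    multiplication by - x, and these two commute. *)
Lemma iter_comm (A : algType C) (x y : A) m :
  iter m (comm_op x) y = \sum_(p < m.+1) 'C(m, p)%:R *: (x ^+ p * y * (- x) ^+ (m - p)).
Proof.
elim: m => [|m IH]; first by rewrite big_ord1 bin0 scale1r expr0 mul1r subn0 expr0 mulr1.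
pose F p q := x ^+ p * y * (- x) ^+ q.
have step p q : comm_op x (F p q) = F p.+1 q + F p q.+1.
  by rewrite /comm_op /F exprS exprSr !mulrA mulrN.
rewrite iterS IH linear_sum [RHS]big_ord_recl bin0 scale1r subn0 -/(F _ _) /=.
transitivity (\sum_(p < m.+1) ('C(m, p)%:R *: F p.+1 (m - p)%N + 'C(m, p)%:R *: F p (m - p).+1)).
  by apply: eq_bigr => p _; rewrite linearZ /= -/(F _ _) step scalerDr.
have -> : \sum_(i < m.+1) 'C(m.+1, bump 0 i)%:R *: (x ^+ bump 0 i * y * (- x) ^+ (m.+1 - bump 0 i)) =
    \sum_(i < m.+1) ('C(m, i)%:R *: F i.+1 (m - i)%N + 'C(m, i.+1)%:R *: F i.+1 (m - i)%N).
  by apply: eq_bigr => i _; rewrite /bump /= add1n subSS binS natrD addrC -scalerDl.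
rewrite !big_split /= addrCA; congr (_ + _).
rewrite big_ord_recl bin0 scale1r subn0 [in RHS]big_ord_recr /= bin_small // scale0r addr0.
by congr (_ + _); apply: eq_bigr => i _; rewrite /bump /= add1n subnSK.
Qed.

Lemma series_pow_small (c : nat -> C) m l : c 0%N = 0 -> (l < m)%N -> series_pow c m l = 0.
Proof.
move=> c0; elim: m l => [//|m IH] l lm; rewrite /series_pow iterS.
rewrite /cauchy_prod big1 // => -[[|j] jl] _ /=; first by rewrite c0 mul0r.
by rewrite [iter _ _ _ _]IH ?mulr0 //; lia.
Qed.

Lemma series_powN (c : nat -> C) m l : series_pow (fun j => - c j) m l = (-1) ^+ m * series_pow c m l.
Proof.
elim: m l => [|m IH] l; first by rewrite mul1r.
rewrite /series_pow !iterS /cauchy_prod mulr_sumr; apply: eq_bigr => j _.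
rewrite [X in - _ * X]IH exprS mulN1r !mulNr; congr (- _).
by rewrite mulrCA.
Qed.

Lemma series_powD (c : nat -> C) p q l :
  series_pow c (p + q) l = \sum_(j < l.+1) series_pow c p j * series_pow c q (l - j).
Proof.
pose P := \poly_(i < l.+1) c i.
have PE i : (i <= l)%N -> P`_i = c i by move=> il; rewrite coef_poly ltnS il.
rewrite (series_pow_coef PE) // exprD coefM; apply: eq_bigr => j _.
by rewrite !(series_pow_coef PE) ?leq_subr // -ltnS.
Qed.

(** The formal identity exp (- c L) A exp (c L) = exp (- c ad_L) (A). Both sides are expanded into
    the double sum over p and q of the terms L^p A (- L)^q, by [series_powD] and by [iter_comm]. *)
Lemma exp_conjugation (c : nat -> C) A l tau : c 0%N = 0 ->
  \sum_(j < l.+1) exp_endo (fun j => - c j) j tau * (A * exp_endo c (l - j) tau) =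
  \sum_(m < l.+1) (series_pow (fun j => - c j) m l / (m`!)%:R) *:
    iter m (comm_op (@laplace_endo R n k tau)) A.
Proof.
move=> c0; set L := laplace_endo _ _ _; set d := fun j => - c j.
have d0 : d 0%N = 0 by rewrite /d c0 oppr0.
(* The sign of c in the right exponential is moved to - L, so that both exponentials carry powers of
   the same series d. *)
pose F p q := ((p`!)%:R^-1 * (q`!)%:R^-1) *: (L ^+ p * A * (- L) ^+ q).
(* Without constant term, the m-th power starts in degree m, so all truncated exponentials can be
   summed over the common range [l.+1]. *)
have widen (V : lmodType C) e i (X : nat -> V) : e 0%N = 0 -> (i <= l)%N ->
    \sum_(m < i.+1) (series_pow e m i / (m`!)%:R) *: X m =
    \sum_(m < l.+1) (series_pow e m i / (m`!)%:R) *: X m.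
  move=> e0 il; rewrite (big_ord_widen l.+1 (fun m => (series_pow e m i / (m`!)%:R) *: X m)) //.
  rewrite big_mkcond; apply: eq_bigr => m _; case: ifP => // h.
  by rewrite series_pow_small ?mul0r ?scale0r //; lia.
transitivity (\sum_(p < l.+1) \sum_(q < l.+1) series_pow d (p + q) l *: F p q).
  under [RHS]eq_bigr => p _ do under eq_bigr => q _ do rewrite series_powD scaler_suml.
  under [RHS]eq_bigr => p _ do rewrite exchange_big.
  rewrite [RHS]exchange_big /=; apply: eq_bigr => j _.
  have jl : (j <= l)%N by rewrite -ltnS.
  have EE e i : e 0%N = 0 -> (i <= l)%N ->
      exp_endo e i tau = \sum_(m < l.+1) (series_pow e m i / (m`!)%:R) *: L ^+ m.
    by move=> e0 il; exact: (widen E e i (fun m => L ^+ m) e0 il).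
  rewrite (EE d j d0 jl) (EE c (l - j)%N c0 (leq_subr _ _)).
  rewrite mulr_suml; apply: eq_bigr => p _.
  rewrite mulrA mulr_sumr; apply: eq_bigr => q _.
  have -> : series_pow c q (l - j) = (-1) ^+ q * series_pow d q (l - j).
    by rewrite series_powN mulrA -exprD addnn -mul2n exprM sqrrN expr1n expr1n mul1r.
  rewrite /F -[- L]scaleN1r exprZn -!scalerAl -!scalerAr !scalerA; congr (_ *: _).
  by rewrite /GRing.scale /=; ring.
have step m : (series_pow d m l / (m`!)%:R) *: iter m (comm_op L) A =
    \sum_(p < m.+1) series_pow d m l *: F p (m - p)%N.
  rewrite iter_comm scaler_sumr; apply: eq_bigr => p _; rewrite /F !scalerA; congr (_ *: _).
  have pm : (p <= m)%N by rewrite -ltnS.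
  rewrite -(bin_fact pm) !natrM.
  have f0 i : (i`!%:R : C) != 0 by rewrite pnatr_eq0 -lt0n fact_gt0.
  have b0 : ('C(m, p)%:R : C) != 0 by rewrite pnatr_eq0 -lt0n bin_gt0.
  by field; rewrite !f0 b0.
under [RHS]eq_bigr => m _ do rewrite step.
rewrite (triangle_sum l.+1 (fun m p => series_pow d m l *: F p (m - p)%N)).
apply: eq_bigr => p _.
rewrite [RHS](big_ord_widen l.+1 (fun q => series_pow d (p + q) l *: F p (p + q - p)%N)) ?leq_subr //.
rewrite [RHS]big_mkcond; apply: eq_bigr => q _; rewrite addKn; case: ifP => // h.
by rewrite series_pow_small ?scale0r //; lia.
Qed.

Lemma exp_conjugation_triv D l tau : is_diffop k D -> teich tau ->
  eq_oper k
    (formal_comp (formal_exp (fun j => - r_coef R k j) (laplace (n := n) k tau))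
       (fun j psi x => D (formal_exp (r_coef R k) (laplace k tau) j psi) x) l)
    (exp_triv k D l tau).
Proof.
move=> dD htau; have [A rA _] := diffop_rep dD.
have r0 : r_coef R k 0 = 0 by [].
have h : rep k (exp_triv k D l tau) (\sum_(m < l.+1) (series_pow (fun j => - r_coef R k j) m l / (m`!)%:R) *:
    iter m (comm_op (@laplace_endo R n k tau)) A).
  apply: rep_sum => m _; apply: repZ; apply: rep_iter_bracket rA; exact: rep_laplace.
apply: rep_eq _ h (exp_conjugation A l tau r0).
apply: rep_sum => j _.
exact: repM (rep_formal_exp _ _ htau) (repM rA (rep_formal_exp _ _ htau)).
Qed.

Lemma formal_HW_flat v tau l : teich tau ->
  eq_oper k
    (formal_comp (formal_exp (r_coef R k) (laplace (n := n) k tau))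
       (HW_expansion k v
          (fun t => formal_exp (fun j => - r_coef R k j) (laplace k t)) tau) l)
    (@zero_oper R n).
Proof.
move=> htau psi x sp Ux; rewrite /formal_comp /zero_oper big1 // => j _.
by apply: formal_exp_zero Ux => y Uy; exact: HW_expansion_eq0.
Qed.

End Trivialisations.

(** * The mapping class group *)

Section MappingClassGroup.
Variables (R : realType) (n k : nat).
Hypothesis k0 : (0 < k)%N.
Local Notation M := 'M[R]_(2, n.-1).
Local Notation U := (@regular R n).
Local Notation C := R[i].
Local Notation E := (endo R n).
Local Notation CM := (map_mx (real_complex R)).
Implicit Types (phi : 'M[int]_2) (tau : R * R) (psi : oneform R n -> C).

Definition real_mx phi : 'M[R]_2 := map_mx intr phi.

Lemma pull_form_linear phi : linear (pull_form phi : M -> M).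
Proof. by move=> a x y; rewrite /pull_form mulmxDr -scalemxAr. Qed.

Definition pull_lin phi : {linear M -> M} :=
  HB.pack (pull_form phi : M -> M) (GRing.isLinear.Build _ _ _ _ _ (pull_form_linear phi)).

Lemma mcg_unit phi : mcg phi -> phi \in unitmx.
Proof. by move=> h; rewrite unitmxE h unitr1. Qed.

Lemma mcg_inv phi : mcg phi -> mcg (invmx phi).
Proof. by move=> h; rewrite /mcg det_inv h invr1. Qed.

Lemma pull_formM phi phi' (x : oneform R n) :
  pull_form phi (pull_form phi' x) = pull_form (phi' *m phi) x.
Proof. by rewrite /pull_form mulmxA -trmx_mul -map_mxM. Qed.

Lemma pull_form1 (x : oneform R n) : pull_form 1%:M x = x.
Proof. by rewrite /pull_form map_mx1 trmx1 mul1mx. Qed.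

Lemma diag_pull phi (x : oneform R n) : diag (pull_form phi x) = (real_mx phi)^T *m diag x.
Proof. by rewrite !diagE /pull_form mulmxA. Qed.

Lemma pull_integral phi m : pull_form phi (integral_form R m : oneform R n) = integral_form R (phi^T *m m).
Proof.
rewrite /pull_form /integral_form map_mxM; congr (_ *m _).
by apply/matrixP => i j; rewrite !mxE.
Qed.

(** If two diagonal entries of the image differed by integers in both rows, the integral inverse of
    phi would carry this back to x. *)
Lemma regular_pull phi x : mcg phi -> U x -> U (pull_form phi x).
Proof.
move=> hphi /regularP Ux; apply/regularP => j l jl; apply: contrapT => H.
have Hi i : diag (pull_form phi x) i j - diag (pull_form phi x) i l \is a Num.int.
  by apply/negPn/negP => Hi; apply: H; exists i.
have [i /negP[]] := Ux j l jl.
have -> : diag x = diag (pull_form (invmx phi) (pull_form phi x)).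
  by rewrite pull_formM mulmxV ?mcg_unit // pull_form1.
rewrite (diag_pull (invmx phi)) !mxE -sumrB; apply: rpred_sum => r _.
by rewrite -mulrBr rpredM // !mxE intr_int.
Qed.

Lemma det_real_mx phi : mcg phi -> \det (real_mx phi) = 1.
Proof. by move=> h; rewrite det_map_mx h. Qed.

(** Only the antisymmetric part of a 2 x 2 matrix enters omega, and congruence by phi multiplies it
    by det phi = 1. *)
Lemma omega_pull phi (x y : oneform R n) : mcg phi ->
  omega (pull_form phi x) (pull_form phi y) = omega x y.
Proof.
move=> h; rewrite !omegaE; congr (_ * _); rewrite /pull_form trmx_mul trmxK -/(real_mx phi).
have -> : (real_mx phi)^T *m x *m gram R n *m (y^T *m real_mx phi) =
    (real_mx phi)^T *m (x *m gram R n *m y^T) *m real_mx phi by rewrite !mulmxA.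
move: (x *m gram R n *m y^T) => N; have := det_real_mx h; move: (real_mx phi) => A.
rewrite (mx2P A) (mx2P N) mx2_det mx2_T !mx2_mul !mx2E.
by move=> h1; rewrite -[RHS]mul1r -h1; ring.
Qed.

Lemma expi_add (x y : R) : expi (x + y) = expi x * expi y.
Proof. by rewrite /expi cosD sinD; apply: eqC_ReIm => /=; ring. Qed.

Lemma expi_2pi (z : int) : expi (2 * pi * z%:~R : R) = 1.
Proof.
have nat_case m : expi (2 * pi * m%:R : R) = 1.
  elim: m => [|m IH]; first by rewrite mulr0 /expi cos0 sin0.
  rewrite -IH (_ : 2 * pi * m.+1%:R = 2 * pi * m%:R + pi *+ 2); last first.
    by rewrite -natr1 -mulr_natl; ring.
  by rewrite /expi cosD2pi sinD2pi.
case: (intP z) => [|m|m]; first by rewrite mulr0z mulr0 /expi cos0 sin0.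
  by rewrite -(nat_case m.+1).
have := nat_case m.+1; rewrite /expi mulrNz mulrN cosN sinN => -[-> ->].
by rewrite oppr0.
Qed.

(** Only the sign is at stake. The product m'.m'' changes by a b |m'|^2 + c d |m''|^2 + 2 b c
    m'.m'', which is even: |m'|^2 has the parity of the sum of the entries of m', and this sum is
    zero; likewise for m''. *)
Lemma cocycle_pull phi m (x : oneform R n) : mcg phi ->
  cocycle k (pull_form phi (integral_form R m)) (pull_form phi x) = cocycle k (integral_form R m) x.
Proof.
move=> h; rewrite /cocycle omega_pull //.
set S := (X in k%:R * (pi * X - _)); set S' := (X in _ = expi (k%:R * (pi * X - _))).
have [z Sz] : exists z : int, S = S' + 2 * z%:~R.
  pose u i j := Num.floor (diag (integral_form R m) i j).
  have uE i j : diag (integral_form R m) i j = (u i j)%:~R.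
    by apply/esym/eqP; rewrite -intrEfloor; exact: diag_integral.
  have half i : exists z : int, \sum_j u i j * u i j = 2 * z.
    have sq (a : int) : exists b : int, a * a = a + 2 * b.
      have := divz_eq a 2; have := modz_ge0 a (isT : (2 : int) != 0).
      have := ltz_pmod a (isT : 0 < (2 : int)).
      move: (a %/ 2)%Z (a %% 2)%Z => q r r2 r0 ->.
      exists (q * (2 * q + 2 * r - 1)).
      have [->|->] : r = 0 \/ r = 1 by lia.
        by ring.
      by ring.
    have u0 : \sum_j u i j = 0.
      have := sum_diag (integral_form R m) i; under eq_bigr do rewrite uE.
      by rewrite -rmorph_sum /= => /eqP; rewrite intr_eq0 => /eqP.
    suff [z ->] : exists z, \sum_j u i j * u i j = \sum_j u i j + 2 * z by exists z; rewrite u0 add0r.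
    elim: (index_enum _) => [|j s [z IH]]; first by exists 0; rewrite !big_nil.
    have [b bE] := sq (u i j); exists (b + z); rewrite !big_cons bE IH; ring.
  have [z0 h0] := half 0; have [z1 h1] := half 1.
  pose a := phi 0 0; pose b := phi 0 1; pose c := phi 1 0; pose d := phi 1 1.
  have dt : a * d - b * c = 1.
    by move: h; rewrite /mcg (mx2P phi) mx2_det.
  exists (a * b * z0 + c * d * z1 + b * c * \sum_j u 0 j * u 1 j).
  have dE i j : diag (pull_form phi (integral_form R m)) i j =
      (phi 0 i * u 0 j + phi 1 i * u 1 j)%:~R.
    have T i' : (real_mx phi)^T i i' = (phi i' i)%:~R by rewrite !mxE.
    rewrite diag_pull mxE !big_ord_recl big_ord0 addr0 !T !uE rmorphD !rmorphM /=.
    by rewrite (_ : lift ord0 ord0 = 1) //; exact: val_inj.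
  have -> : S = (\sum_j (a * u 0 j + c * u 1 j) * (b * u 0 j + d * u 1 j))%:~R.
    by rewrite rmorph_sum; apply: eq_bigr => j _; rewrite !dE rmorphM.
  have -> : S' = (\sum_j u 0 j * u 1 j)%:~R.
    by rewrite rmorph_sum; apply: eq_bigr => j _; rewrite !uE rmorphM.
  have -> : \sum_j (a * u 0 j + c * u 1 j) * (b * u 0 j + d * u 1 j) =
     a * b * \sum_j u 0 j * u 0 j + c * d * \sum_j u 1 j * u 1 j + (a * d + b * c) * \sum_j u 0 j * u 1 j.
    rewrite !mulr_sumr -!big_split; apply: eq_bigr => j _ /=; ring.
  rewrite h0 h1 (_ : a * d + b * c = 1 + 2 * (b * c)); last first.
    by rewrite (_ : a * d = 1 + b * c); [ring|rewrite -dt subrK].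
  by rewrite -[2 : R]/(2%:~R) -intrM -intrD; congr (_%:~R); ring.
rewrite Sz (_ : k%:R * (pi * (S' + 2 * z%:~R) - omega x (integral_form R m) / 2) =
  k%:R * (pi * S' - omega x (integral_form R m) / 2) + 2 * pi * (k%:Z * z)%:~R); last first.
  by rewrite intrM; ring.
by rewrite expi_add expi_2pi mulr1.
Qed.

Lemma act_section phi psi : mcg phi -> is_section k psi -> is_section k (act_fun phi psi).
Proof.
move=> h [s q w]; split.
- exact: (@smooth_pull R n (pull_lin phi) (fun x Ux => regular_pull h Ux) psi s).
- move=> m x Ux; rewrite /act_fun -(cocycle_pull m x h) pull_integral.
  rewrite -(q _ _ (regular_pull h Ux)) -pull_integral; congr psi.
  exact: (linearD (pull_lin phi)).
- move=> v x Ux; rewrite /act_fun -(w v _ (regular_pull h Ux)); congr psi.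
  by rewrite !weyl_mxE /pull_form mulmxA.
Qed.

Section Conjugation.
Variable phi : 'M[int]_2.
Hypothesis hphi : mcg phi.

Definition pull_phi (phi' : 'M[int]_2) (h : mcg phi') : E :=
  @pull_endo R n (pull_lin phi') (fun x Ux => regular_pull h Ux).

Lemma pull_phiE phi' (h : mcg phi') f x : smooth f -> U x ->
  pull_phi h f x = act_fun phi' f x.
Proof. exact: pull_endoE. Qed.

Lemma pull_phi_section phi' (h : mcg phi') : preserves_sections k (pull_phi h).
Proof.
move=> psi sp; apply: is_section_local (act_section h sp) => x Ux.
exact: esym (pull_phiE h (is_section_smooth sp) Ux).
Qed.

Lemma pull_phiM phi1 phi2 (h1 : mcg phi1) (h2 : mcg phi2) : phi1 *m phi2 = 1%:M ->
  pull_phi h1 * pull_phi h2 = 1.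
Proof.
move=> h12; apply: endoP_ext => f x sf Ux; rewrite endoME.
rewrite (pull_phiE h1 (endo_smooth _ sf) Ux) (endo1E sf Ux) /act_fun.
rewrite (pull_phiE h2 sf (regular_pull h1 Ux)) /act_fun.
by rewrite pull_formM h12 pull_form1.
Qed.

Let P := pull_phi hphi.
Let Q := pull_phi (mcg_inv hphi).

Lemma pullPQ : P * Q = 1.
Proof. by apply: pull_phiM; rewrite mulmxV // mcg_unit. Qed.
Lemma pullQP : Q * P = 1.
Proof. by apply: pull_phiM; rewrite mulVmx // mcg_unit. Qed.

Lemma rep_act_oper D A : rep k D A -> rep k (act_oper phi D) (P * A * Q).
Proof.
move=> [pA DA]; split.
  by apply: preservesM (preservesM (pull_phi_section hphi) pA) (pull_phi_section _).
move=> psi x sp Ux; have si := act_section (mcg_inv hphi) sp.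
have Upx := regular_pull hphi Ux.
rewrite /act_oper {1}/act_fun (DA _ _ si Upx) endoME endoME.
rewrite (pull_phiE hphi (endo_smooth _ (endo_smooth _ (is_section_smooth sp))) Ux) /act_fun.
congr (_ _); apply: endo_local => y Uy.
exact: esym (pull_phiE _ (is_section_smooth sp) Uy).
Qed.

Lemma conj_comm A B : P * comm_op A B * Q = comm_op (P * A * Q) (P * B * Q).
Proof.
have cancel X Y : P * X * Q * (P * Y * Q) = P * (X * Y) * Q.
  by rewrite !mulrA -(mulrA _ Q P) pullQP mulr1.
by rewrite /comm_op !cancel mulrBr mulrBl.
Qed.

(** [N] is the squared modulus of the denominator d - c tau; the imaginary part tau2 / N uses a d -
    b c = 1. *)
Lemma act_teichE tau : teich tau ->
  let a := real_mx phi 0 0 in let b := real_mx phi 0 1 in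
  let c := real_mx phi 1 0 in let d := real_mx phi 1 1 in
  let N := (d - c * tau.1) ^+ 2 + (c * tau.2) ^+ 2 in
  0 < N /\ act_teich phi tau =
    (((a * tau.1 - b) * (d - c * tau.1) - a * c * tau.2 ^+ 2) / N, tau.2 / N).
Proof.
move=> htau a b c d N.
have t2 : 0 < tau.2 by exact: htau.
have dt : a * d - b * c = 1.
  by have := det_real_mx hphi; rewrite (mx2P (real_mx phi)) mx2_det.
have N0 : 0 < N.
  rewrite lt_neqAle addr_ge0 ?sqr_ge0 // andbT eq_sym paddr_eq0 ?sqr_ge0 // !sqrf_eq0.
  apply/negP => /andP[/eqP e1]; rewrite mulf_eq0 (gt_eqF t2) orbF => /eqP c00.
  by move: e1 dt; rewrite c00 mul0r subr0 => ->; rewrite !mulr0 subr0 => /eqP; rewrite eq_sym oner_eq0.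
split=> //.
pose t' := (((a * tau.1 - b) * (d - c * tau.1) - a * c * tau.2 ^+ 2) / N, tau.2 / N).
rewrite -/t'.
rewrite /act_teich.
have intC (z : int) : z%:~R = (z%:~R : R)%:C :> C by rewrite rmorph_int.
have -> : (phi 0 0)%:~R = a%:C :> C by rewrite intC /a mxE.
have -> : (phi 0 1)%:~R = b%:C :> C by rewrite intC /b mxE.
have -> : (phi 1 1)%:~R = d%:C :> C by rewrite intC /d mxE.
have -> : (phi 1 0)%:~R = c%:C :> C by rewrite intC /c mxE.
have -> : (a%:C * (tau.1 +i* tau.2) - b%:C) / (d%:C - c%:C * (tau.1 +i* tau.2)) = t'.1 +i* t'.2.
  have v0 : d%:C - c%:C * (tau.1 +i* tau.2) != 0.
    apply/negP => /eqP e; have := congr1 (@complex.Re R) e; have := congr1 (@complex.Im R) e.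
    rewrite /= => e2 e1; move: N0; rewrite /N.
    have -> : d - c * tau.1 = 0 by rewrite -[RHS]e1; ring.
    have -> : c * tau.2 = 0 by rewrite -[RHS]oppr0 -[in RHS]e2; ring.
    by rewrite expr0n addr0 ltxx.
  apply: (mulIf v0); rewrite mulfVK //.
  have N0' : N != 0 by rewrite gt_eqF.
  pose X := (a * tau.1 - b) * (d - c * tau.1) - a * c * tau.2 ^+ 2.
  have e1 : (a * tau.1 - b) * N = X * (d - c * tau.1) + c * tau.2 ^+ 2.
    transitivity (X * (d - c * tau.1) + (a * d - b * c) * (c * tau.2 ^+ 2)).
      by rewrite /X /N; ring.
    by rewrite dt mul1r.
  have e2 : a * tau.2 * N = X * - (c * tau.2) + tau.2 * (d - c * tau.1).
    transitivity (X * - (c * tau.2) + (a * d - b * c) * (tau.2 * (d - c * tau.1))).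
      by rewrite /X /N; ring.
    by rewrite dt mul1r.
  rewrite /t' -/X; clearbody X N.
  apply: eqC_ReIm; rewrite /=; apply: (mulIf N0').
    transitivity ((a * tau.1 - b) * N); first by ring.
    by rewrite e1; field.
  transitivity (a * tau.2 * N); first by ring.
  by rewrite e2; field.
by [].
Qed.

Lemma teich_act tau : teich tau -> teich (act_teich phi tau).
Proof. by move=> htau; have [N0 ->] := act_teichE htau; exact: divr_gt0. Qed.

Lemma metric_dual_act tau : teich tau ->
  (real_mx phi)^T *m metric_dual (act_teich phi tau) *m real_mx phi = metric_dual tau.
Proof.
move=> htau; have [N0 ->] := act_teichE htau.
have := det_real_mx hphi; rewrite {1}(mx2P (real_mx phi)) mx2_det.
rewrite [X in X^T *m _ *m X = _]mx2P.
move: (real_mx phi 0 0) (real_mx phi 0 1) (real_mx phi 1 0) (real_mx phi 1 1) N0 => a b c d.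
set N := (d - _) ^+ 2 + _ => N0 dt.
have t2 : tau.2 != 0 by rewrite gt_eqF.
have Nn : N != 0 by rewrite gt_eqF.
(* X + i tau2 is the product of a tau - b with the conjugate of d - c tau, so [XW] says that squared
   moduli multiply. *)
pose X := (a * tau.1 - b) * (d - c * tau.1) - a * c * tau.2 ^+ 2.
pose W := (a * tau.1 - b) ^+ 2 + (a * tau.2) ^+ 2.
have XW : X ^+ 2 + tau.2 ^+ 2 = N * W.
  rewrite -[tau.2 ^+ 2]mul1r -(expr1n R 2) -{1}dt /X /N /W; ring.
have -> : metric_dual ((((a * tau.1 - b) * (d - c * tau.1) - a * c * tau.2 ^+ 2) / N), (tau.2 / N)) =
    tau.2^-1 *: mx2 N X X W.
  rewrite /metric_dual mx2_scale /= -/X; congr mx2.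
  - by rewrite invf_div mulrC.
  - by field; rewrite t2 Nn.
  - by field; rewrite t2 Nn.
  - rewrite (_ : (X / N) ^+ 2 + (tau.2 / N) ^+ 2 = (X ^+ 2 + tau.2 ^+ 2) / N ^+ 2); last by field.
    by rewrite XW; field; rewrite t2 Nn.
have -> : metric_dual tau = tau.2^-1 *: ((a * d - b * c) ^+ 2 *: mx2 1 tau.1 tau.1 (tau.1 ^+ 2 + tau.2 ^+ 2)).
  by rewrite dt expr1n scale1r mx2_scale /metric_dual; congr mx2; rewrite ?mulr1 // mulrC.
rewrite -scalemxAr -scalemxAl; congr (_ *: _); rewrite mx2_T !mx2_mul mx2_scale /N /X /W.
by congr mx2; ring.
Qed.

Lemma laplace_conj tau : teich tau ->
  P * laplace_endo n k tau * Q = laplace_endo n k (act_teich phi tau).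
Proof.
move=> htau; have ht' := teich_act htau.
have Lo (x y : oneform R n) : omega (pull_lin phi x) (pull_lin phi y) = omega x y by exact: omega_pull.
have E1 := @quad_pull R n k (pull_lin phi) (fun x Ux => regular_pull hphi Ux) Lo (CM (inv_kahler n (act_teich phi tau))).
have Lc : lin_coord (pull_lin phi) = kron (real_mx phi)^T 1%:M.
  by rewrite (@lin_coordE _ _ _ (real_mx phi)^T 1%:M) ?trmx1 // => x; rewrite mulmx1.
have K : CM (lin_coord (pull_lin phi)) *m CM (inv_kahler n (act_teich phi tau)) *m
    (CM (lin_coord (pull_lin phi)))^T = CM (inv_kahler n tau).
  rewrite Lc map_T -!map_mxM; congr map_mx; rewrite !inv_kahlerE // kronT !kronM !trmx1.
  by rewrite mul1mx mulmx1 trmxK -scalemxAr -scalemxAl metric_dual_act.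
rewrite K in E1.
transitivity (laplace_endo n k (act_teich phi tau) * P * Q).
  by congr (_ * Q); exact: esym E1.
by rewrite -mulrA pullPQ mulr1.
Qed.

Lemma a_conj tau : teich tau -> P * a_endo n k tau * Q = a_endo n k (act_teich phi tau).
Proof. by move=> htau; rewrite /a_endo -scalerAr -scalerAl laplace_conj. Qed.

Lemma act_series_conj alpha A l tau : teich tau ->
  P * act_series k (@adjoint R n) alpha A l tau * Q =
  act_series k (@adjoint R n) alpha (P * A * Q) l (act_teich phi tau).
Proof.
move=> htau; rewrite /act_series mulr_sumr mulr_suml; apply: eq_bigr => r _.
rewrite -scalerAr -scalerAl /act_power -scalerAr -scalerAl; congr (_ *: (_ *: _)).
have h X : P * comm_op (a_endo n k tau) X * Q = comm_op (a_endo n k (act_teich phi tau)) (P * X * Q).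
  by rewrite conj_comm (a_conj htau).
elim: (l - r)%N => [|m IH]; first reflexivity.
exact: etrans (h _) (congr1 (comm_op _) IH).
Qed.

End Conjugation.

Lemma represented_mcg_invariant alpha (T : opmap R n) : represented k alpha T -> mcg_invariant k T.
Proof.
move=> rT phi D l tau hphi dD htau; have [A rA _] := diffop_rep dD.
apply: rep_eq (rep_act_oper hphi (rT D A l tau rA htau))
  (rT _ _ l _ (rep_act_oper hphi rA) (teich_act hphi htau)) _.
exact: act_series_conj.
Qed.

End MappingClassGroup.

(** * A nonzero section *)

Section BumpFunction.
Variable R : realType.
Implicit Types (t s : R) (p : {poly R}).

(** The classical flat function exp (- 1 / t), with a polynomial factor in 1 / t that makes the
    family closed under differentiation. *)
Definition flat_exp p t : R := if 0 < t then p.[t^-1] * expR (- t^-1) else 0.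

(** From y <= exp y at y = s / m, raised to the power m; m = 0 is separate. *)
Lemma expR_ge_pow m s : 0 <= s -> s ^+ m * expR (- s) <= m%:R ^+ m.
Proof.
move=> s0; case: m => [|m]; first by rewrite !expr0 mul1r expRN invf_le1 ?expR_gt0 // -expR0 ler_expR.
rewrite expRN ler_pdivrMr ?expR_gt0 //.
have {2}-> : s = m.+1%:R * (s / m.+1%:R) by field.
rewrite expRM_natl -exprMn; apply: lerXn2r; rewrite ?nnegrE ?mulr_ge0 ?expR_ge0 //.
have : s / m.+1%:R <= expR (s / m.+1%:R).
  by apply: le_trans (expR_ge1Dx _); rewrite lerDr ler01.
by rewrite ler_pdivrMr // mulrC.
Qed.

Lemma poly_expR_bounded p : exists C, forall s, 0 <= s -> `|p.[s] * expR (- s)| <= C.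
Proof.
exists (\sum_(i < size p) `|p`_i| * i%:R ^+ i) => s s0.
rewrite horner_coef mulr_suml; apply: le_trans (ler_norm_sum _ _ _) _.
apply: ler_sum => i _; rewrite -mulrA normrM; apply: ler_wpM2l => //.
rewrite ger0_norm ?mulr_ge0 ?exprn_ge0 ?expR_ge0 //; exact: expR_ge_pow.
Qed.

Lemma is_derive0_quadratic (g : R -> R) C : (forall h, `|g h| <= C * h ^+ 2) ->
  is_derive 0 (1 : R) g 0.
Proof.
move=> gC; have g0 : g 0 = 0.
  by apply/eqP; rewrite -normr_le0; have := gC 0; rewrite expr0n mulr0.
have C0 : 0 <= C by have := le_trans (normr_ge0 _) (gC 1); rewrite expr1n mulr1.
have lim : (fun h => h^-1 *: (g (h *: 1 + 0) - g 0)) @ 0^' --> (0 : R).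
  apply/cvgr0Pnorm_le => e e0; near=> h.
  have h0 : h != 0 by near: h; exact: nbhs_dnbhs_neq.
  have hs : `|h| <= e / (C + 1).
    near: h; apply: nbhs_dnbhs; apply: (@nbhs0_le R R); apply: divr_gt0 => //; lra.
  rewrite g0 subr0 addr0 /GRing.scale /= mulr1 normrM normfV.
  have hp : 0 < `|h| by rewrite normr_gt0.
  rewrite mulrC ler_pdivrMr //; apply: le_trans (gC h) _.
  rewrite -real_normK ?num_real // expr2 mulrA ler_pM2r //.
  apply: le_trans (_ : (C + 1) * `|h| <= _); first by apply: ler_wpM2r => //; lra.
  by rewrite mulrC -ler_pdivlMr //; lra.
apply: DeriveDef; first by apply/cvg_ex; exists 0.
exact: cvg_lim lim.
Unshelve. all: by end_near. Qed.

(** Away from 0 this is the chain rule for 1 / t. At 0, boundedness of s^2 p(s) exp (- s) with s = 1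
    / h makes the function O(h^2), so its derivative is 0. *)
Lemma flat_exp_derive p t :
  is_derive t (1 : R) (flat_exp p) (flat_exp ('X^2 * (p - p^`())) t).
Proof.
case: (ltgtP 0 t) => t0.
- have nr : \forall y \near t, flat_exp p y = p.[y^-1] * expR (- y^-1).
    have : \forall y \near t, 0 < y by exact: lt_nbhsr.
    by apply: filterS => y y0; rewrite /flat_exp y0.
  have tn : t != 0 by rewrite gt_eqF.
  have di : is_derive t (1 : R) (fun y => y^-1) (- t ^- 2).
    apply: is_derive_eq; first exact: (@is_deriveV R id t 1 1 tn (is_derive_id _ _)).
    by rewrite /= /GRing.scale /= mulr1.
  have dp := is_derive1_comp (is_derive_poly p t^-1) di.
  have de := @is_derive1_comp R expR (- GRing.inv) t _ _ (is_derive_expR (- t^-1)) (is_deriveN di).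
  have [dd dv] := is_deriveM dp de.
  have E : \forall y \near t, flat_exp p y = ((horner p \o GRing.inv) * (expR \o (- GRing.inv))) y.
    by apply: filterS nr => y ->.
  apply: DeriveDef.
    move/derivable1_diffP: dd => dd; apply/derivable1_diffP.
    by apply: near_eq_differentiable dd; apply: filterS E => y ->.
  rewrite (near_eq_derive _ E) dv /flat_exp t0 /GRing.scale /=.
  rewrite (_ : (- GRing.inv : R -> R) t = - t^-1) // hornerM hornerXn hornerD hornerN -!exprVn.
  by ring.
- have nr : \forall y \near t, flat_exp p y = 0.
    have : \forall y \near t, y < 0 by exact: lt_nbhsl.
    by apply: filterS => y y0; rewrite /flat_exp ltNge (ltW y0).
  rewrite {2}/flat_exp ltNge (ltW t0) /=; apply: DeriveDef.
    apply/derivable1_diffP; apply: (@near_eq_differentiable _ _ (cst 0) (flat_exp p)).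
      by apply: filterS nr => y ->.
    exact: differentiable_cst.
  by rewrite (near_eq_derive _ nr) derive_cst.
- rewrite -t0 {2}/flat_exp ltxx.
  have [C HC] := poly_expR_bounded ('X^2 * p).
  apply: (@is_derive0_quadratic _ C) => h; rewrite /flat_exp.
  case: ifP => h0.
    have h0' : h != 0 by rewrite gt_eqF.
    have hi : 0 <= h^-1 by rewrite invr_ge0 ltW.
    have := HC _ hi; rewrite hornerM hornerXn -mulrA normrM ger0_norm ?exprn_ge0 //.
    by rewrite exprVn mulrC ler_pdivrMr // exprn_gt0.
  rewrite normr0 mulr_ge0 ?sqr_ge0 //; exact: le_trans (HC 0 (lexx _)).
Qed.

Lemma smooth1_flat_exp p : smooth1 (flat_exp p).
Proof.
exists (fun g => exists q, g = flat_exp q); first by exists p.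
move=> _ [q ->]; exists (flat_exp ('X^2 * (q - q^`()))); first by exists ('X^2 * (q - q^`())).
exact: flat_exp_derive.
Qed.

(** The support has half-width 1 / 4, less than 1 / 2, so that integer translates do not meet. *)
Definition bump (t : R) : R := flat_exp 1 (4^-1 - t) * flat_exp 1 (4^-1 + t).

Lemma bump_ge0 t : 0 <= bump t.
Proof.
have h s : 0 <= flat_exp 1 s.
  by rewrite /flat_exp; case: ifP => // _; rewrite hornerC mul1r expR_ge0.
exact: mulr_ge0.
Qed.

Lemma bump_gt0 t : `|t| < 4^-1 -> 0 < bump t.
Proof.
rewrite ltr_norml => /andP[t1 t2].
have h s : 0 < s -> 0 < flat_exp 1 s.
  by move=> s0; rewrite /flat_exp s0 hornerC mul1r expR_gt0.
by apply: mulr_gt0; apply: h; lra.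
Qed.

Lemma bump_eq0 t : 4^-1 <= `|t| -> bump t = 0.
Proof.
rewrite ler_normr => /orP[h|h]; rewrite /bump /flat_exp.
  by rewrite (_ : 0 < 4^-1 - t = false) ?mul0r //; apply/negP; lra.
by rewrite (_ : 0 < 4^-1 + t = false) ?mulr0 //; apply/negP; lra.
Qed.

End BumpFunction.

(** * Quasi-periodic extension of a bump and its Weyl average *)

Section Sections.
Variables (R : realType) (n k : nat).
Local Notation M := 'M[R]_(2, n.-1).
Local Notation U := (@regular R n).
Local Notation C := R[i].
Implicit Types (x y : oneform R n) (m : 'M[int]_(2, n.-1)).

Lemma smooth_near (f : oneform R n -> C) :
  (forall x, U x -> exists2 g, smooth g & \forall y \near (x : M), f y = g y) -> smooth f.
Proof.
move=> H; apply/smoothP.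
have near_partials w (f1 g1 : M -> R) (x : M) : (\forall y \near x, f1 y = g1 y) ->
    \forall y \near x, rpartials w f1 y = rpartials w g1 y.
  move=> fg; elim: w => [//|p w IH] /=.
  by apply: filterS (near_join IH) => y; exact: near_eq_derive.
have loc (h : C -> R) : (forall g, smooth g -> rsmooth (fun x : M => h (g x))) -> rsmooth (fun x : M => h (f x)).
  move=> hs w x Ux; have [g sg fg] := H x Ux.
  apply: near_eq_differentiable (hs g sg w x Ux); apply: near_partials.
  by apply: filterS fg => y ->.
by split; apply: loc => g /smoothP[].
Qed.

Lemma coord_linear (i : 'I_2) (j : 'I_n.-1) : linear (fun x : M => x i j).
Proof. by move=> a u v; rewrite !mxE. Qed.

Definition coord_lin (i : 'I_2) (j : 'I_n.-1) : {linear M -> R} :=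
  HB.pack (fun x : M => x i j) (GRing.isLinear.Build _ _ _ _ _ (coord_linear i j)).

Lemma smooth_flat_exp (a : R) (l : {linear M -> R}) c :
  smooth (fun x : oneform R n => (flat_exp 1 (a * l x + c))%:C).
Proof.
have lin : linear (fun x : M => a * l x).
  by move=> b u v; rewrite linearD linearZ /= -[b *: l u]/(b * l u) -[b *: (a * l u)]/(b * (a * l u)); ring.
pose l' : {linear M -> R} := HB.pack (fun x : M => a * l x) (GRing.isLinear.Build _ _ _ _ _ lin).
apply: smooth_exprs => /=; last exact: smooth_expr_cst.
exact: (@smooth_expr_comp1 R n _ l' c (smooth1_flat_exp 1)).
Qed.

Lemma smooth_prod (I : Type) (r : seq I) (F : I -> oneform R n -> C) :
  (forall i, smooth (F i)) -> smooth (fun x => \prod_(i <- r) F i x).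
Proof.
move=> sF; elim: r => [|i r IH].
  under eq_fun do rewrite big_nil; exact: smooth_cst.
under eq_fun do rewrite big_cons; exact: (smoothM (sF i) IH).
Qed.

(* The cocycle twists the bump function around the integral form m; these bumps
   have disjoint supports, so that their sum over m is smooth. *)
Definition bump_at m x : C := cocycle k (integral_form R m) x *
  \prod_i \prod_j (bump (x i j - (m i j)%:~R))%:C.

Definition round_mx x : 'M[int]_(2, n.-1) := \matrix_(i, j) Num.floor (x i j + 2^-1).

(** At each x at most the nearest integral form contributes to the sum over all m, so the sum is
    encoded by that one term. *)
Definition bump_sum x : C := bump_at (round_mx x) x.

Lemma smooth_bump_at m : smooth (bump_at m).
Proof.
apply: smoothM; first exact: smooth_cocycle.
apply: smooth_prod => i; apply: smooth_prod => j.
have s1 := smooth_flat_exp (-1) (coord_lin i j) (4^-1 + (m i j)%:~R).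
have s2 := smooth_flat_exp 1 (coord_lin i j) (4^-1 - (m i j)%:~R).
have -> : (fun x : oneform R n => (bump (x i j - (m i j)%:~R))%:C) =
   (fun x => (flat_exp 1 (-1 * coord_lin i j x + (4^-1 + (m i j)%:~R)))%:C *
             (flat_exp 1 (1 * coord_lin i j x + (4^-1 - (m i j)%:~R)))%:C).
  apply/funext => x; rewrite -rmorphM /bump /=; congr ((flat_exp 1 _ * flat_exp 1 _)%:C); ring.
exact: smoothM s1 s2.
Qed.

Lemma bump_at_eq0 m x i j : 4^-1 <= `|x i j - (m i j)%:~R| -> bump_at m x = 0.
Proof.
move=> h; rewrite /bump_at (bigD1 i) //= (bigD1 j) //= (bump_eq0 h).
by rewrite !mul0r mulr0.
Qed.

Lemma floor_near (t : R) (z : int) : `|t - z%:~R| < 2^-1 -> Num.floor (t + 2^-1) = z.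
Proof.
rewrite ltr_norml => /andP[h1 h2]; apply/eqP; rewrite floor_eq; apply/andP; split; first by lra.
by rewrite intrD; lra.
Qed.

Lemma floor_dist (t : R) (z : int) : `|t - (Num.floor (t + 2^-1))%:~R| <= `|t - z%:~R|.
Proof.
set f := Num.floor _.
have h1 : f%:~R <= t + 2^-1 by exact: floor_le_tmp.
have h2 : t + 2^-1 < f%:~R + 1 by have := lt_succ_floor (t + 2^-1); rewrite intrD.
have [->//|/eqP zf] := eqVneq z f.
have d : 1 <= `|z%:~R - f%:~R : R| .
  by rewrite -intrB -intr_norm ler1z; lia.
have a1 : `|t - f%:~R| <= 2^-1 by rewrite ler_norml; lra.
have := ler_distD t z%:~R f%:~R; rewrite (distrC z%:~R t); lra.
Qed.

Lemma smooth_bump_sum : smooth bump_sum.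
Proof.
apply: smooth_near => x Ux.
have nr : \forall y \near (x : M), forall (i : 'I_2) (j : 'I_n.-1), `|(y : M) i j - x i j| < 8^-1.
  have : \forall y \near (x : M), `|(x : M) - y| < 8^-1.
    have e0 : (0 : R) < 8^-1 by rewrite invr_gt0.
    by apply: (nbhs_normP (x : M) (fun y => `|(x : M) - y| < 8^-1)).2; exists 8^-1.
  apply: filterS => y h i j; apply: le_lt_trans h; rewrite distrC.
  by have := norm_entry_le (x - y : M) i j; rewrite !mxE.
(* The threshold 3 / 8 lies midway between 1 / 4 and 1 / 2. Below it, a move by less than 1 / 8
   keeps the nearest integers; otherwise such a move leaves one coordinate at distance at least 1 /
   4 from every integer, where the bump vanishes. *)
case: (pselect (forall i j, `|x i j - (round_mx x i j)%:~R| < 3 / 8)) => H.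
  exists (bump_at (round_mx x)); first exact: smooth_bump_at.
  apply: filterS nr => y yx; rewrite /bump_sum; congr bump_at.
  apply/matrixP => i j; rewrite mxE; apply: floor_near.
  apply: le_lt_trans (ler_distD (x i j) _ _) _.
  by have := H i j; have := yx i j; lra.
exists (fun=> 0); first exact: smooth_cst.
have [i [j hij]] : exists i j, 3 / 8 <= `|x i j - (round_mx x i j)%:~R|.
  apply: contrapT => H'; apply: H => i j; rewrite ltNge; apply/negP => h.
  by apply: H'; exists i, j.
apply: filterS nr => y yx; apply: (@bump_at_eq0 _ _ i j).
have := floor_dist (x i j) (round_mx y i j); move: hij; rewrite mxE.
have := ler_distD (y i j) (x i j) (round_mx y i j)%:~R; rewrite distrC.
by have := yx i j; rewrite [`|y i j - _|]distrC; lra.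
Qed.

(** The cross terms of the sign and the half of omega (m', m) combine to 2 pi k times an integer.
    Consistency of the cocycle thus rests on the sign in its definition. *)
Lemma cocycle_sum m m' x : cocycle k (integral_form R (m + m')) (x + integral_form R m') =
  cocycle k (integral_form R m') x * cocycle k (integral_form R m) x.
Proof.
pose u (m : 'M[int]_(2, n.-1)) i j := Num.floor (diag (integral_form R m) i j).
have uE m1 i j : diag (integral_form R m1) i j = (u m1 i j)%:~R.
  by apply/esym/eqP; rewrite -intrEfloor; exact: diag_integral.
have mm : integral_form R (m + m') = integral_form R m + integral_form R m'.
  by rewrite /integral_form map_mxD.
have o0 : omega (integral_form R m') (integral_form R m') = 0.
  by rewrite /omega big1 ?mulr0 // => j _; rewrite mulrC subrr.
rewrite /cocycle -expi_add mm !omegaDr !omegaDl o0.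
set w1 := omega x _; set w2 := omega x _.
set s1 := \sum_j diag (integral_form R m') 0 j * _; set s2 := \sum_j diag (integral_form R m) 0 j * _.
have -> : \sum_j diag (integral_form R m + integral_form R m') 0 j *
    diag (integral_form R m + integral_form R m') 1 j =
    s1 + s2 + \sum_j ((u m 0 j)%:~R * (u m' 1 j)%:~R + (u m' 0 j)%:~R * (u m 1 j)%:~R).
  rewrite /s1 /s2 -!big_split; apply: eq_bigr => j _ /=.
  by rewrite !diagD !uE; ring.
have -> : omega (integral_form R m') (integral_form R m) =
    2 * pi * \sum_j ((u m' 0 j)%:~R * (u m 1 j)%:~R - (u m' 1 j)%:~R * (u m 0 j)%:~R).
  by rewrite /omega; congr (_ * _); apply: eq_bigr => j _; rewrite !uE.
rewrite big_split sumrB /=.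
set a := \sum_j (u m 0 j)%:~R * _; set b := \sum_j (u m' 0 j)%:~R * _.
have -> : \sum_j (u m' 1 j)%:~R * (u m 0 j)%:~R = a by apply: eq_bigr => j _; rewrite mulrC.
have -> : a = (\sum_j u m 0 j * u m' 1 j)%:~R by rewrite rmorph_sum; apply: eq_bigr => j _; rewrite rmorphM.
move: (\sum_j u m 0 j * u m' 1 j) => z.
rewrite -[RHS]mulr1 -(expi_2pi R (k%:Z * z)) -expi_add; congr expi.
by rewrite intrM; field.
Qed.

Lemma bump_sum_translate m x : bump_sum (x + integral_form R m) =
  cocycle k (integral_form R m) x * bump_sum x.
Proof.
have r : round_mx (x + integral_form R m) = round_mx x + m.
  by apply/matrixP => i j; rewrite !mxE addrAC real_floorDrz ?num_real ?intr_int // intrKfloor.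
rewrite /bump_sum r /bump_at cocycle_sum -mulrA; congr (_ * (_ * _)).
apply: eq_bigr => i _; apply: eq_bigr => j _; congr ((bump _)%:C).
by rewrite !mxE intrD; ring.
Qed.

Definition weyl_int (w : 'S_(n.-1.+1)) m : 'M[int]_(2, n.-1) :=
  \matrix_(i, j) Num.floor (weyl w (integral_form R m) i j).

Lemma weyl_integral w m : weyl w (integral_form R m) = integral_form R (weyl_int w m).
Proof.
apply/matrixP => i j; rewrite [RHS]mxE [weyl_int _ _ _ _]mxE; apply/esym/eqP.
by rewrite -intrEfloor weylE; exact: diag_integral.
Qed.

Lemma cocycle_weyl w (m x : oneform R n) : cocycle k (weyl w m) (weyl w x) = cocycle k m x.
Proof.
rewrite /cocycle omega_weyl [in RHS](reindex_inj (@perm_inj _ w)) /=.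
by under eq_bigr do rewrite !diag_weyl.
Qed.

Definition nice_section x : C := \sum_(w : 'S_(n.-1.+1)) bump_sum (weyl w x).

Lemma weyl_comp w v x : weyl w (weyl v x) = weyl (w * v)%g x.
Proof.
apply/matrixP => i j; rewrite !weylE diag_weyl permM //.
Qed.

Lemma is_section_nice : is_section k nice_section.
Proof.
split.
- apply: smooth_sum => w.
  have -> : (fun x => bump_sum (weyl w x)) = (fun x => bump_sum (weyl_lin R w x + 0)).
    by apply/funext => x; rewrite addr0.
  apply: (smooth_comp smooth_bump_sum) => x Ux; rewrite addr0; exact: regular_weyl.
- move=> m x _; rewrite /nice_section mulr_sumr; apply: eq_bigr => w _.
  rewrite [weyl w (x + _)](linearD (weyl_lin R w)) /= weyl_integral bump_sum_translate.
  by rewrite -weyl_integral cocycle_weyl.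
- move=> v x _; rewrite /nice_section [in RHS](reindex_inj (mulIg v)) /=.
  by apply: eq_bigr => w _; rewrite weyl_comp.
Qed.

(** At a regular point near the origin all Weyl images round to the zero form, where the cocycle is
    1. The average is then a sum of nonnegative reals with a positive term, so no cancellation
    occurs. *)
Lemma exists_section_neq0 : exists psi x, [/\ is_section k psi, U x & psi x != 0].
Proof.
have [x Ux xs] := @small_regular R n 4^-1 (ltac:(rewrite invr_gt0 //)).
exists nice_section, x; split=> //; first exact: is_section_nice.
have E w : bump_sum (weyl w x) = (\prod_i \prod_j bump (weyl w x i j))%:C.
  have r : round_mx (weyl w x) = 0.
    apply/matrixP => i j; rewrite mxE [RHS]mxE; apply: floor_near.
    by rewrite mulr0z subr0 weylE; apply: lt_trans (xs _ _) _; lra.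
  rewrite /bump_sum r /bump_at.
  have -> : integral_form R (0 : 'M[int]_(2, n.-1)) = 0 by rewrite /integral_form map_mx0.
  have -> : cocycle k 0 (weyl w x) = 1.
    rewrite /cocycle big1 => [|j _]; last by rewrite diagE mul0mx !mxE mul0r.
    have -> : omega (weyl w x) (0 : oneform R n) = 0.
      by rewrite /omega big1 ?mulr0 // => j _; rewrite !diagE !mul0mx !mxE !mulr0 subrr.
    by rewrite mulr0 mul0r subrr mulr0 /expi cos0 sin0.
  rewrite mul1r rmorph_prod; apply: eq_bigr => i _; rewrite rmorph_prod.
  apply: eq_bigr => j _; have z : (0 : 'M[int]_(2, n.-1)) i j = 0 by rewrite mxE.
  by rewrite z mulr0z subr0.
rewrite /nice_section (eq_bigr _ (fun w _ => E w)) -rmorph_sum /=.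
rewrite fmorph_eq0 gt_eqF //; rewrite (bigD1 1%g) //=.
apply: ltr_pwDl; last by apply: sumr_ge0 => w _; apply: prodr_ge0 => i _; apply: prodr_ge0 => j _; exact: bump_ge0.
apply: prodr_gt0 => i _; apply: prodr_gt0 => j _; apply: bump_gt0; rewrite weylE; exact: xs.
Qed.

End Sections.

(** * The set of solutions *)

Section SolutionSpace.
Variables (R : realType) (n k : nat).
Hypothesis k0 : (0 < k)%N.
Local Notation C := R[i].

Lemma infinitely_many_trivialisations : exists T : nat -> opmap R n,
  (forall j, trivialisation k (T j) /\ mcg_invariant k (T j) /\
     exists2 alpha, normalised_solution k alpha & of_form k alpha (T j)) /\
  (forall j j', j <> j' ->
     exists D l tau, [/\ is_diffop k D, teich tau
                       & ~ eq_oper k (T j D l tau) (T j' D l tau)]).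
Proof.
have ex (j : nat) := normalised_exists (fun=> j%:R : C) k0.
have [al alP] := choice ex.
exists (fun j => solution_map k (al j)); split=> [j|j j' jj].
  have [ns _] := alP j; have rs := represented_solution_map (n := n) (k := k) (al j).
  split; first exact: represented_trivialisation ns rs.
  by split; [exact: represented_mcg_invariant rs|exists (al j)].
have [psi [x [sp Ux px]]] := exists_section_neq0 R n k.
(* All commutators with the identity vanish, so the coefficient of s^-1 is the diagonal entry alpha
   1 1 = j; the point (0, 1) is tau = i. *)
exists id, 1%N, (0, 1); split.
- exact: dop_diffop (rep_id R n k) (dop1 R n).
- exact: ltr01.
have val i : solution_map k (al i) id 1 (0, 1) psi x = i%:R * psi x.
  have [_ d1] := alP i.
  rewrite /solution_map !big_ord_recl big_ord0 addr0 /= (d1 1%N isT).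
  rewrite (_ : A_op k (1 - 0) id (0, 1) psi x = 0) ?mulr0 ?add0r; last first.
    by rewrite /A_op /= /bracket subrr mulr0.
  by rewrite /A_op /= fact0 invr1 mul1r.
move=> /(_ psi x sp Ux); rewrite !val => /(mulIf px)/eqP.
by rewrite eqr_nat => /eqP.
Qed.

Lemma trivialisations_proportional (T T' : opmap R n) (alpha alpha' : nat -> nat -> C) :
  normalised_solution k alpha -> normalised_solution k alpha' ->
  of_form k alpha T -> of_form k alpha' T' ->
  exists c : nat -> C, forall D l tau, is_diffop k D -> teich tau ->
    eq_oper k (T' D l tau)
      (fun psi x => \sum_(j < l.+1) c j * T D (l - j)%N tau psi x).
Proof.
move=> na na' fT fT'; have [c cE] := normalised_twist k0 na na'.
exists c => D l tau dD htau psi x sp Ux.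
rewrite (fT' D l tau dD htau psi x sp Ux).
pose F r j := c j * alpha (l - j)%N (r - j)%N * A_op k (l - r) D tau psi x.
transitivity (\sum_(r < l.+1) \sum_(j < r.+1) F r j).
  by apply: eq_bigr => r _; rewrite cE ?leq_ord // /twist mulr_suml.
rewrite triangle_sum; apply: eq_bigr => j _.
have jl : (j <= l)%N by exact: leq_ord.
rewrite (fT D (l - j)%N tau dD htau psi x sp Ux) mulr_sumr subSn //.
by apply: eq_bigr => r _; rewrite /F addKn -mulrA subnDA.
Qed.

End SolutionSpace.

(** * The branch of the logarithm *)

Section Branch.
Variables (R : realType) (k : nat).
Hypothesis k0 : (0 < k)%N.
Local Notation C := R[i].
Local Notation kR := (k%:R : R).

Let kR0 : 0 < kR. Proof. by rewrite ltr0n. Qed.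
Let kRn : kR != 0. Proof. by rewrite gt_eqF. Qed.

Lemma natC m : m%:R = (m%:R)%:C :> C.
Proof. by rewrite rmorph_nat. Qed.

Lemma real_mulC (a : R) (z : C) : a%:C * z = (a * complex.Re z) +i* (a * complex.Im z).
Proof. by case: z => x y; apply: eqC_ReIm => /=; ring. Qed.

Lemma cos_sin_2atan (x : R) :
  cos (2 * atan x) = (1 - x ^+ 2) / (1 + x ^+ 2) /\ sin (2 * atan x) = 2 * x / (1 + x ^+ 2).
Proof.
have p : 0 < 1 + x ^+ 2 by have := sqr_ge0 x; lra.
have c2 : cos (atan x) ^+ 2 = (1 + x ^+ 2)^-1.
  by rewrite cos_atan exprVn sqr_sqrtr // ltW.
have cn : cos (atan x) != 0 by rewrite cos_atan invr_eq0 sqrtr_eq0 -ltNge.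
have sx : sin (atan x) = x * cos (atan x).
  by rewrite -{2}[x](atanK x) /tan divfK.
have -> : 2 * atan x = atan x + atan x by ring.
rewrite cosD sinD sx; split.
  by rewrite -c2; ring.
by rewrite -c2; ring.
Qed.

Definition branch (s : R) : C := 0 +i* (atan (kR / s) / (2 * kR)).

Lemma four_k (z : C) : 4 * k%:R * z = (4 * kR * complex.Re z) +i* (4 * kR * complex.Im z).
Proof. by rewrite [4]natC [k%:R]natC -rmorphM real_mulC. Qed.

(** Since i (k - i s) = s + i k, the quotient is (s + i k)^2 / (s^2 + k^2). Squaring makes 2 atan (k
    / s) a valid argument for negative s too. *)
Lemma branch_expi s : s != 0 ->
  - conjc (level k s) / level k s = expi (2 * atan (kR / s)) :> C.
Proof.
move=> s0; have t0 : level k s != 0 :> C.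
  by apply/negP => /eqP /(congr1 (@complex.Im R)) /= /eqP; rewrite (negPf s0).
apply: (mulIf t0); rewrite divfK // /expi.
have [-> ->] := cos_sin_2atan (kR / s).
have q0 : s ^+ 2 + kR ^+ 2 != 0 by rewrite gt_eqF // addr_gt0 // exprn_even_gt0.
have e : 1 + (kR / s) ^+ 2 = (s ^+ 2 + kR ^+ 2) / s ^+ 2 by field.
by rewrite e; apply: eqC_ReIm; rewrite /level /=; field; rewrite s0 q0.
Qed.

Lemma atan_le (x : R) : `|atan x| <= `|x|.
Proof.
have d (s : R) : `|s| <= `|x| -> derivable (@atan R) (0 + s *: 1) 1 by [].
have [s _ ] := mean_value_line d.
rewrite atan0 subr0 add0r [x%:A]mulr1 add0r => ->.
rewrite derive_val normrM ler_piMr //.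
have p : 1 <= 1 + (s *: (1 : R)) ^+ 2 by have := sqr_ge0 (s *: (1 : R)); lra.
by rewrite ger0_norm ?invr_ge0 ?invf_le1 //; lra.
Qed.

Lemma continuous_atan_inv s : s != 0 -> (fun s : R => atan (kR / s)) @ s --> atan (kR / s).
Proof.
move=> s0; have c : (fun s : R => kR / s) @ s --> kR / s.
  by apply: cvgM; [exact: cvg_cst|apply: cvgV => //; exact: cvg_id].
exact: (cvg_comp _ _ c (@continuous_atan R (kR / s))).
Qed.

Lemma branch_near_infinity (e : R) : 0 < e -> forall s : R, e^-1 < `|s| ->
  `|atan (kR / s) / (2 * kR)| <= e.
Proof.
move=> e0 s se; have i0 : 0 < e^-1 by rewrite invr_gt0.
have s0 : 0 < `|s| by exact: lt_trans se.
have k2 : 0 < 2 * kR by exact: mulr_gt0.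
rewrite normrM normfV (gtr0_norm k2) ler_pdivrMr //; apply: le_trans (atan_le _) _.
rewrite normrM normfV (gtr0_norm kR0) ler_pdivrMr //.
have h : 1 <= `|s| * e by rewrite -ler_pdivrMr // div1r ltW.
have hk : kR <= kR * (`|s| * e) by rewrite ler_peMr // ltW.
have := mulr_gt0 kR0 (mulr_gt0 s0 e0); lra.
Qed.

Lemma is_r_branch : is_r k branch.
Proof.
split.
- move=> s s0; rewrite branch_expi // four_k /cexp /= mulr0 expR0 mul1r.
  by congr expi; field.
- move=> s s0; split; first exact: cvg_cst.
  apply: cvgM; [exact: continuous_atan_inv|exact: cvg_cst].
- split; first exact: cvg_cst.
  apply/cvgr0Pnorm_le => e e0; near=> s; apply: branch_near_infinity => //.
  have : e^-1 < s by near: s; apply: nbhs_pinfty_gt; exact: num_real.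
  by move=> h; apply: lt_le_trans h (ler_norm _).
- split; first exact: cvg_cst.
  apply/cvgr0Pnorm_le => e e0; near=> s; apply: branch_near_infinity => //.
  have : s < - e^-1 by near: s; apply: nbhs_ninfty_lt; exact: num_real.
  move=> h; rewrite -normrN; apply: lt_le_trans (ler_norm _); lra.
Unshelve. all: by end_near. Qed.

(** If d s were nonzero, |d| would descend from |d s| to 0 and, by the intermediate value theorem,
    take a value c strictly between 0 and pi, where the cosine is not 1. *)
Lemma cos_eq1_const (d : R -> R) : (forall s : R, 0 < s -> d @ s --> d s) ->
  (forall s : R, 0 < s -> cos (d s) = 1) -> d @ +oo --> (0 : R) -> forall s : R, 0 < s -> d s = 0.
Proof.
move=> cd c1 dl s s0; apply/eqP/negPn/negP => ds.
pose c := Num.min `|d s| pi / 2.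
have m0 : 0 < Num.min `|d s| pi by rewrite lt_min normr_gt0 ds pi_gt0.
have c0 : 0 < c by rewrite divr_gt0.
have cd' : c < `|d s| by apply: lt_le_trans (_ : Num.min `|d s| pi <= _); [rewrite /c; lra|by rewrite ge_min lexx].
have cpi : c < pi by apply: lt_le_trans (_ : Num.min `|d s| pi <= _); [rewrite /c; lra|by rewrite ge_min lexx orbT].
have [s1 [ss1 ds1]] : exists s1, s < s1 /\ `|d s1| < c.
  have h1 : \forall t \near +oo, `|d t| < c by move/cvgr0Pnorm_lt: dl => /(_ c c0).
  have h2 : \forall t \near +oo, s < t by apply: nbhs_pinfty_gt; exact: num_real.
  by have [t [? ?]] := filter_ex (filterI h1 h2); exists t.
have cont : {within `[s, s1], continuous (fun t => `|d t|)}.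
  apply: continuous_in_subspaceT => t; rewrite inE /= in_itv /= => /andP[st _].
  by apply: cvg_norm; apply: cd; exact: lt_le_trans st.
have mm : Num.min `|d s| `|d s1| <= c <= Num.max `|d s| `|d s1|.
  by rewrite ge_min le_max (ltW ds1) (ltW cd') orbT.
have [u] := IVT (ltW ss1) cont mm; rewrite in_itv /= => /andP[su _] du.
have u0 : 0 < u by exact: lt_le_trans su.
have : cos c = cos 0.
  by rewrite cos0 -(c1 u u0) -du; case: (ger0P (d u)) => // _; rewrite cosN.
move/cos_inj => E; have : c = 0 by apply: E; rewrite in_itv /= ?lexx ?pi_ge0 // (ltW c0) ltW.
by move=> cE; rewrite cE ltxx in c0.
Qed.

Lemma is_r_unique r : is_r k r -> forall s, s != 0 -> r s = branch s.
Proof.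
move=> [rexp rc rp rn].
pose d s := 4 * kR * complex.Im (r s) - 2 * atan (kR / s).
have key s : s != 0 -> complex.Re (r s) = 0 /\ cos (d s) = 1.
  move=> s0; have := rexp s s0; rewrite (branch_expi s0) four_k /cexp real_mulC /expi /=.
  set e := expR _; set x := _ * complex.Im _; set y := 2 * atan _ => -[E1 E2].
  have e0 : 0 < e by exact: expR_gt0.
  have e1 : e = 1.
    have : e ^+ 2 = 1.
      transitivity ((e * cos x) ^+ 2 + (e * sin x) ^+ 2).
        by rewrite !exprMn -mulrDr cos2Dsin2 mulr1.
      by rewrite E1 E2 cos2Dsin2.
    by move/eqP; rewrite sqrf_eq1 => /orP[/eqP//|/eqP h]; move: e0; rewrite h; lra.
  split.
    have : 4 * kR * complex.Re (r s) = 0 by apply: expR_inj; rewrite expR0.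
    by move/eqP; rewrite !mulf_eq0 (negPf kRn) orbF pnatr_eq0 /= => /eqP.
  rewrite /d -/x -/y cosB; move: E1 E2; rewrite e1 !mul1r => -> ->.
  by rewrite -!expr2 cos2Dsin2.
have dc s : s != 0 -> d @ s --> d s.
  move=> s0; apply: cvgB; last by apply: cvgM; [exact: cvg_cst|exact: continuous_atan_inv].
  by apply: cvgM; [exact: cvg_cst|case: (rc s s0)].
have lim0 (F : set_system R) : Filter F -> ccvg F r 0 -> (fun s => complex.Im (branch s)) @ F --> (0 : R) -> d @ F --> (0 : R).
  move=> FF [_ h1] h2.
  have -> : d = (fun s => 4 * kR * complex.Im (r s) - 4 * kR * complex.Im (branch s)).
    by apply/funext => s; rewrite /d /branch /=; congr (_ - _); field.
  have a : (fun s => 4 * kR * complex.Im (r s)) @ F --> 4 * kR * (0 : R).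
    by apply: cvgM; [exact: cvg_cst|exact: h1].
  have b : (fun s => 4 * kR * complex.Im (branch s)) @ F --> 4 * kR * (0 : R).
    by apply: cvgM; [exact: cvg_cst|exact: h2].
  rewrite -(subrr (4 * kR * (0 : R))); exact: (cvgB a b).
have [_ _ [_ bp] [_ bn]] := is_r_branch.
(* The value s = 0 separates the two half-lines, so each is treated from its own infinity, the
   negative one by reflection. *)
have d0 s : s != 0 -> d s = 0.
  move=> s0; case: (ltgtP 0 s) s0 => // sp _.
    apply: (cos_eq1_const (d := d)) sp.
    - by move=> t t0; apply: dc; rewrite gt_eqF.
    - by move=> t t0; have [] := key t; rewrite ?gt_eqF.
    - exact: lim0 rp bp.
  rewrite -[s]opprK; apply: (cos_eq1_const (d := fun t => d (- t))); last by lra.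
  - move=> t t0; have tn : - t != 0 by rewrite oppr_eq0 gt_eqF.
    exact: (cvg_comp _ _ (cvgN cvg_id) (dc _ tn)).
  - by move=> t t0; have [] := key (- t); rewrite ?oppr_eq0 ?gt_eqF.
  - by rewrite -(cvgNy_compNP d); exact: lim0 rn bn.
move=> s s0; have [re _] := key s s0.
apply: eqC_ReIm; rewrite /branch /= ?re //.
have := d0 s s0; rewrite /d => /eqP; rewrite subr_eq0 => /eqP h.
have -> : atan (kR / s) = 2 * kR * complex.Im (r s).
  by apply: (mulfI (_ : 2 != 0 :> R)); rewrite ?pnatr_eq0 // -h; ring.
by field.
Qed.

(** * Expansion of the branch at infinity, and the exponential series *)

Definition atan_poly P : {poly R} :=
  \sum_(p < P) ((-1) ^+ p / p.*2.+1%:R) *: 'X^(p.*2.+1).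

Lemma atan_poly_deriv P (x : R) : (1 + x ^+ 2) * (atan_poly P)^`().[x] = 1 - (- x ^+ 2) ^+ P.
Proof.
elim: P => [|P IH]; first by rewrite /atan_poly big_ord0 deriv0 horner0 mulr0 expr0 subrr.
rewrite /atan_poly big_ord_recr /= -/(atan_poly P) derivD hornerD mulrDr IH.
rewrite derivZ derivXn hornerZ hornerMn hornerXn /=.
have -> : x ^+ P.*2 = (x ^+ 2) ^+ P by rewrite -exprM mul2n.
have d0 : P.*2.+1%:R != 0 :> R by rewrite pnatr_eq0.
rewrite -[(x ^+ 2) ^+ P *+ _]mulr_natr; move: (P.*2.+1%:R : R) d0 => m d0.
have -> : (- x ^+ 2) ^+ P.+1 = - x ^+ 2 * (- x ^+ 2) ^+ P by rewrite exprS.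
rewrite (exprNn (x ^+ 2) P); move: ((-1) ^+ P) ((x ^+ 2) ^+ P) => e Z.
by field.
Qed.

(** The derivative of the error is (- y^2)^P / (1 + y^2), as the derivative of [atan_poly] is a
    finite geometric sum; the mean value theorem then gives the bound. *)
Lemma atan_poly_approx P (x : R) : `|x| <= 1 -> `|atan x - (atan_poly P).[x]| <= `|x| ^+ P.*2.+1.
Proof.
move=> x1; pose f (y : R) := atan y - (atan_poly P).[y].
have df (y : R) : is_derive y (1 : R) f ((- y ^+ 2) ^+ P / (1 + y ^+ 2)).
  have p : 1 + y ^+ 2 != 0 by have := sqr_ge0 y => h; rewrite gt_eqF //; lra.
  have h : is_derive y (1 : R) f ((1 + y ^+ 2)^-1 - (atan_poly P)^`().[y]) :=
    is_deriveB (is_derive1_atan y) (is_derive_poly (atan_poly P) y).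
  apply: (is_derive_eq h).
  apply: (mulfI p); rewrite mulrBr divff // atan_poly_deriv [RHS]mulrC divfK //; ring.
have d (s : R) : `|s| <= `|x| -> derivable f (0 + s *: 1) 1 by case: (df (0 + s *: 1)).
have [s sx] := mean_value_line d.
have f0 : f 0 = 0.
  rewrite /f atan0 /atan_poly horner_sum big1 ?subrr // => p _.
  by rewrite hornerZ hornerXn expr0n mulr0.
rewrite f0 subr0 !add0r [x%:A]mulr1 [s%:A]mulr1 -/(f x) => ->.
have [_ ->] := df s.
have q : 1 <= 1 + s ^+ 2 by have := sqr_ge0 s; lra.
rewrite normrM [leRHS]exprS; apply: ler_wpM2l => //.
rewrite normrM normfV [`|1 + _|]ger0_norm; last by lra.
apply: le_trans (_ : `|(- s ^+ 2) ^+ P| <= _).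
  by rewrite ler_pdivrMr ?ler_peMr //; lra.
rewrite normrX normrN normrX -exprM mul2n; apply: lerXn2r; rewrite ?nnegrE //.
Qed.

Lemma iC_pow m : iC R ^+ m = if odd m then 0 +i* ((-1) ^+ m./2) else ((-1) ^+ m./2)%:C.
Proof.
elim: m => [//|m IH]; rewrite exprS IH /=; case: (boolP (odd m)) => om /=.
  by rewrite uphalf_half om add1n exprS; apply: eqC_ReIm; rewrite /=; ring.
by rewrite uphalf_half (negPf om) add0n; apply: eqC_ReIm; rewrite /=; ring.
Qed.

Lemma r_coef_sum (s : R) N : s != 0 ->
  \sum_(j < N) r_coef R k j * (s^-1)%:C ^+ j =
  0 +i* ((atan_poly N./2).[kR / s] / (2 * kR)).
Proof.
move=> s0; elim: N => [|N IH].
  by rewrite big_ord0 /atan_poly big_ord0 horner0 mul0r.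
rewrite big_ord_recr IH -[N.+1./2]/(uphalf N) uphalf_half /= /r_coef.
case: (boolP (odd N)) => oN; last first.
  by rewrite /= add0n mul0r addr0.
rewrite /= add1n /atan_poly big_ord_recr /= -/(atan_poly _) hornerD hornerZ hornerXn.
have NE : (N./2).*2.+1 = N by rewrite -[RHS]odd_double_half oN.
rewrite NE; have N0 : N%:R != 0 :> R by rewrite pnatr_eq0 -NE.
have -> : (2 * k%:R)^-1 * (ik R k ^+ N / N%:R) * (s^-1)%:C ^+ N =
    ((2 * kR)^-1 * (kR ^+ N / N%:R) * s^-1 ^+ N)%:C * iC R ^+ N :> C.
  by rewrite /ik exprMn !(rmorphM, rmorphXn, fmorphV, rmorph_nat) /=; ring.
rewrite iC_pow oN real_mulC; apply: eqC_ReIm; first by rewrite /= mulr0 addr0.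
by rewrite /= expr_div_n exprVn; field; rewrite ?kRn ?N0 ?expf_neq0.
Qed.

Lemma branch_expansion (s : R) : kR < `|s| ->
  ccvg \oo (fun N : nat => \sum_(j < N) r_coef R k j * (s^-1)%:C ^+ j) (branch s).
Proof.
move=> ks; have s0 : s != 0 by rewrite -normr_gt0; exact: lt_trans ks.
under [X in ccvg _ X _]eq_fun do rewrite r_coef_sum //.
split; first exact: cvg_cst.
apply: cvgM; last exact: cvg_cst.
set x := kR / s.
have x1 : `|x| < 1.
  rewrite /x normrM normfV (gtr0_norm kR0) ltr_pdivrMr ?mul1r // normr_gt0 //.
have := cvg_expr x1; move/cvgr0Pnorm_lt => h.
apply/cvgrPdist_lt => e e0; have := h e e0; apply: filterS => N.
rewrite normrX; apply: le_lt_trans.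
apply: le_trans (atan_poly_approx _ (ltW x1)) _.
apply: ler_wiXn2l => //; first exact: ltW.
(* The exponent [N./2.*2.+1] is at least N for either parity. *)
by have := odd_double_half N; case: (odd N) => /=; lia.
Qed.

Definition exp_sum (z : C) N := \sum_(m < N) z ^+ m / (m`!)%:R.

(** On the imaginary axis, where [branch] takes its values, the parity of m sorts the terms into the
    cosine and the sine series. *)
Lemma exp_sum_cvg (y : R) : ccvg \oo (exp_sum (0 +i* y)) (cexp (0 +i* y)).
Proof.
have E m : (0 +i* y) ^+ m / (m`!)%:R = cos_coeff y m +i* sin_coeff y m :> C.
  have -> : 0 +i* y = y%:C * iC R by rewrite real_mulC /=; apply: eqC_ReIm; rewrite /=; ring.
  rewrite exprMn natC -rmorphXn mulrAC -fmorphV -rmorphM real_mulC iC_pow /cos_coeff /sin_coeff /=.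
  case: (boolP (odd m)) => om /=; apply: eqC_ReIm => /=; rewrite ?mul0r ?mulr0 //.
    have -> : m.-1./2 = m./2 by case: (m) om => //= m' om'; rewrite uphalf_half (negPf om').
    by ring.
  by rewrite -exprnP; ring.
have S N : exp_sum (0 +i* y) N = series (cos_coeff y) N +i* series (sin_coeff y) N.
  rewrite /series /= !big_mkord /exp_sum; elim: N => [|N IH]; first by rewrite !big_ord0.
  by rewrite !big_ord_recr /= IH E.
rewrite /cexp /= expR0 mul1r /expi.
have -> : exp_sum (0 +i* y) = (fun N => series (cos_coeff y) N +i* series (sin_coeff y) N).
  by apply/funext.
split => /=.
  by rewrite unlock; exact: is_cvg_series_cos_coeff.
by rewrite unlock; exact: is_cvg_series_sin_coeff.
Qed.

End Branch.

(** * The explicit trivialisation *)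

Section ExplicitTrivialisation.
Variables (R : realType) (n k : nat).
Hypothesis k0 : (0 < k)%N.
Local Notation U := (@regular R n).
Local Notation C := R[i].
Local Notation E := (endo R n).

Lemma ccvgD (F : set_system nat) (u v : nat -> C) a b : Filter F ->
  ccvg F u a -> ccvg F v b -> ccvg F (fun N => u N + v N) (a + b).
Proof.
move=> FF [u1 u2] [v1 v2]; split; rewrite ?ReD ?ImD.
  by under eq_fun do rewrite ReD; exact: (cvgD u1 v1).
by under eq_fun do rewrite ImD; exact: (cvgD u2 v2).
Qed.

Lemma ccvgZ (F : set_system nat) (u : nat -> C) c a : Filter F ->
  ccvg F u a -> ccvg F (fun N => c * u N) (c * a).
Proof.
move=> FF [u1 u2]; split; rewrite ?ReM ?ImM.
  under eq_fun do rewrite ReM; apply: cvgD.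
    by apply: cvgM; [exact: cvg_cst|exact: u1].
  by apply: cvgM; [exact: cvg_cst|apply: cvgM; [exact: cvg_cst|exact: u2]].
under eq_fun do rewrite ImM; apply: cvgD.
  by apply: cvgM; [exact: cvg_cst|exact: u2].
by apply: cvgM; [exact: cvg_cst|exact: u1].
Qed.

Lemma ccvg_cst (F : set_system nat) c : Filter F -> ccvg F (fun=> c : C) c.
Proof. by move=> FF; split; exact: cvg_cst. Qed.

Lemma ccvg_shift (u : nat -> C) a : ccvg \oo (fun N => u N.+1) a <-> ccvg \oo u a.
Proof.
have h1 : ((fun N => complex.Re (u N.+1)) @ \oo --> complex.Re a) =
          ((fun N => complex.Re (u N)) @ \oo --> complex.Re a).
  exact: (@cvg_shiftS _ (fun N => complex.Re (u N)) (nbhs (complex.Re a))).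
have h2 : ((fun N => complex.Im (u N.+1)) @ \oo --> complex.Im a) =
          ((fun N => complex.Im (u N)) @ \oo --> complex.Im a).
  exact: (@cvg_shiftS _ (fun N => complex.Im (u N)) (nbhs (complex.Im a))).
by rewrite /ccvg h1 h2.
Qed.

Lemma iter_comm_eigen (A : algType C) (L b bb : A) kap m c d :
  comm_op L b = (- kap) *: b -> comm_op L bb = kap *: bb ->
  iter m (comm_op L) (c *: b + d *: bb) = ((- kap) ^+ m * c) *: b + (kap ^+ m * d) *: bb.
Proof.
move=> hb hbb; elim: m => [|m IH]; first by rewrite !mul1r.
rewrite iterS IH linearD !linearZ /= hb hbb.
by rewrite !scalerA; congr (_ *: _ + _ *: _); rewrite exprS; ring.
Qed.

Lemma comm_eigen (A : algType C) (L b bb : A) kap c d :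
  comm_op L b = (- kap) *: b -> comm_op L bb = kap *: bb ->
  comm_op L (c *: b - d *: bb) + (b + bb) = (1 - kap * c) *: b + (1 - kap * d) *: bb.
Proof.
move=> hb hbb; have := iter_comm_eigen 1 c (- d) hb hbb; rewrite /= scaleNr => ->.
rewrite addrACA -{2}[b]scale1r -{2}[bb]scale1r -!scalerDl.
by congr (_ *: _ + _ *: _); rewrite expr1; ring.
Qed.

Lemma endo_combE (b bb : E) c d psi x : (c *: b + d *: bb) psi x = c * b psi x + d * bb psi x.
Proof. by rewrite endoDE !endoZE. Qed.

(** From m = 1 on the terms follow the eigenvalues - kap and kap, so the sum consists of partial
    sums of the two exponentials divided by -+ kap. The first bracket corrects the term m = 0, which
    does not follow this pattern. *)
Lemma exp_twisted_sum (kap p q r : C) (a : nat -> C) N : kap != 0 ->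
  (forall m, a m.+1 = (- kap) ^+ m * p + kap ^+ m * q) ->
  \sum_(m < N.+1) r ^+ m / (m`!)%:R * a m =
  (a 0%N + kap^-1 * (p - q)) + (- (kap^-1 * p) * exp_sum (- (kap * r)) N.+1 +
   kap^-1 * q * exp_sum (kap * r) N.+1).
Proof.
move=> k0' aS; elim: N => [|N IH].
  by rewrite /exp_sum !big_ord1 !expr0 fact0 invr1 !mul1r; ring.
have eS z : exp_sum z N.+2 = exp_sum z N.+1 + z ^+ N.+1 / (N.+1)`!%:R :> C.
  by rewrite /exp_sum big_ord_recr.
have e1 : (- (kap * r)) ^+ N.+1 = - kap * (- kap) ^+ N * r ^+ N.+1.
  by rewrite -mulNr exprMn exprS.
have e2 : (kap * r) ^+ N.+1 = kap * kap ^+ N * r ^+ N.+1 by rewrite exprMn exprS.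
rewrite big_ord_recr IH aS !eS e1 e2.
move: (exp_sum _ _) (exp_sum _ _) ((- kap) ^+ N) (kap ^+ N) => S1 S2 x y.
rewrite /=; move: (r ^+ N.+1) (((N.+1)`!%:R)^-1) (a 0%N) => z f a0.
by field.
Qed.

(** Here T = t, T' = conj t and K = k. As t + conj t = 2 k, the factor 1 - 2 k / t is - conj t / t,
    and the coefficient of b vanishes once exp (- 4 k r) = - t / conj t; that of bbar is the
    conjugate case. This is the origin of the formula for r. *)
Lemma limit_cancels (T T' K b1 b2 : C) : T != 0 -> T' != 0 -> K != 0 -> T' = 2 * K - T ->
  (2 * T)^-1 * b1 - (2 * T')^-1 * b2 +
    (4 * K)^-1 * ((1 - 4 * K / (2 * T)) * b1 - (1 - 4 * K / (2 * T')) * b2) +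
  (- ((4 * K)^-1 * ((1 - 4 * K / (2 * T)) * b1)) * (- T / T') +
   (4 * K)^-1 * ((1 - 4 * K / (2 * T')) * b2) * (- T' / T)) = 0.
Proof. by move=> T0 T0' K0 E; move: T0'; rewrite E => T0'; field; rewrite T0 T0' K0. Qed.

Section AtPoint.
Variables (s : R) (v tau : R * R).
Hypothesis htau : teich tau.
Local Notation t := (level k s).
Local Notation b := (@b_endo R n k v tau).
Local Notation bb := (@bbar_endo R n k v tau).
Local Notation L := (@laplace_endo R n k tau).

Lemma comm_laplace_b' : comm_op L b = (- (4 * k%:R)) *: b.
Proof. by rewrite (comm_laplace_b n k v htau) mulNr. Qed.

Lemma rep_HW_form : rep k (HW_form k s v tau) ((2 * t)^-1 *: b - (2 * conjc t)^-1 *: bb).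
Proof. exact: repB (repZ _ (rep_b n k v htau)) (repZ _ (rep_bbar n k v htau)). Qed.

(** The connection form contributes its eigenvalues under ad_Delta, and the variation of the Laplace
    operator adds b + bbar. The result is a combination of eigenvectors, which makes all further
    brackets explicit. *)
Lemma rep_ad_HW1 : rep k
  (fun psi x => bracket (laplace k tau) (HW_form k s v tau) psi x - dT (laplace (n := n) k) v tau psi x)
  ((1 - 4 * k%:R * (2 * t)^-1) *: b + (1 - 4 * k%:R * (2 * conjc t)^-1) *: bb).
Proof.
have r1 := rep_bracket (rep_laplace n k htau) rep_HW_form.
have r2 := repD (rep_b n k v htau) (rep_bbar n k v htau).
rewrite -(comm_eigen (2 * t)^-1 (2 * conjc t)^-1 comm_laplace_b' (comm_laplace_bbar n k v htau)).
apply: rep_eq_oper (repD r1 r2) => psi x sp Ux; congr (_ + _).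
have nr : \forall t' \near tau, laplace k t' psi x = laplace_endo n k t' psi x.
  by apply: filterS (near_teich htau) => t' ht; have [_ ->] := rep_laplace n k ht.
rewrite /dT (cderive_near nr).2 (family_deriv_eval psi x (laplace_family n k htau)).2.
have [_ h] := r2; rewrite (h psi x sp Ux) endoNE opprK; reflexivity.
Qed.

Lemma ad_HWE m psi x : is_section k psi -> U x -> ad_HW k s v tau m.+1 psi x =
  (- (4 * k%:R)) ^+ m * ((1 - 4 * k%:R * (2 * t)^-1) * b psi x) +
  (4 * k%:R) ^+ m * ((1 - 4 * k%:R * (2 * conjc t)^-1) * bb psi x).
Proof.
move=> sp Ux; have [_ h] := rep_iter_bracket m (rep_laplace n k htau) rep_ad_HW1.
apply: etrans (h psi x sp Ux) _.
rewrite (iter_comm_eigen _ _ _ comm_laplace_b' (comm_laplace_bbar n k v htau)).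
by rewrite !mulrA; exact: endo_combE.
Qed.

Lemma exp_ad_HW_cvg r psi x : s != 0 -> is_r k r -> is_section k psi -> U x ->
  ccvg \oo (fun N : nat => \sum_(m < N) r s ^+ m / (m`!)%:R * ad_HW k s v tau m psi x) 0.
Proof.
move=> s0 hr sp Ux; apply/ccvg_shift.
have kc : k%:R != 0 :> C by rewrite pnatr_eq0 -lt0n.
have k4 : 4 * k%:R != 0 :> C by rewrite mulf_neq0 // pnatr_eq0.
have h0 : ad_HW k s v tau 0 psi x = (2 * t)^-1 * b psi x - (2 * conjc t)^-1 * bb psi x.
  have [_ h] := rep_HW_form; apply: etrans (h psi x sp Ux) _.
  by rewrite -mulNr -endo_combE scaleNr.
have sumE N := exp_twisted_sum (a := fun m => ad_HW k s v tau m psi x) (r s) N k4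
  (fun m => ad_HWE m sp Ux).
rewrite h0 in sumE.
set y : R := 2 * atan (k%:R / s).
have rE : 4 * k%:R * r s = 0 +i* y.
  rewrite (is_r_unique k0 hr s0) /branch (four_k k) /=; apply: eqC_ReIm; rewrite /= ?mulr0 //.
  by rewrite /y; field; rewrite pnatr_eq0 -lt0n.
have y2 : - (4 * k%:R * r s) = 0 +i* (- y).
  by rewrite rE; apply: eqC_ReIm; rewrite /= ?oppr0.
have c1 := (ccvg_shift _ _).2 (exp_sum_cvg y); have c2 := (ccvg_shift _ _).2 (exp_sum_cvg (- y)).
rewrite -rE in c1; rewrite -y2 in c2.
have t0 : t != 0 by apply/negP => /eqP /(congr1 (@complex.Im R)) /= /eqP; rewrite (negPf s0).
have tc0 : conjc t != 0.
  by apply/negP => /eqP /(congr1 (@complex.Im R)) /= /eqP; rewrite oppr_eq0 (negPf s0).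
have e1 : cexp (4 * k%:R * r s) = - conjc t / t by case: hr => h _ _ _; exact: h.
have e2 : cexp (- (4 * k%:R * r s)) = - t / conjc t.
  have ee : cexp (- (4 * k%:R * r s)) * cexp (4 * k%:R * r s) = 1.
    by rewrite y2 rE /cexp /= expR0 !mul1r -expi_add addNr /expi cos0 sin0.
  rewrite e1 in ee; apply: (mulIf (_ : - conjc t / t != 0)).
    by rewrite mulf_neq0 ?oppr_eq0 ?invr_eq0.
  by rewrite ee; field; rewrite t0 tc0.
have tt : conjc t = 2 * k%:R - t.
  by apply: eqC_ReIm; rewrite [2]natC [k%:R]natC /level /=; ring.
rewrite e1 in c1; rewrite e2 in c2.
rewrite (funext sumE) -[X in ccvg _ _ X](limit_cancels (b psi x) (bb psi x) t0 tc0 kc tt).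
have FF := @eventually_filter.
exact: ccvgD FF (ccvg_cst _ FF) (ccvgD FF (ccvgZ _ FF c2) (ccvgZ _ FF c1)).
Qed.

End AtPoint.
End ExplicitTrivialisation.

Theorem theorem4 (R : realType) (n k : nat) (hn : (2 <= n)%N) (hk : (0 < k)%N) :
  (* (1) *)
  (forall beta : nat -> R[i],
     (exists alpha : nat -> nat -> R[i],
        normalised_solution k alpha /\
        forall r : nat, (1 <= r)%N -> alpha r r = beta r) /\
     (forall alpha alpha' : nat -> nat -> R[i],
        normalised_solution k alpha -> normalised_solution k alpha' ->
        (forall r : nat, (1 <= r)%N -> alpha r r = beta r) ->
        (forall r : nat, (1 <= r)%N -> alpha' r r = beta r) ->
        forall l r : nat, (r <= l)%N -> alpha l r = alpha' l r)) /\
  (* (2) *)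
  (exists T : nat -> opmap R n,
     (forall j, trivialisation k (T j) /\ mcg_invariant k (T j) /\
        exists2 alpha, normalised_solution k alpha & of_form k alpha (T j)) /\
     (forall j j', j <> j' ->
        exists D l tau, [/\ is_diffop k D, teich tau
                          & ~ eq_oper k (T j D l tau) (T j' D l tau)])) /\
  (* (3) *)
  (forall (T T' : opmap R n) (alpha alpha' : nat -> nat -> R[i]),
     normalised_solution k alpha -> normalised_solution k alpha' ->
     of_form k alpha T -> of_form k alpha' T' ->
     trivialisation k T -> trivialisation k T' ->
     exists c : nat -> R[i], forall D l tau, is_diffop k D -> teich tau ->
       eq_oper k (T' D l tau)
         (fun psi x => \sum_(j < l.+1) c j * T D (l - j)%N tau psi x)) /\
  (* (4): the branch r, and its expansion at infinity *)
  (exists r : R -> R[i], is_r k r) /\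
  (forall r : R -> R[i], is_r k r ->
     (forall s : R, k%:R < `|s| ->
        ccvg \oo (fun N : nat => \sum_(j < N) r_coef R k j * (s^-1)%:C ^+ j) (r s)) /\
     (* exp (r Delta) (nabla^Tr + HW_form) exp (- r Delta)
        = \sum_m r^m / m! ad_Delta^m (nabla^Tr + HW_form) = nabla^Tr *)
     (forall (s : R) (v tau : R * R) psi (x : oneform R n),
        s != 0 -> teich tau -> is_section k psi -> regular x ->
        ccvg \oo (fun N : nat => \sum_(m < N) r s ^+ m / (m`!)%:R *
                    ad_HW k s v tau m psi x) 0)) /\
  (* (4): the same identity between formal series in s^-1 *)
  (forall (v tau : R * R) l, teich tau ->
     dT_exists k (fun tau' => formal_exp (n := n) (fun j => - r_coef R k j)
                                (laplace k tau') l) tau /\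
     eq_oper k
       (formal_comp (formal_exp (r_coef R k) (laplace (n := n) k tau))
          (HW_expansion k v
             (fun tau' => formal_exp (fun j => - r_coef R k j) (laplace k tau')) tau) l)
       (@zero_oper R n)) /\
  (* (4): the resulting solution *)
  (forall D l tau, is_diffop k D -> teich tau ->
     eq_oper k
       (formal_comp
          (formal_exp (fun j => - r_coef R k j) (laplace (n := n) k tau))
          (fun j psi x => D (formal_exp (r_coef R k) (laplace k tau) j psi) x) l)
       (exp_triv k D l tau)) /\
  trivialisation k (exp_triv k : opmap R n) /\
  mcg_invariant k (exp_triv k : opmap R n) /\
  exists2 alpha : nat -> nat -> R[i], normalised_solution k alpha &
    of_form k alpha (exp_triv k : opmap R n).
Proof.
have repE := @represented_exp_triv R n k.
split; [|split; [|split; [|split; [|split; [|split; [|split; [|split; [|split]]]]]]]].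
- move=> beta; split; first exact: normalised_exists.
  move=> alpha alpha' [a0 rec] [a0' rec'] b b'.
  apply: recursion_unique hk rec rec' _ => -[|r]; first by rewrite a0 a0'.
  by rewrite b // b'.
- exact: infinitely_many_trivialisations.
- move=> T T' alpha alpha' na na' fT fT' _ _.
  exact: (trivialisations_proportional hk na na' fT fT').
- by exists (branch k); exact: is_r_branch.
- move=> r hr; split=> [s ks|s v tau psi x s0 htau sp Ux].
    have s0 : s != 0 by rewrite -normr_gt0; apply: lt_trans ks; rewrite ltr0n.
    by rewrite (is_r_unique hk hr s0); exact: branch_expansion.
  exact: exp_ad_HW_cvg.
- move=> v tau l htau; split; first exact: formal_exp_dT_exists.
  exact: formal_HW_flat.
- by move=> D l tau dD htau; exact: exp_conjugation_triv.
- exact: (represented_trivialisation hk (normalised_alpha_exp R hk) repE).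
- exact: represented_mcg_invariant repE.
- exists (alpha_exp R k); first exact: normalised_alpha_exp.
  move=> D l tau dD htau; have [A rA _] := diffop_rep dD.
  have h := @represented_solution_map R n k (alpha_exp R k) D A l tau rA htau.
  exact: (rep_eq (repE D A l tau rA htau) h (erefl _)).
Qed.
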